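(* Let $b$ be a prime, $s\ge1$ an integer, $\alpha\ge2$ an integer, and $\boldsymbol{\gamma}=\{\gamma_u\}_{u\subseteq\{1,\ldots,s\}}$ a set of positive weights with $\gamma_\emptyset=1$. For any odd $r\ge3$, any $0<\epsilon<\alpha$ and any $0<\rho<1$, there is a constant $c_1=c_1(\alpha,\boldsymbol{\gamma},\epsilon)>0$, depending (for the given $b$ and $s$) only on $\alpha$, the weights $\gamma_u$ and $\epsilon$, such that for all $m,n\in\mathbb{N}$ with $n\ge\alpha m=\alpha\log_bN$, where $N=b^m$, all irreducible $p\in\mathbb{F}_b[x]$ with $\deg(p)=n$, and all $1\le q\le\infty$, \[ \mathbb{P}\left[e^{\mathrm{wor}}(M_{m,n,s,p,r}; \mathcal{F}^{\mathrm{sob}}_{s,\alpha,\boldsymbol{\gamma},q}) \le \frac{c_1(\alpha,\boldsymbol{\gamma},\epsilon)}{(\rho N)^{\alpha-\epsilon}}\right] \ge 1 - \frac{\rho^{(r+1)/2}}{4}, \] where the probability is over generating vectors $\boldsymbol{q}_1,\ldots,\boldsymbol{q}_r$ drawn independently and uniformly at random from $G_n^s$, with $G_n=\{g\in\mathbb{F}_b[x]\mid g\neq0,\ \deg(g)<n\}$.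
   Context: For an integrable function $f:[0,1)^s\to\mathbb{R}$ write $I_s(f)=\int_{[0,1)^s}f(\boldsymbol{x})\,d\boldsymbol{x}$, and for a finite point set $P$ of $N$ points (counted with multiplicity) write $Q_P(f)=\frac1N\sum_{\boldsymbol{x}\in P}f(\boldsymbol{x})$. $\mathbb{N}$ is the set of positive integers and $\mathbb{N}_0=\mathbb{N}\cup\{0\}$. $\mathbb{F}_b$ is the finite field of prime order $b$, identified with $\{0,1,\ldots,b-1\}$. An integer $h\in\mathbb{N}_0$ with $b$-adic expansion $h=\eta_0+\eta_1b+\cdots$ is associated with the polynomial $h(x)=\eta_0+\eta_1x+\cdots\in\mathbb{F}_b[x]$. High-order polynomial lattice point set: for $m\le n$, $p\in\mathbb{F}_b[x]$ with $\deg(p)=n$ and $\boldsymbol{q}=(q_1,\ldots,q_s)\in(\mathbb{F}_b[x])^s$ with $\deg(q_j)<n$, it consists of the $N=b^m$ points \[P_{m,n,s,p,\boldsymbol{q}}=\left\{\left(\nu_n\left(\frac{h(x)q_1(x)}{p(x)}\right),\ldots,\nu_n\left(\frac{h(x)q_s(x)}{p(x)}\right)\right)\in[0,1)^s\;\middle|\;h=0,\ldots,b^m-1\right\},\] where $\nu_n:\mathbb{F}_b((x^{-1}))\to[0,1)$ is defined on formal Laurent series by $\nu_n\left(\sum_{i=w}^\infty a_ix^{-i}\right)=\sum_{i=\max(1,w)}^n a_ib^{-i}$. Weighted Sobolev space: for an integer $\alpha\ge2$, $1\le q\le\infty$ and positive weights $\boldsymbol{\gamma}=\{\gamma_u\}_{u\subseteq\{1,\ldots,s\}}$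 with $\gamma_\emptyset=1$, $\mathcal{F}^{\mathrm{sob}}_{s,\alpha,\boldsymbol{\gamma},q}$ is the Banach space of (not necessarily periodic) smooth functions $f:[0,1)^s\to\mathbb{R}$ with the norm \[\|f\|^{\mathrm{sob}}_{s,\alpha,\boldsymbol{\gamma},q}=\sup_{u\subseteq\{1,\ldots,s\}}\gamma_u^{-1}\left(\sum_{v\subseteq u}\sum_{\boldsymbol{\tau}_{u\setminus v}\in\{1,\ldots,\alpha\}^{|u\setminus v|}}\int_{[0,1)^{|v|}}\left|\int_{[0,1)^{s-|v|}}f^{(\boldsymbol{\tau}_{u\setminus v},\boldsymbol{\alpha}_v,\boldsymbol{0})}(\boldsymbol{x})\,d\boldsymbol{x}_{-v}\right|^q d\boldsymbol{x}_v\right)^{1/q}\] (with the usual modification for $q=\infty$). Here $(\boldsymbol{\tau}_{u\setminus v},\boldsymbol{\alpha}_v,\boldsymbol{0})$ is the vector $\boldsymbol{h}\in\mathbb{N}_0^s$ with $h_j=\tau_j$ if $j\in u\setminus v$, $h_j=\alpha$ if $j\in v$ and $h_j=0$ otherwise; $f^{(\boldsymbol{h})}$ is the mixed partial derivative of order $\boldsymbol{h}$; $\boldsymbol{x}_v=(x_j)_{j\in v}$ and $\boldsymbol{x}_{-v}=(x_j)_{j\in\{1,\ldots,s\}\setminus v}$. (The scalar $q$ is an integrability exponent, unrelated to the polynomial vectors $\boldsymbol{q}_\ell$.) Median rule: given $\boldsymbol{q}_1,\ldots,\boldsymbol{q}_r$, \[M_{m,n,s,p,r}(f)=\operatorname{median}\left(Q_{P_{m,n,s,p,\boldsymbol{q}_1}}(f),\ldots,Q_{P_{m,n,s,p,\boldsymbol{q}_r}}(f)\right).\]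 Its worst-case error is the random variable (a function of $\boldsymbol{q}_1,\ldots,\boldsymbol{q}_r$) \[e^{\mathrm{wor}}(M_{m,n,s,p,r};\mathcal{F}^{\mathrm{sob}}_{s,\alpha,\boldsymbol{\gamma},q})=\sup_{f\in\mathcal{F}^{\mathrm{sob}}_{s,\alpha,\boldsymbol{\gamma},q},\ \|f\|^{\mathrm{sob}}_{s,\alpha,\boldsymbol{\gamma},q}\le1}|M_{m,n,s,p,r}(f)-I_s(f)|,\] i.e. the vectors are drawn first and then the supremum over $f$ is taken. *)

(* Defs.v *)
From HB Require Import structures.
From mathcomp Require Import all_boot all_order all_algebra zify.
From mathcomp Require Import all_classical all_reals all_analysis ess_sup_inf.

Set Implicit Arguments.
Unset Strict Implicit.
Unset Printing Implicit Defensive.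

Import Order.TTheory GRing.Theory Num.Theory.
Import numFieldNormedType.Exports.

Local Open Scope classical_set_scope.
Local Open Scope ring_scope.

Definition rV_display : measure_display -> measure_display.
Proof. exact. Qed.

(* Row vectors carry the sigma-algebra generated by the coordinates, as the
   library does for [n.-tuple T]; for [T = R] these are the Borel sets of R^n. *)
Section measurable_rV.
Context {d} {T : sigmaRingType d} (n : nat).

Let coor : 'I_n -> 'rV[T]_n -> T := fun i x => x ord0 i.

Let rV_set0 : g_sigma_preimage coor set0.
Proof. exact: sigma_algebra0. Qed.

Let rV_setC A : g_sigma_preimage coor A -> g_sigma_preimage coor (~` A).
Proof. exact: sigma_algebraC. Qed.

Let rV_bigcup (F : (set 'rV[T]_n)^nat) : (forall i, g_sigma_preimage coor (F i)) ->
  g_sigma_preimage coor (\bigcup_i (F i)).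
Proof. exact: sigma_algebra_bigcup. Qed.

HB.instance Definition _ := @isMeasurable.Build (rV_display d)
  'rV[T]_n (g_sigma_preimage coor) rV_set0 rV_setC rV_bigcup.
End measurable_rV.

Lemma measurable_rV_coord d (T : measurableType d) n (i : 'I_n) :
  measurable_fun [set: 'rV[T]_n] (fun x => x ord0 i).
Proof.
move=> _ Y mY; rewrite setTI; apply: sub_sigma_algebra => /=.
rewrite -bigcup_seq/=; exists i => /=; first by rewrite mem_index_enum.
by exists Y => //; rewrite setTI.
Qed.

Lemma measurable_fun_rVP d1 d2 (T1 : measurableType d1)
    (T2 : measurableType d2) n (f : T1 -> 'rV[T2]_n) :
  (forall i, measurable_fun [set: T1] (fun x => f x ord0 i)) ->
  measurable_fun [set: T1] f.
Proof.
move=> mf _ A mA.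
suff: image_set_system setT f measurable A by [].
apply: mA; split; first exact/sigma_algebra_image/sigma_algebra_measurable.
rewrite -bigcup_seq; apply: bigcup_sub => i _ _ [B mB <-].
by rewrite /image_set_system/= !setTI; have := mf i measurableT B mB; rewrite setTI.
Qed.

Section lebesgue_rV.
Context {R : realType}.

Definition rV_cons n (p : measurableTypeR R * 'rV[R]_n) : 'rV[R]_n.+1 :=
  \row_i (if unlift ord0 i is Some j then p.2 ord0 j else p.1).

Let rV_uncons n (x : 'rV[R]_n.+1) : measurableTypeR R * 'rV[R]_n :=
  (x ord0 ord0, \row_j x ord0 (lift ord0 j)).

Let rV_consK n : cancel (@rV_cons n) (@rV_uncons n).
Proof.
move=> [t x]; congr pair; first by rewrite mxE unlift_none.
by apply/rowP => j; rewrite !mxE liftK.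
Qed.

Lemma measurable_rV_cons n : measurable_fun setT (@rV_cons n).
Proof.
apply: measurable_fun_rVP => i.
case: (unliftP ord0 i) => [j|] ->.
- rewrite [X in measurable_fun _ X](_ : _ = (fun p : measurableTypeR R * 'rV[R]_n => p.2 ord0 j)).
    exact: (measurableT_comp (measurable_rV_coord j)).
  by apply/funext => p; rewrite mxE liftK.
- rewrite [X in measurable_fun _ X](_ : _ = fst); first exact: measurable_fst.
  by apply/funext => p; rewrite mxE unlift_none.
Qed.

Let measurable_rV_uncons n : measurable_fun setT (@rV_uncons n).
Proof.
apply/measurable_fun_pairP; split; first exact: measurable_rV_coord.
apply: measurable_fun_rVP => i /=.
rewrite [X in measurable_fun _ X](_ : _ = (fun x : 'rV[R]_n.+1 => x ord0 (lift ord0 i))).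
  exact: measurable_rV_coord.
by apply/funext => x; rewrite mxE.
Qed.

Section step.
Context n (mu : {sigma_finite_measure set 'rV[R]_n -> \bar R}).

Definition lebesgue_rV_step : set 'rV[R]_n.+1 -> \bar R :=
  pushforward (lebesgue_measure \x mu)%E (@rV_cons n).

Let mcons := @measurable_rV_cons n.

Let step0 : lebesgue_rV_step set0 = 0%E.
Proof. exact: measure0. Qed.

Let step_ge0 A : (0 <= lebesgue_rV_step A)%E.
Proof. exact: measure_ge0. Qed.

Let step_sigma_additive : semi_sigma_additive lebesgue_rV_step.
Proof. exact: measure_semi_sigma_additive. Qed.

HB.instance Definition _ := isMeasure.Build _ _ _ lebesgue_rV_step
  step0 step_ge0 step_sigma_additive.

Let step_sigma_finite : sigma_finite setT lebesgue_rV_step.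
Proof.
have /sigma_finiteP[F [FT ndF Foo]] := sigma_finiteT (@lebesgue_measure R).
have /sigma_finiteP[G [GT ndG Goo]] := sigma_finiteT mu.
exists (fun k => @rV_uncons n @^-1` (F k `*` G k)).
  rewrite -preimage_bigcup (_ : \bigcup_k _ = setT) ?preimage_setT//.
  rewrite -subTset => -[t x] _.
  have [i _ Fi] : (\bigcup_k F k) t by rewrite -FT.
  have [j _ Gj] : (\bigcup_k G k) x by rewrite -GT.
  exists (maxn i j) => //; split.
  - by move: t Fi; exact/subsetPset/ndF/leq_maxl.
  - by move: x Gj; exact/subsetPset/ndG/leq_maxr.
move=> k; have [mF Fk] := Foo k; have [mG Gk] := Goo k; split.
  rewrite -[X in measurable X]setTI.
  by apply: measurable_rV_uncons => //; exact: measurableX.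
rewrite /lebesgue_rV_step /pushforward -comp_preimage.
rewrite (_ : _ \o _ = id) ?preimage_id; last first.
  by apply/funext => p; exact: rV_consK.
by rewrite product_measure1E// lte_mul_pinfty// ge0_fin_numE.
Qed.

HB.instance Definition _ := Measure_isSigmaFinite.Build _ _ _
  lebesgue_rV_step step_sigma_finite.
End step.

(* Lebesgue measure on R^n: the n-fold product of [lebesgue_measure]. *)
Fixpoint lebesgue_rV n : {sigma_finite_measure set 'rV[R]_n -> \bar R} :=
  if n is k.+1 then lebesgue_rV_step (lebesgue_rV k) else \d_(0 : 'rV[R]_0).

End lebesgue_rV.

(* Formal Laurent series in x^-1: [lcoef L i] is the coefficient of x^(-i). *)
Record laurent (F : nzRingType) := Laurent {
  lcoef : int -> F;
  lcoef_bounded : exists w : int, forall i, i < w -> lcoef i = 0 }.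

Section laurent_quotient.
Context {F : fieldType}.
Implicit Types f g : {poly F}.

(* The coefficient of x^(-i) in f / g is that of x^0 in x^i f / g, hence can be
   read off the polynomial part of x^i f / g (of f / g if i < 0); [lquotP] below
   states that the resulting series is indeed the quotient. *)
Definition lquot_coef f g (i : int) : F :=
  match i with
  | Posz k => ((f * 'X^k) %/ g)`_0
  | Negz k => (f %/ g)`_k.+1
  end.

Fact lquot_bounded f g :
  exists w : int, forall i, i < w -> lquot_coef f g i = 0.
Proof.
exists (- (size (f %/ g))%:Z) => -[k|k] /= wk; first lia.
by rewrite nth_default//; lia.
Qed.

Definition lquot f g : laurent F := Laurent (lquot_bounded f g).

Let divp_shift f g N k j : g != 0 ->
  ((f * 'X^(N + k)) %/ g)`_(j + k) = ((f * 'X^N) %/ g)`_j.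
Proof.
move=> g0; rewrite exprD mulrA {1}(divp_eq (f * 'X^N) g) mulrDl mulrAC.
rewrite divp_addl_mul// coefD coefMXn ltnNge leq_addl/= addnK.
rewrite [X in _ + X]nth_default ?addr0//.
have [->|r0] := eqVneq ((f * 'X^N) %% g) 0; first by rewrite mul0r div0p size_poly0.
rewrite size_divp// size_Mmonic ?monicXn// size_polyXn addnS/=.
have : (size ((f * 'X^N) %% g)%R < size g)%N by rewrite ltn_modp.
by move: (size (_ %% _)%R) (size g) => a c; lia.
Qed.

Let lquot_coefE f g N j : g != 0 ->
  lquot_coef f g (N%:Z - j%:Z) = ((f * 'X^N) %/ g)`_j.
Proof.
move=> g0; have [jN|Nj] := leqP j N.
  rewrite subzn//= -(divp_shift f (N - j)%N j 0 g0).
  by rewrite subnK.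
rewrite (_ : _ - _ = Negz (j - N).-1) /=; last lia.
rewrite -[f in LHS]mulr1 -(expr0 'X) prednK ?subn_gt0//.
by rewrite -(divp_shift f 0 N _ g0) add0n subnK// ltnW.
Qed.

(* g * (f / g) = f in F((x^-1)), coefficient by coefficient. *)
Lemma lquotP f g (i : int) : g != 0 ->
  \sum_(k < size g) g`_k * lcoef (lquot f g) (i + k%:Z) =
  match i with Posz 0 => f`_0 | Posz _ => 0 | Negz k => f`_k.+1 end.
Proof.
move=> g0; pose N := (`|i| + size g)%N; pose D := `|N%:Z - i|%N.
have sD : (size g <= D)%N by rewrite /D /N; lia.
have coefi (k : 'I_(size g)) : lcoef (lquot f g) (i + k%:Z) =
    ((f * 'X^N) %/ g)`_(D - k).
  rewrite -lquot_coefE//=; congr lquot_coef.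
  case: k => k /=; rewrite /D /N; clear; move: (size g) => c kg; lia.
under eq_bigr do rewrite coefi.
transitivity (g * ((f * 'X^N) %/ g))`_D.
  rewrite coefM (big_ord_widen D.+1
    (fun k => g`_k * ((f * 'X^N) %/ g)`_(D - k)) (leqW sD)) big_mkcond/=.
  apply: eq_bigr => k _; case: ltnP => // gk.
  by rewrite nth_default ?mul0r.
have -> : g * ((f * 'X^N) %/ g) = f * 'X^N - (f * 'X^N) %% g.
  by rewrite {2}(divp_eq (f * 'X^N) g) addrK mulrC.
rewrite coefB [X in _ - X]nth_default ?subr0; last first.
  by apply: leq_trans sD; rewrite ltnW// ltn_modp.
rewrite coefMXn /D /N; case: i {coefi D N sD} => [[|k]|k]; case: ltnP; try lia.
- by move=> _; congr _`_ _; lia.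
- by [].
- by move=> _; congr _`_ _; lia.
Qed.

End laurent_quotient.

(* The elements of 'F_b are the ordinals 0, ..., b - 1 when b is prime. *)
Definition nu {R : realType} (b n : nat) (L : laurent 'F_b) : R :=
  \sum_(1 <= i < n.+1) (lcoef L i%:Z : nat)%:R / b%:R ^+ i.

(* The digits of h of index i >= h vanish, as h < b ^ h for b >= 2. *)
Definition digit_poly (b h : nat) : {poly 'F_b} :=
  \poly_(i < h) ((h %/ b ^ i) %% b)%:R.

Section quadrature.
Context {R : realType} {s b : nat} (m n : nat) (p : {poly 'F_b}).

Definition lattice_point (q : 'I_s -> {poly 'F_b}) (h : nat) : 'rV[R]_s :=
  \row_j nu n (lquot (digit_poly b h * q j) p).

Definition lattice_rule (q : 'I_s -> {poly 'F_b}) (f : 'rV[R]_s -> R) : R :=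
  (b ^ m)%:R^-1 * \sum_(0 <= h < b ^ m) f (lattice_point q h).

(* The middle order statistic: only meant for sequences of odd length. *)
Definition median (l : seq R) : R := nth 0 (sort <=%R l) (size l)./2.

Definition median_rule (r : nat) (q : 'I_r -> 'I_s -> {poly 'F_b})
    (f : 'rV[R]_s -> R) : R :=
  median [seq lattice_rule (q l) f | l <- enum 'I_r].

End quadrature.

Section sobolev.
Context {R : realType} {s : nat}.
Local Notation Rs := 'rV[R]_s.
Local Notation mu := (@lebesgue_rV R s).
Implicit Types (f g phi : Rs -> R) (h : 'I_s -> nat).

Definition cube : set Rs := [set x | forall j, 0 <= x ord0 j < 1].

Definition cube_integral f : R := \int[mu]_(x in cube) f x.

Definition partial (j : 'I_s) f : Rs -> R := 'D_(delta_mx ord0 j) f.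

Definition smooth f := forall js : seq 'I_s,
  let g := foldr partial f js in
  continuous g /\ forall x j, derivable g x (delta_mx ord0 j).

(* Smooth functions with compact support in the open cube (0,1)^s. *)
Definition test_function phi := smooth phi /\
  exists2 d : R, 0 < d & forall x, phi x != 0 ->
    forall j, d <= x ord0 j <= 1 - d.

Definition mixed_partial h f : Rs -> R :=
  foldr (fun j => iter (h j) (partial j)) f (enum 'I_s).

(* g is integrable and is the mixed partial derivative of f of order h on (0,1)^s
   in the sense of distributions. *)
Definition weak_mixed_partial h f g :=
  mu.-integrable cube (EFin \o g) /\
  forall phi, test_function phi ->
    cube_integral (fun x => f x * mixed_partial h phi x) =
    (-1) ^+ (\sum_j h j) * cube_integral (fun x => g x * phi x).

(* f^(h), well-defined up to a null set whenever it exists. *)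
Definition sob_deriv h f : Rs -> R :=
  xget (fun=> 0) [set g | weak_mixed_partial h f g].

Section norm.
Variables (alpha : nat) (gamma : {set 'I_s} -> R).
Implicit Types (u v : {set 'I_s}) (tau : {ffun 'I_s -> 'I_alpha.+1}).

(* A vector of {1..alpha}^w, extended by 0 outside w. *)
Definition tau_on (w : {set 'I_s}) tau :=
  [forall j, (tau j != 0%N :> nat) == (j \in w)].

Definition sob_order v tau (j : 'I_s) : nat :=
  if j \in v then alpha else tau j.

Definition glue v (x y : Rs) : Rs :=
  \row_j (if j \in v then x ord0 j else y ord0 j).

(* The integral over x_(-v) of f^(tau, alpha_v, 0), as a function of x_v. The
   integral runs over the whole cube, but the integrand does not depend on the
   coordinates y_j with j \in v, which thus only contribute a factor 1; likewise
   for the coordinates outside v in the outer integrals below. *)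
Definition sob_average f v tau (x : Rs) : R :=
  \int[mu]_(y in cube) sob_deriv (sob_order v tau) f (glue v x y).

Definition sob_local_norm (q : \bar R) f u : \bar R :=
  match q with
  | q'%:E => ((\sum_(v : {set 'I_s} | v \subset u)
      \sum_(tau | tau_on (u :\: v) tau)
        \int[mu]_(x in cube) (`|sob_average f v tau x| `^ q')%:E) `^ q'^-1)%E
  | +oo%E => \big[maxe/0%E]_(v : {set 'I_s} | v \subset u)
      \big[maxe/0%E]_(tau | tau_on (u :\: v) tau)
        ess_sup mu ((fun x => `|sob_average f v tau x|%:E) \_ cube)
  | -oo%E => 0%E
  end.

Definition sob_norm (q : \bar R) f : \bar R :=
  \big[maxe/0%E]_(u : {set 'I_s}) ((gamma u)^-1%:E * sob_local_norm q f u)%E.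

(* Functions are defined on R^s, but only their values on the cube matter. *)
Definition sob_space (q : \bar R) : set (Rs -> R) :=
  [set f | {within cube, continuous f} /\
    (forall h, (forall j, (h j <= alpha)%N) ->
       exists g, weak_mixed_partial h f g) /\
    (sob_norm q f < +oo)%E].

Definition worst_case_error (q : \bar R) (M : (Rs -> R) -> R) : \bar R :=
  ereal_sup [set `|M f - cube_integral f|%:E
            | f in [set f | sob_space q f /\ (sob_norm q f <= 1)%E]].

End norm.
End sobolev.

Definition finite_uniform_prob {R : realType} {T : finType} (A : {set T})
    (E : T -> Prop) : R := #|[pred t in A | `[< E t >]]|%:R / #|A|%:R.

(* The r-tuples of vectors of (G_n)^s; the uniform distribution on this product
   set makes the r vectors independent and uniform on (G_n)^s. *)
Definition generating_vectors (b n s r : nat) :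
    {set {ffun 'I_r -> {ffun 'I_s -> {poly_n 'F_b}}}} :=
  finset (fun Q : {ffun 'I_r -> {ffun 'I_s -> {poly_n 'F_b}}} =>
    [forall l, forall j, Q l j != 0]).

(* Main.v *)
Require Import Defs.
From mathcomp Require Import all_boot all_order all_algebra ring lra zify.
From mathcomp Require Import all_classical all_reals all_analysis ess_sup_inf measurable_realfun.

Set Implicit Arguments.
Unset Strict Implicit.
Unset Printing Implicit Defensive.

Import Order.TTheory GRing.Theory Num.Theory.
Import numFieldNormedType.Exports.

Local Open Scope classical_set_scope.
Local Open Scope ring_scope.

(** * A *)

Section boxes.
Context {R : realType}.
Local Notation leb := (@lebesgue_measure R).

Definition box n (A : 'I_n -> set R) : set 'rV[R]_n :=
  [set x | forall j, A j (x ord0 j)].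

Lemma measurable_box n (A : 'I_n -> set (measurableTypeR R)) :
  (forall j, measurable (A j)) -> measurable (box A).
Proof.
move=> mA.
have -> : box A = \big[setI/setT]_(j < n) ((fun x : 'rV[R]_n => x ord0 j) @^-1` A j).
  rewrite -bigcap_seq; apply/seteqP; split => x /= Ax.
    by move=> j _ /=; exact: Ax.
  by move=> j; apply: (Ax j); rewrite /= mem_index_enum.
apply: bigsetI_measurable => j _.
rewrite -[X in measurable X]setTI.
exact: (@measurable_rV_coord _ (measurableTypeR R) n j).
Qed.

Lemma rV_measurableE n : @measurable _ 'rV[R]_n =
  <<s [set box A | A in [set A : 'I_n -> set (measurableTypeR R) | forall j, measurable (A j)]] >>.
Proof.
apply/seteqP; split; last first.
  apply: smallest_sub; first exact: sigma_algebra_measurable.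
  by move=> _ [A mA <-]; exact: measurable_box.
apply: smallest_sub; first exact: smallest_sigma_algebra.
rewrite -bigcup_seq; apply: bigcup_sub => i _ _ [B mB <-].
apply: sub_sigma_algebra; exists (fun j => if j == i then B else setT).
  by move=> j /=; case: ifP.
rewrite setTI; apply/seteqP; split => x /=.
  by move=> /(_ i); rewrite eqxx.
by move=> Bx j; case: eqP => [->|].
Qed.

Lemma lebesgue_rV_box n (A : 'I_n -> set (measurableTypeR R)) :
  (forall j, measurable (A j)) ->
  (@lebesgue_rV R n) (box A) = (\prod_(j < n) leb (A j))%E.
Proof.
elim: n A => [|n IH] A mA.
  rewrite big_ord0 /= diracE mem_set//=.
  by case.
rewrite big_ord_recl /= /lebesgue_rV_step /pushforward.
have -> : @rV_cons R n @^-1` box A =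
   A ord0 `*` box (fun j => A (lift ord0 j)).
  apply/seteqP; split => [[t x]|[t x]] /=.
    move=> H; split => /=.
      by have := H ord0; rewrite mxE unlift_none.
    by move=> j; have := H (lift ord0 j); rewrite mxE liftK.
  move=> [/= H1 H2] j; rewrite mxE.
  by case: unliftP => [i ->|->] //=; exact: H2.
rewrite product_measure1E//; last exact: measurable_box.
by rewrite IH.
Qed.

Lemma cubeE n : @cube R n = box (fun=> `[0, 1[%classic).
Proof. by apply/seteqP; split => x /= H j; have := H j; rewrite /= in_itv. Qed.

Lemma measurable_cube n : measurable (@cube R n).
Proof. by rewrite cubeE; apply: measurable_box => j; exact: measurable_itv. Qed.

Lemma lebesgue_rV_cube n : (@lebesgue_rV R n) (@cube R n) = 1%E.
Proof.
rewrite cubeE lebesgue_rV_box; last by move=> j; exact: measurable_itv.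
by rewrite big1// => j _; rewrite lebesgue_measure_itv/= lte_fin ltr01 sube0.
Qed.

Lemma lebesgue_rV_cubeI n (A : 'I_n -> set (measurableTypeR R)) :
  (forall j, measurable (A j)) ->
  (@lebesgue_rV R n) (cube `&` box A) =
  (\prod_(j < n) leb (`[0%R, 1%R[%classic `&` A j))%E.
Proof.
move=> mA; rewrite -lebesgue_rV_box; last first.
  by move=> j; apply: measurableI => //; exact: measurable_itv.
rewrite cubeE; congr (lebesgue_rV _ _); apply/seteqP; split => x /=.
  by move=> [H1 H2] j; split; [exact: H1|exact: H2].
by move=> H; split => j; have [] := H j.
Qed.

Definition open_cube n : set 'rV[R]_n := [set x | forall j, 0 < x ord0 j < 1].

Lemma cube_boundary_negligible n :
  {ae @lebesgue_rV R n, forall x, cube x -> open_cube x}.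
Proof.
pose N j : set 'rV[R]_n := cube `&` box (fun i => if i == j then [set 0] else setT).
have mA (j i : 'I_n) : measurable ((if i == j then [set 0] else setT) : set (measurableTypeR R)).
  by case: ifP => _ //; exact: measurable_set1.
have NN j : (@lebesgue_rV R n).-negligible (N j).
  apply/negligibleP; first by apply: measurableI; [exact: measurable_cube|exact: measurable_box].
  apply: (etrans (lebesgue_rV_cubeI (mA j))); rewrite (bigD1 j)//= eqxx.
  rewrite [X in (X * _)%E = _](_ : _ = 0%E) ?mul0e//.
  apply/eqP; rewrite eq_le measure_ge0 andbT.
  rewrite -(@lebesgue_measure_set1 R 0) le_measure// ?inE.
    by apply: measurableI; [exact: measurable_itv|exact: measurable_set1].
  exact: measurable_set1.
suff : (@lebesgue_rV R n).-negligible (\big[setU/set0]_(j < n) N j).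
  apply: negligibleS => x /= /not_implyP[cx].
  move/existsNP => [j /negP].
  have := cx j => /andP[x0 x1].
  rewrite x1 andbT -leNgt => xle0.
  rewrite -bigcup_seq; exists j; first by rewrite /= mem_index_enum.
  split => // i /=; case: eqP => // ->; apply/eqP.
  by rewrite eq_le x0 xle0.
elim/big_rec : _ => [|j x _ H]; first exact: negligible_set0.
exact: negligibleU.
Qed.

Lemma measurable_glue n (v : {set 'I_n}) :
  measurable_fun setT (fun z : 'rV[R]_n * 'rV[R]_n =>
     (Defs.glue v z.1 z.2 : 'rV[R]_n)).
Proof.
apply: measurable_fun_rVP => i.
have -> : (fun z : 'rV[R]_n * 'rV[R]_n =>
    (Defs.glue v z.1 z.2 : 'rV[R]_n) ord0 i) =
   (if i \in v then (fun x : 'rV[R]_n => x ord0 i) \o fst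
    else (fun x : 'rV[R]_n => x ord0 i) \o snd).
  by apply/funext => z; rewrite mxE; case: ifP.
by case: ifP => _; apply: measurableT_comp => //; exact: measurable_rV_coord.
Qed.

Lemma glue_cube n (v : {set 'I_n}) (x y : 'rV[R]_n) :
  cube x -> cube y -> cube (Defs.glue v x y).
Proof. by move=> cx cy j; rewrite mxE; case: ifP. Qed.

Section glue_measure.
Variables (n : nat) (v : {set 'I_n}).
Local Notation Rn := 'rV[R]_n.
Local Notation mu := (@lebesgue_rV R n).
Let S (z : Rn * Rn) : Rn := Defs.glue v z.1 z.2.
Let cc : set (Rn * Rn) := cube `*` cube.

Let mcc : measurable cc.
Proof. by apply: measurableX; exact: measurable_cube. Qed.

Let mS : measurable_fun setT S.
Proof. exact: measurable_glue. Qed.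

Lemma glue_measure (A : set Rn) : measurable A ->
  (mu \x mu)%E (S @^-1` A `&` cc) = mu (A `&` cube).
Proof.
move=> mA.
pose mr := mrestr (mu \x mu)%E mcc.
have mcube : measurable (cube : set Rn) by exact: measurable_cube.
pose mc := mrestr mu mcube.
suff : pushforward mr S A = mc A by [].
apply: (@measure_unique _ R Rn
  [set box A | A in [set A : 'I_n -> set (measurableTypeR R) | forall j, measurable (A j)]]
  (fun=> setT) (@rV_measurableE n) _ _ _ (pushforward mr S) (mrestr mu mcube)) => //.
- move=> _ _ [B mB <-] [C mC <-]; exists (fun j => B j `&` C j).
    by move=> j; apply: measurableI; [exact: mB|exact: mC].
  apply/seteqP; split => x /=; first by move=> H; split=> j; case: (H j).
  by move=> [H1 H2] j; split.
- by move=> i; exists (fun=> setT) => //; apply/seteqP.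
- by rewrite bigcup_const.
- move=> _ [B mB <-]; change ((mu \x mu)%E (S @^-1` box B `&` cc) = mu (box B `&` cube)).
  have -> : S @^-1` box B `&` cc =
      (cube `&` box (fun j => if j \in v then B j else setT)) `*`
      (cube `&` box (fun j => if j \in v then setT else B j)).
    apply/seteqP; split => [[x y]|[x y]] /=.
      move=> [H [cx cy]]; split; split => // j; have := H j; rewrite mxE; case: ifP => //.
    move=> [[cx Hx] [cy Hy]]; split => // j; rewrite mxE; have := Hx j; have := Hy j.
    by case: ifP.
  have mB1 (j : 'I_n) : measurable (if j \in v then B j else setT) by case: ifP => // _; exact: mB.
  have mB2 (j : 'I_n) : measurable (if j \in v then setT else B j) by case: ifP => // _; exact: mB.
  rewrite product_measure1E; last 2 first.
    by apply: measurableI; [exact: measurable_cube|exact: measurable_box].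
    by apply: measurableI; [exact: measurable_cube|exact: measurable_box].
  rewrite [in RHS]setIC; transitivity (\prod_(j < n) leb (`[0%R, 1%R[%classic `&` B j))%E; last first.
    by symmetry; apply: lebesgue_rV_cubeI.
  transitivity ((\prod_(j < n) leb (`[0%R, 1%R[%classic `&` (if j \in v then B j else setT))) *
    (\prod_(j < n) leb (`[0%R, 1%R[%classic `&` (if j \in v then setT else B j))))%E.
    by congr (_ * _)%E; apply: lebesgue_rV_cubeI.
  rewrite -big_split /=; apply: eq_bigr => j _.
  have l1 : leb (`[0%R, 1%R[%classic `&` setT) = 1%E.
    by rewrite setIT lebesgue_measure_itv/= lte_fin ltr01 sube0.
  by case: ifP => _; rewrite l1 ?mule1 ?mul1e.
- move=> _; change ((mu \x mu)%E (S @^-1` setT `&` cc) < +oo)%E.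
  rewrite preimage_setT setTI.
  rewrite product_measure1E//; try exact: measurable_cube.
  rewrite [X in (X < _)%E](_ : _ = 1%E) ?ltry// -[RHS]mule1.
  by congr (_ * _)%E; exact: lebesgue_rV_cube.
Qed.

Lemma ge0_glue_integral (G : Rn -> \bar R) : @measurable_fun _ _ Rn _ setT G ->
  (forall x, (0 <= G x)%E) ->
  (\int[mu]_(x in cube) G x = \int[(mu \x mu)%E]_(z in cc) G (S z))%E.
Proof.
move=> mG G0.
pose mr := mrestr (mu \x mu)%E mcc.
transitivity (\int[pushforward mr S]_(x in cube) G x)%E.
  apply: eq_measure_integral => A mA Ac.
  change (mu A = (mu \x mu)%E (S @^-1` A `&` cc)); rewrite glue_measure//.
  by congr (mu _); exact/esym/setIidl.
have mcube : measurable (cube : set Rn) by exact: measurable_cube.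
rewrite (@ge0_integral_pushforward _ _ _ _ _ _ mS mr cube G mcube); last 2 first.
- exact: measurable_funTS.
- by move=> x _; exact: G0.
have mD : measurable (S @^-1` cube).
  by rewrite -[X in measurable X]setTI; apply: mS => //; exact: measurable_cube.
have mN : measurable (~` cc) by exact: measurableC.
have mGS : measurable_fun (S @^-1` cube) (G \o S).
  by apply: measurable_funTS; exact: measurableT_comp.
have N0 : mr (~` cc) = 0%E by rewrite /mr /mrestr setICl measure0.
have GS0 : forall z, (S @^-1` cube) z -> (0 <= (G \o S) z)%E by move=> z _; exact: G0.
rewrite (ge0_negligible_integral mN mD mGS GS0 N0).
have -> : S @^-1` cube `\` ~` cc = cc.
  rewrite setDE setCK setIC; apply: setIidl => -[x y] [cx cy]; exact: glue_cube.
apply: eq_measure_integral => A mA Ac; rewrite /mr /mrestr.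
by congr ((mu \x mu)%E _); exact: setIidl.
Qed.

Lemma glue_integral (G : Rn -> \bar R) : @measurable_fun _ _ Rn _ setT G ->
  (\int[mu]_(x in cube) G x = \int[(mu \x mu)%E]_(z in cc) G (S z))%E.
Proof.
move=> mG; rewrite [LHS]integralE [RHS]integralE.
congr (_ - _)%E.
- rewrite (ge0_glue_integral (measurable_funepos mG))//.
  by apply: eq_integral => z _; rewrite (funepos_comp G S).
- rewrite (ge0_glue_integral (measurable_funeneg mG))//.
  by apply: eq_integral => z _; rewrite (funeneg_comp G S).
Qed.

Lemma glue_fubini (g : Rn -> R) : mu.-integrable cube (EFin \o g) ->
  let F x := (\int[mu]_(y in cube) (g (S (x, y)))%:E)%E in
  [/\ measurable_fun cube F,
   (\int[mu]_(x in cube) (g x)%:E = \int[mu]_(x in cube) F x)%E &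
   {ae mu, forall x, cube x -> mu.-integrable cube (fun y => (g (S (x, y)))%:E)}].
Proof.
move=> ig F.
have mcube : measurable (cube : set Rn) by exact: measurable_cube.
pose G : Rn -> \bar R := (EFin \o g) \_ cube.
have mG : @measurable_fun _ _ Rn _ setT G.
  have [mg _] := integrableP _ _ _ ig.
  exact: (measurable_restrictT _ mcube).1.
pose H : Rn * Rn -> \bar R := (G \o S) \_ cc.
have mH : measurable_fun setT H.
  apply: (measurable_restrictT _ mcc).1; apply: measurable_funTS.
  exact: measurableT_comp mG mS.
have HE x y : cube x -> cube y -> H (x, y) = (g (S (x, y)))%:E.
  move=> cx cy; rewrite /H patchE mem_set//= /G patchE mem_set//.
  exact: glue_cube.
have H0 x y : ~ cube x -> H (x, y) = 0%E.
  by move=> cx; rewrite /H patchE memNset// => -[].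
have H0' x : H \o pair x = ((H \o pair x) \_ cube).
  apply/funext => y; rewrite patchE; case: ifPn => //=.
  by rewrite notin_setE => cy; rewrite /H patchE memNset// => -[].
have iH : (mu \x mu)%E.-integrable setT H.
  apply/integrableP; split => //.
  have -> : (\int[(mu \x mu)%E]_z `|H z| = \int[mu]_(x in cube) `|G x|)%E.
    have maG : @measurable_fun _ _ Rn (\bar R) setT (abse \o G).
      by apply: measurableT_comp mG; exact: abse_measurable.
    rewrite (ge0_glue_integral maG); last by move=> x; exact: abse_ge0.
    by rewrite [RHS]integral_mkcond; apply: eq_integral => z _; rewrite /H !patchE; case: ifP => //; rewrite abse0.
  have [_ igoo] := integrableP _ _ _ ig. apply: le_lt_trans igoo.
  rewrite le_eqVlt; apply/orP; left; apply/eqP.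
  by apply: eq_integral => x xc; rewrite /G patchE xc.
have FE x : cube x -> fubini_F mu H x = F x.
  move=> cx; rewrite /fubini_F /F [RHS]integral_mkcond; apply: eq_integral => y _.
  rewrite patchE; case: ifPn => yc; first by rewrite HE//; exact/set_mem.
  by have := congr1 (@^~ y) (H0' x); rewrite /= patchE (negbTE yc).
have F0 x : ~ cube x -> fubini_F mu H x = 0%E.
  by move=> cx; rewrite /fubini_F; apply: integral0_eq => y _; exact: H0.
have intF : (\int[mu]_(x in cube) F x = \int[mu]_x fubini_F mu H x)%E.
  rewrite integral_mkcond; apply: eq_integral => x _; rewrite patchE.
  by case: ifPn => [/set_mem cx|]; [rewrite FE|rewrite notin_setE => /F0].
split.
- apply: (@eq_measurable_fun _ _ _ _ _ (fubini_F mu H)).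
    by move=> x /set_mem; exact: FE.
  apply: measurable_funTS; exact: (measurable_fubini_F iH).
- transitivity (\int[mu]_(x in cube) G x)%E.
    by apply: eq_integral => x xc; rewrite /G patchE xc.
  rewrite (glue_integral mG) intF.
  by rewrite (integral12_prod_meas1 iH) integral_mkcond.
- have := ae_integrable1 iH; apply: filterS => x /= + cx.
  move=> /(integrableS measurableT mcube (@subsetT _ _)); apply: eq_integrable => //.
  by move=> y /set_mem; exact: HE.
Qed.

Lemma glue_average_bound (g phi : Rn -> R) (K : R) : 0 <= K ->
  mu.-integrable cube (EFin \o g) -> measurable_fun cube phi ->
  (forall x, cube x -> `|phi x| <= K) ->
  (forall x y, cube x -> cube y -> phi (S (x, y)) = phi x) ->
  measurable_fun cube (fun x => \int[mu]_(y in cube) g (S (x, y))) /\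
  (`|\int[mu]_(x in cube) (g x * phi x)|%:E <=
   K%:E * \int[mu]_(x in cube) `|\int[mu]_(y in cube) g (S (x, y))|%:E)%E.
Proof.
move=> K0 ig mphi phiK phiS.
have mcube : measurable (cube : set Rn) by exact: measurable_cube.
have [mF _ aeF] := glue_fubini ig.
have mavg : measurable_fun cube (fun x => \int[mu]_(y in cube) g (S (x, y))).
  have mfine : measurable_fun [set: \bar R] (@fine R) by [].
  exact: measurableT_comp mfine mF.
split=> //.
have bphi : [bounded phi x | x in (cube : set Rn)].
  exists K; split => //; first exact: num_real.
  by move=> M KM x cx; apply: (le_trans (phiK x cx)); exact: ltW.
have igp : mu.-integrable cube (EFin \o (fun x => g x * phi x)).
  have := integrableMl mcube ig mphi bphi.
  by apply: eq_integrable => // x _; rewrite /= EFinM.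
have [mFp intFp aeFp] := glue_fubini igp.
rewrite EFin_normr_Rintegral// [X in (`|X|)%E]intFp.
apply: (le_trans (le_abse_integral _ _ _)) => //.
have mnavg : measurable_fun cube (fun x => `|\int[mu]_(y in cube) g (S (x, y))|%:E).
  by apply/measurable_EFinP; apply: measurableT_comp mavg.
rewrite -ge0_integralZl//.
apply: ae_ge0_le_integral => //.
- exact: measurableT_comp.
- by move=> x cx; rewrite mule_ge0// lee_fin.
- exact: measurable_funeM.
apply: filterS aeF => x /= + cx => /(_ cx) igx.
have -> : (\int[mu]_(y in cube) (g (S (x, y)) * phi (S (x, y)))%:E =
  (phi x * \int[mu]_(y in cube) g (S (x, y)))%:E)%E.
  rewrite EFinM fineK; last by apply: integrable_fin_num.
  rewrite -integralZl//; apply: eq_integral => y /set_mem cy.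
  by rewrite -EFinM phiS// mulrC.
by rewrite /= lee_fin normrM ler_wpM2r// phiK.
Qed.

End glue_measure.
End boxes.
Arguments open_cube {R n}.

(** * B *)

Section smooth_functions.
Context {R : realType}.
Implicit Types f g : R -> R.

Fixpoint Ck n f : Prop :=
  if n is k.+1 then (forall x, derivable f x 1) /\ Ck k (derive1 f) else continuous f.

Definition smooth1 f := forall n, Ck n f.

Lemma CkS n f : Ck n.+1 f -> Ck n f.
Proof.
elim: n f => [|n IH] f /= [df cf] => [x|]; last by split => //; exact: IH.
exact/differentiable_continuous/derivable1_diffP.
Qed.

Lemma Ck_is_derive n f g : (forall x : R, is_derive x (1 : R) f (g x)) -> Ck n g -> Ck n.+1 f.
Proof.
move=> fg Cg /=; split; first by move=> x; have := fg x; case.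
by rewrite (_ : derive1 f = g)//; apply/funext => x; rewrite derive1E; have := fg x; case.
Qed.

Lemma Ck_derivable n f (x : R) : Ck n.+1 f -> is_derive x (1 : R) f (derive1 f x).
Proof. by move=> [df _]; rewrite derive1E; apply: DeriveDef. Qed.

Lemma smooth1_derivable f (x : R) : smooth1 f -> is_derive x (1 : R) f (derive1 f x).
Proof. by move=> sf; exact: (@Ck_derivable 0 _ _ (sf 1%N)). Qed.

Lemma smooth1_deriv f : smooth1 f -> smooth1 (derive1 f).
Proof. by move=> sf n; case: (sf n.+1). Qed.

Lemma smooth1_derivn f k : smooth1 f -> smooth1 (derive1n k f).
Proof. by move=> sf; elim: k => // k IH; rewrite derive1nS; exact: smooth1_deriv. Qed.

Lemma smooth1_continuous f : smooth1 f -> continuous f.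
Proof. by move=> sf; exact: (sf 0%N). Qed.

Lemma smooth1_cst c : smooth1 (fun=> c).
Proof.
move=> n; elim: n c => [|n IH] c; first by move=> x; exact: cvg_cst.
apply: (@Ck_is_derive _ _ (fun=> 0)); last exact: IH.
Qed.

Lemma smooth1D f g : smooth1 f -> smooth1 g -> smooth1 (fun x => f x + g x).
Proof.
move=> + + n; elim: n f g => [|n IH] f g sf sg.
  by move=> x; apply: cvgD; exact: smooth1_continuous.
apply: (@Ck_is_derive _ _ (fun x => derive1 f x + derive1 g x)); last by apply: IH; exact: smooth1_deriv.
by move=> x; apply: is_deriveD; exact: smooth1_derivable.
Qed.

Lemma smooth1M f g : smooth1 f -> smooth1 g -> smooth1 (fun x => f x * g x).
Proof.
move=> sf sg n; move: (sf n) (sg n) => {sf sg}.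
elim: n f g => [|n IH] f g sf sg.
  by move=> x; apply: cvgM; [exact: sf|exact: sg].
apply: (@Ck_is_derive _ _ (fun x => derive1 f x * g x + f x * derive1 g x)).
  move=> x; have := @Ck_derivable _ f x sf; have := @Ck_derivable _ g x sg.
  move=> dg df; apply: is_derive_eq.
  by rewrite /GRing.scale/= addrC [g x * _]mulrC.
have CkD : forall n f g, Ck n f -> Ck n g -> Ck n (fun x => f x + g x).
  elim=> [|k IHk] f1 g1 h1 h2; first by move=> x; apply: cvgD; [exact: h1|exact: h2].
  apply: (@Ck_is_derive _ _ (fun x => derive1 f1 x + derive1 g1 x)).
    by move=> x; apply: is_deriveD; [exact: Ck_derivable h1|exact: Ck_derivable h2].
  by apply: IHk; [case: h1|case: h2].
apply: CkD; apply: IH; [by case: sf|exact: CkS|exact: CkS|by case: sg].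
Qed.

Lemma smooth1Z c f : smooth1 f -> smooth1 (fun x => c * f x).
Proof. by move=> sf; apply: smooth1M => //; exact: smooth1_cst. Qed.

Lemma smooth1_affine f c d : smooth1 f -> smooth1 (fun x => f (c * x + d)).
Proof.
move=> sf n.
have D (x : R) : is_derive x (1:R) (fun x : R => c * x + d) c.
  by apply: is_derive_eq; rewrite /= ?addr0 ?scaler1 ?mulr1.
suff : forall k, smooth1 f -> Ck n (fun x => c ^+ k * f (c * x + d)).
  by move=> /(_ 0%N sf); under eq_fun do rewrite expr0 mul1r.
elim: n f {sf} => [|n IH] f k sf.
  move=> x; apply: cvgM; first exact: cvg_cst.
  apply: (@continuous_comp _ _ _ (fun x => c * x + d) f); last exact: smooth1_continuous.
  by apply: cvgD; [apply: cvgM; [exact: cvg_cst|exact: cvg_id]|exact: cvg_cst].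
apply: (@Ck_is_derive _ _ (fun x => c ^+ k.+1 * derive1 f (c * x + d))); last first.
  by apply: IH; exact: smooth1_deriv.
move=> x; have df := smooth1_derivable (c * x + d) sf.
have dc : is_derive x (1:R) (f \o (fun x => c * x + d)) (derive1 f (c * x + d) * c).
  exact: is_derive1_comp.
have := @is_deriveZ _ _ _ _ (c ^+ k) x 1 _ dc.
by rewrite /GRing.scale/= exprSr -mulrA [c * derive1 f _]mulrC.
Qed.

Definition flat (P : {poly R}) (x : R) : R :=
  if 0 < x then P.[x^-1] * expR (- x^-1) else 0.

Lemma flat_le (P : {poly R}) : exists2 C, 0 <= C &
  forall x, `|x| <= 1 -> `|flat P x| <= C * `|x|.
Proof.
suff [C C0 HC] : exists2 C, 0 <= C &
    forall x, 0 < x -> x <= 1 -> `|P.[x^-1]| * expR (- x^-1) <= C * x.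
  exists C => // x x1; rewrite /flat; case: ifPn => [x0|_]; last by rewrite normr0 mulr_ge0.
  rewrite normrM (ger0_norm (expR_ge0 _)) [X in _ <= C * X]gtr0_norm//.
  by apply: HC => //; rewrite -[leLHS]gtr0_norm.
have mono n : forall x : R, 0 < x -> x <= 1 -> x^-1 ^+ n * expR (- x^-1) <= n.+1`!%:R * x.
  move=> x x0 x1; rewrite expRN ler_pdivrMr ?expR_gt0//.
  apply: (@le_trans _ _ (n.+1`!%:R * x * (x^-1 ^+ n.+1 / n.+1`!%:R))).
    have f0 : n.+1`!%:R != 0 :> R by rewrite pnatr_eq0 -lt0n fact_gt0.
    by rewrite le_eqVlt; apply/orP; left; apply/eqP; rewrite exprS; field; rewrite f0 gt_eqF.
  rewrite ler_wpM2l ?mulr_ge0 ?(ltW x0)//.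
  have := @expR_ge1Dxn R x^-1 n; rewrite invr_ge0 (ltW x0) => /(_ isT).
  by apply: le_trans; rewrite lerDr.
exists (\sum_(i < size P) `|P`_i| * i.+1`!%:R).
  by apply: sumr_ge0 => i _; rewrite mulr_ge0.
move=> x x0 x1; rewrite horner_coef mulr_suml.
apply: (le_trans (ler_wpM2r (expR_ge0 _) (ler_norm_sum _ _ _))).
rewrite mulr_suml; apply: ler_sum => i _.
rewrite normrM -!mulrA; apply: ler_wpM2l => //.
rewrite [`|_ ^+ _|]ger0_norm; first exact: mono.
by apply: exprn_ge0; rewrite invr_ge0 ltW.
Qed.

Lemma flat_deriv (P : {poly R}) (x : R) :
  is_derive x (1:R) (flat P) (flat ('X^2 * (P - P^`())) x).
Proof.
have [x0|x0|->] := ltgtP x 0.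
- have -> : flat ('X^2 * (P - P^`())) x = 0 by rewrite /flat ltNge (ltW x0).
  apply: (@near_eq_is_derive _ _ _ (fun=> 0)).
    near=> y; rewrite /flat ltNge (_ : y <= 0)//.
    by apply/ltW; near: y; exact: lt_nbhsl.
- have -> : flat ('X^2 * (P - P^`())) x = ('X^2 * (P - P^`())).[x^-1] * expR (- x^-1).
    by rewrite /flat x0.
  apply: (near_eq_is_derive (f := (fun y : R => P.[y^-1] * expR (- y^-1)))).
    near=> y; rewrite /flat (_ : 0 < y)//.
    by near: y; exact: lt_nbhsr.
  have xn0 : x != 0 by rewrite gt_eqF.
  have dV : is_derive x (1:R) (fun y : R => y^-1) (- x ^- 2).
    have := @is_deriveV R id x 1 1 xn0 _; rewrite /GRing.scale/= mulr1; apply.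
  have d1 : is_derive x (1:R) (horner P \o (fun y => y^-1)) (P^`().[x^-1] * - x ^- 2).
    exact: is_derive1_comp.
  have d2 : is_derive x (1:R) (fun y => - y^-1) (x ^- 2).
    by have := is_deriveN dV; rewrite opprK.
  have d3 : is_derive x (1:R) (expR \o (fun y => - y^-1)) (expR (- x^-1) * x ^- 2).
    exact: is_derive1_comp.
  have Q : ('X^2 * (P - P^`())).[x^-1] = x ^- 2 * (P.[x^-1] - P^`().[x^-1]).
    by rewrite !hornerE exprVn.
  apply: (@is_derive_eq _ _ _ _ _ _ _ _ (is_deriveM d1 d3)); rewrite Q.
  rewrite [LHS](_ : _ = P.[x^-1] * (expR (- x^-1) * x ^- 2) +
      expR (- x^-1) * (P^`().[x^-1] * - x ^- 2))//; ring.
have -> : flat ('X^2 * (P - P^`())) 0 = 0 by rewrite /flat ltxx.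
have [C C0 HC] := flat_le ('X * P).
suff : h^-1 *: (flat P (h *: (1:R) + 0) - flat P 0) @[h --> (0:R)^'] --> (0:R).
  move=> H; apply: DeriveDef; first by apply/cvg_ex; exists 0.
  exact/cvg_lim.
rewrite /flat ltxx; apply/cvgr0Pnorm_le => e e0; near=> h.
rewrite /GRing.scale/= mulr1 addr0 subr0.
have h0 : h != 0 by near: h; exact: nbhs_dnbhs_neq.
have hC : `|h| <= e / (C + 1).
  near: h; apply: (@dnbhs0_le _ R).
  by rewrite divr_gt0// ltr_wpDl.
have h1 : `|h| <= 1 by near: h; apply: dnbhs0_le.
apply: (@le_trans _ _ `|flat ('X * P) h|).
  rewrite /flat; case: ifP => // hp; first by rewrite hornerM hornerX mulrA.
  by rewrite mulr0.
apply: (le_trans (HC _ h1)).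
rewrite ler_pdivlMr in hC; last by rewrite ltr_wpDl.
by apply: le_trans hC; rewrite mulrC ler_wpM2l// lerDl.
Unshelve. all: by end_near. Qed.

Lemma smooth1_flat (P : {poly R}) : smooth1 (flat P).
Proof.
move=> n; elim: n P => [|n IH] P.
  move=> x; apply/differentiable_continuous/derivable1_diffP.
  by have := flat_deriv P x; case.
by apply: (Ck_is_derive (flat_deriv P)); exact: IH.
Qed.

End smooth_functions.

(** * C *)

Lemma Rdominated_cvg d (T : measurableType d) (R : realType)
    (mu : {measure set T -> \bar R}) (D : set T) (f_ : nat -> T -> R) (f g : T -> R) :
  measurable D ->
  (forall n, measurable_fun D (f_ n)) -> measurable_fun D f ->
  {ae mu, forall x, D x -> f_ ^~ x @ \oo --> f x} ->
  mu.-integrable D (EFin \o g) ->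
  (forall n x, D x -> `|f_ n x| <= g x) ->
  mu.-integrable D (EFin \o f) /\
  \int[mu]_(x in D) f_ n x @[n --> \oo] --> \int[mu]_(x in D) f x.
Proof.
move=> mD mf_ mf cvf ig fg.
have H := @dominated_convergence _ T R mu D mD (fun n => EFin \o f_ n) (EFin \o f) (EFin \o g).
have [|||||fi _ C] := H; last first.
- split=> //; apply: fine_cvg.
  rewrite fineK; last exact: integrable_fin_num.
  exact: C.
- by apply: aeW => x n Dx; rewrite /= lee_fin fg.
- exact: ig.
- apply: filterS cvf => x /= + Dx => /(_ Dx) C.
  by apply: cvg_EFin => //; exact: nearW.
- exact/measurable_EFinP.
- by move=> n; exact/measurable_EFinP.
Qed.

Section approximable_functions.
Context {R : realType}.
Local Notation leb := (@lebesgue_measure R).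
Implicit Types (w f g : R -> R).

Definition test1 f := smooth1 f /\
  exists2 d : R, 0 < d & forall x, f x != 0 -> d <= x <= 1 - d.

Definition approximable w := exists phi : nat -> R -> R,
  [/\ forall k, test1 (phi k),
      exists M, forall k x, `|phi k x| <= M &
      forall x, 0 < x < 1 -> phi ^~ x @ \oo --> w x].

Lemma test1D f g : test1 f -> test1 g -> test1 (fun x => f x + g x).
Proof.
move=> [sf [d1 d10 f1]] [sg [d2 d20 g1]]; split; first exact: smooth1D.
exists (Num.min d1 d2); first by rewrite lt_min d10.
move=> x fg0; have [f0|f0] := eqVneq (f x) 0.
  have := g1 x; rewrite f0 add0r in fg0 => /(_ fg0) /andP[H1 H2].
  have := ge_min d2 d1 d2; rewrite lexx orbT => H; lra.
have := f1 x f0 => /andP[H1 H2].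
have := ge_min d1 d1 d2; rewrite lexx => H; lra.
Qed.

Lemma test1Z c f : test1 f -> test1 (fun x => c * f x).
Proof.
move=> [sf [d d0 fd]]; split; first exact: smooth1Z.
by exists d => // x; rewrite mulf_eq0 negb_or => /andP[_ /fd].
Qed.

Lemma approxD f g : approximable f -> approximable g -> approximable (fun x => f x + g x).
Proof.
move=> [p [p1 [M pM] pf]] [q [q1 [N qN] qg]].
exists (fun k x => p k x + q k x); split.
- by move=> k; exact: test1D.
- by exists (M + N) => k x; apply: (le_trans (ler_normD _ _)); exact: lerD.
- by move=> x x01; apply: cvgD; [exact: pf|exact: qg].
Qed.

Lemma approxZ c f : approximable f -> approximable (fun x => c * f x).
Proof.
move=> [p [p1 [M pM] pf]]; exists (fun k x => c * p k x); split.
- by move=> k; exact: test1Z.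
- by exists (`|c| * M) => k x; rewrite normrM ler_wpM2l.
- by move=> x x01; apply: cvgM; [exact: cvg_cst|exact: pf].
Qed.

Lemma eq_approx f g : (forall x, 0 < x < 1 -> f x = g x) -> approximable f -> approximable g.
Proof.
move=> fg [p [p1 pM pf]]; exists p; split => // x x01.
by rewrite -fg//; exact: pf.
Qed.

Let e1 := flat (1 : {poly R}).

Let e1E x : e1 x = if 0 < x then expR (- x^-1) else 0.
Proof. by rewrite /e1 /flat hornerC mul1r. Qed.

Let e1_ge0 x : 0 <= e1 x.
Proof. by rewrite e1E; case: ifP => // _; exact: expR_ge0. Qed.

Let e1_le1 x : e1 x <= 1.
Proof.
rewrite e1E; case: ifP => // x0.
by rewrite -expR0 ler_expR oppr_le0 invr_ge0 ltW.
Qed.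

Let e1_cvg1 (u : nat -> R) : (forall A, \forall k \near \oo, A <= u k) ->
  e1 (u k) @[k --> \oo] --> (1 : R).
Proof.
move=> uy; apply/cvgrPdist_le => e e0; near=> k.
have uk1 : e^-1 <= u k by near: k; exact: uy.
have uk0 : 0 < u k by apply: lt_le_trans uk1; rewrite invr_gt0.
have := e1_le1 (u k); rewrite ler_norml e1E uk0 => H; apply/andP; split; first lra.
have := expR_ge1Dx (- (u k)^-1).
have : (u k)^-1 <= e by rewrite -[leRHS]invrK lef_pV2// posrE// invr_gt0.
lra.
Unshelve. all: by end_near. Qed.

Let nat_large (A c : R) : 0 < c -> \forall k \near \oo, A <= k.+1%:R * c.
Proof.
move=> c0; near=> k; rewrite -ler_pdivrMr//.
apply: (@le_trans _ _ k%:R); last by rewrite ler_nat.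
by near: k; exact: nbhs_infty_ger.
Unshelve. all: by end_near. Qed.

Lemma approx_itv_seq (a b : R) : 0 <= a -> b <= 1 -> exists phi : nat -> R -> R,
  [/\ forall k, test1 (phi k), forall k x, 0 <= phi k x <= 1,
      forall k x, phi k x != 0 -> a - k.+1%:R^-1 < x < b &
      forall x, 0 < x < 1 -> phi ^~ x @ \oo --> ((a <= x < b)%R%:R : R)].
Proof.
move=> a0 b1.
exists (fun k x => e1 (k.+1%:R ^+ 2 * x + (k.+1%:R - k.+1%:R ^+ 2 * a)) *
   (e1 ((- k.+1%:R) * x + (k.+1%:R * b - 1)) * e1 (k.+1%:R * x + (- 1)))).
split.
- move=> k; split.
    apply: smooth1M; first by apply: smooth1_affine; exact: smooth1_flat.
    by apply: smooth1M; apply: smooth1_affine; exact: smooth1_flat.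
  exists (k.+1%:R^-1); first by rewrite invr_gt0.
  have k0 : 0 < k.+1%:R :> R by [].
  move=> x; rewrite !mulf_eq0 !negb_or => /and3P[_].
  rewrite !e1E; case: ifP => [H1 _|]; last by rewrite eqxx.
  case: ifP => [H2 _|]; last by rewrite eqxx.
  rewrite -[k.+1%:R^-1]mul1r ler_pdivrMr// lerBrDr -lerBrDl ler_pdivrMr//.
  by apply/andP; split; nra.
- by move=> k x; rewrite !mulr_ge0//= mulr_ile1 ?mulr_ge0// mulr_ile1.
- move=> k x; rewrite !mulf_eq0 !negb_or => /and3P[+ + _].
  have k0 : 0 < k.+1%:R :> R by [].
  rewrite !e1E; case: ifP => [H1 _|]; last by rewrite eqxx.
  case: ifP => [H2 _|]; last by rewrite eqxx.
  apply/andP; split; last by rewrite -(ltr_pM2l k0); lra.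
  have E : k.+1%:R ^+ 2 * k.+1%:R^-1 = k.+1%:R :> R by rewrite expr2 mulfK// gt_eqF.
  by rewrite -(ltr_pM2l (exprn_gt0 2 k0)) mulrBr E; lra.
move=> x /andP[x0 x1].
have c3 : e1 (k.+1%:R * x + (- 1)) @[k --> \oo] --> (1 : R).
  apply: e1_cvg1 => A; apply: filterS (nat_large (A + 1) x0) => k; lra.
have c2 : x < b -> e1 ((- k.+1%:R) * x + (k.+1%:R * b - 1)) @[k --> \oo] --> (1 : R).
  move=> xb; apply: e1_cvg1 => A.
  have bx : 0 < b - x by rewrite subr_gt0.
  apply: filterS (nat_large (A + 1) bx) => k; lra.
have [ax|xa] := leP a x; have [xb|bx] := ltP x b => /=.
- have c1 : e1 (k.+1%:R ^+ 2 * x + (k.+1%:R - k.+1%:R ^+ 2 * a)) @[k --> \oo] --> (1 : R).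
    apply: e1_cvg1 => A; apply: filterS (nat_large A (@ltr01 R)) => k H.
    have : 0 <= k.+1%:R ^+ 2 * (x - a) by rewrite mulr_ge0 ?sqr_ge0// subr_ge0.
    lra.
  have -> : (1%:R : R) = 1 * (1 * 1) by rewrite !mulr1.
  by apply: cvgM => //; apply: cvgM => //; exact: c2.
- apply: cvg_near_cst; near=> k.
  rewrite (e1E (_ * x + (k.+1%:R * b - 1))) ifF ?mul0r ?mulr0//.
  apply/negbTE; rewrite -leNgt.
  have : 0 <= k.+1%:R * (x - b) by rewrite mulr_ge0// subr_ge0.
  lra.
- have ax : 0 < a - x by rewrite subr_gt0.
  apply: cvg_near_cst; near=> k.
  rewrite [X in X * _]e1E ifF ?mul0r//; apply/negbTE; rewrite -leNgt.
  have : 1 <= k.+1%:R * (a - x) by near: k; exact: (nat_large 1 ax).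
  have : 0 < k.+1%:R :> R by [].
  nra.
- apply: cvg_near_cst; near=> k.
  rewrite (e1E (_ * x + (k.+1%:R * b - 1))) ifF ?mul0r ?mulr0//.
  apply/negbTE; rewrite -leNgt.
  have : 0 <= k.+1%:R * (x - b) by rewrite mulr_ge0// subr_ge0.
  lra.
Unshelve. all: by end_near. Qed.

Lemma approx_itv (a b : R) : 0 <= a -> b <= 1 ->
  approximable (fun x => (a <= x < b)%R%:R).
Proof.
move=> a0 b1; have [p [p1 p2 _ p4]] := approx_itv_seq a0 b1.
exists p; split => //; exists 1 => k x.
by have /andP[h1 h2] := p2 k x; rewrite ger0_norm.
Qed.

Definition mean w : R := \int[leb]_(t in `]0, 1[) w t.
Definition prim w (x : R) : R := \int[leb]_(t in `]0, x]) w t.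

Lemma approx_measurable w : approximable w -> measurable_fun (`]0, 1[%classic : set (measurableTypeR R)) w.
Proof.
move=> [p [p1 _ pw]]; apply: (@measurable_fun_cvg _ _ _ _ p).
  move=> k; apply: measurable_funTS; apply: continuous_measurable_fun.
  by have [sp _] := p1 k; exact: smooth1_continuous.
by move=> x; rewrite /= in_itv/= => x01; exact: pw.
Qed.

Lemma approx_bounded w : approximable w ->
  exists2 M, 0 <= M & forall x, 0 < x < 1 -> `|w x| <= M.
Proof.
move=> [p [_ [M pM] pw]]; exists M.
  by apply: le_trans (pM 0%N 0).
move=> x x01; have /cvg_norm := pw x x01 => H.
rewrite -(cvg_lim (@norm_hausdorff _ _) H); apply: limr_le.
  by apply/cvg_ex; exists `|w x|.
by apply: nearW => k; exact: pM.
Qed.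

Let sub01 (x : R) : x < 1 -> `]0, x]%classic `<=` `]0, 1[%classic.
Proof. by move=> x1 t /=; rewrite !in_itv/= => /andP[-> /le_lt_trans]; apply. Qed.

Let cst_integrable (c : R) (D : set (measurableTypeR R)) : measurable D -> D `<=` `]0, 1[%classic ->
  leb.-integrable D (EFin \o cst c).
Proof.
move=> mD D01; apply: (@integrableS _ _ _ leb `]0, 1[%classic) => //.
apply: measurable_bounded_integrable => //.
- by rewrite /= lebesgue_measure_itv/= lte_fin ltr01 sube0 ltry.
- by exists `|c|; split; rewrite ?num_real// => M cM x _ /=; exact: ltW.
Qed.

Lemma approx_integrable w (D : set (measurableTypeR R)) : approximable w ->
  measurable D -> D `<=` `]0, 1[%classic -> leb.-integrable D (EFin \o w).
Proof.
move=> aw mD D01.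
have [M M0 wM] := approx_bounded aw.
apply: (le_integrable mD _ _ (cst_integrable M mD D01)).
  by apply/measurable_EFinP; apply: measurable_funS (approx_measurable aw).
move=> x Dx; rewrite /= lee_fin [leRHS]ger0_norm// wM//.
by have := D01 x Dx; rewrite /= in_itv.
Qed.

Lemma approx_Rint_cvg (p : nat -> R -> R) w (M : R) (D : set (measurableTypeR R)) :
  (forall k, test1 (p k)) -> (forall k x, `|p k x| <= M) ->
  (forall x, 0 < x < 1 -> p ^~ x @ \oo --> w x) ->
  measurable D -> D `<=` `]0, 1[%classic ->
  \int[leb]_(x in D) p n x @[n --> \oo] --> \int[leb]_(x in D) w x.
Proof.
move=> p1 pM pw mD D01.
have aw : approximable w by exists p; split => //; exists M.
apply: (@Rdominated_cvg _ _ _ leb D p w (cst M) mD _ _ _ _ _).2.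
- move=> k; apply: measurable_funTS; apply: continuous_measurable_fun.
  by have [sp _] := p1 k; exact: smooth1_continuous.
- exact: measurable_funS (approx_measurable aw).
- by apply: aeW => x Dx; apply: pw; have := D01 x Dx; rewrite /= in_itv.
- exact: cst_integrable.
- by move=> n x _ /=; exact: pM.
Qed.

Lemma test1_prim f : test1 f -> mean f = 0 ->
  test1 (prim f) /\ derive1 (prim f) = f.
Proof.
move=> [sf [d d0 fd]] mf.
have f0 x : ~~ (d <= x <= 1 - d) -> f x = 0.
  by move=> xd; apply/eqP; apply: contraNT xd => /fd.
have cf := smooth1_continuous sf.
have P0 x : x < d -> prim f x = 0.
  move=> xd; rewrite /prim /Rintegral integral0_eq// => t /=.
  rewrite in_itv/= => /andP[_ tx]; rewrite f0// negb_and -!ltNge.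
  by rewrite (le_lt_trans tx xd).
have P1 x : 1 - d < x -> prim f x = 0.
  move=> xd; rewrite -mf /prim /mean Rintegral_mkcond [RHS]Rintegral_mkcond.
  apply: eq_Rintegral => t _; rewrite !patchE.
  have [->|ft0] := eqVneq (f t) 0; first by do 2 case: ifP.
  have /andP[t0 t1] := fd t ft0.
  rewrite !mem_set//= in_itv/=; first by apply/andP; split; lra.
  by apply/andP; split; lra.
have dp (x : R) : is_derive x (1:R) (prim f) (f x).
  have [xd|dx] := ltP x d.
    rewrite f0; last by rewrite negb_and -!ltNge xd.
    apply: (near_eq_is_derive (f := fun _ : R => (0:R))).
    near=> y; rewrite P0//; near: y; exact: lt_nbhsl.
  have x0 : 0 < x by apply: lt_le_trans dx.
  have xx1 : x < x + 1 by rewrite ltrDl.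
  have fi : leb.-integrable [set` Interval (BRight 0) (BRight (x + 1))] (EFin \o f).
    apply: (@integrableS _ _ _ leb `[0, x + 1]) => //.
      by apply: subset_itvr; rewrite bnd_simp.
    apply: continuous_compact_integrable; first exact: segment_compact.
    by apply: continuous_subspaceT => t; exact: cf.
  have [] := continuous_FTC1 xx1 fi _ (cf x); first by [].
  by rewrite derive1E => H1 H2; apply: DeriveDef.
split; last by apply/funext => x; rewrite derive1E; case: (dp x).
split.
  case=> [|n]; last by apply: (Ck_is_derive dp); exact: sf.
  move=> x; apply/differentiable_continuous/derivable1_diffP.
  by case: (dp x).
exists d => // x px; rewrite !leNgt; apply/andP; split.
  by apply: contraNN px => /P0 ->.
by apply: contraNN px => /P1 ->.
Unshelve. all: by end_near. Qed.

Lemma prim_bound f (M : R) x : 0 <= M -> approximable f -> (forall x, 0 < x < 1 -> `|f x| <= M) ->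
  0 < x < 1 -> `|prim f x| <= M * x.
Proof.
move=> M0 af fM /andP[x0 x1].
apply: (le_trans (le_normr_Rintegral _ _)) => //.
  by apply: approx_integrable => //; exact: sub01.
have -> : M * x = \int[leb]_(t in `]0, x]) M.
  by rewrite Rintegral_cst//= lebesgue_measure_itv/= lte_fin x0 sube0.
apply: le_Rintegral => //.
- have := approx_integrable af _ (sub01 x1) => /(_ (measurable_itv _)) /integrable_norm.
  by apply: eq_integrable.
- by apply: cst_integrable => //; exact: sub01.
- by move=> t tx; apply: fM; have := sub01 x1 tx; rewrite /= in_itv.
Qed.

End approximable_functions.

(** * D *)

Section approximable_pairs.
Context {R : realType}.
Local Notation leb := (@lebesgue_measure R).
Implicit Types (w f g : R -> R).

Lemma test1_bounded f : test1 f -> exists M, forall x, `|f x| <= M.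
Proof.
move=> [sf [d d0 fd]].
have cf : {within `[d, 1 - d], continuous f}.
  by apply: continuous_subspaceT => t; exact: smooth1_continuous.
have [dd|dd] := leP d (1 - d); last first.
  exists 0 => x; rewrite (_ : f x = 0) ?normr0//; apply/eqP/negPn/negP => /fd; lra.
have cnf : {within `[d, 1 - d], continuous (fun x => `|f x|)}.
  apply: continuous_subspaceT => t; apply: cvg_norm; exact: smooth1_continuous.
have [c _ fc] := EVT_max dd cnf.
exists `|f c| => x; have [->|fx] := eqVneq (f x) 0; first by rewrite normr0.
by apply: fc; rewrite in_itv/=; exact: fd.
Qed.

Lemma test1_approx f : test1 f -> approximable f.
Proof.
move=> tf; exists (fun=> f); split => //.
- by have [M fM] := test1_bounded tf; exists M.
- by move=> x _; exact: cvg_cst.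
Qed.

Lemma approx_mean w : approximable w -> leb.-integrable `]0, 1[ (EFin \o w).
Proof. by move=> aw; apply: approx_integrable. Qed.

Lemma mean_lin f g c : approximable f -> approximable g ->
  mean (fun x => f x + c * g x) = mean f + c * mean g.
Proof.
move=> af ag; rewrite /mean RintegralD//=.
- by rewrite RintegralZl//; exact: approx_mean.
- exact: approx_mean.
- by apply: (approx_mean (approxZ c ag)).
Qed.

Lemma mean_cst c : mean (fun=> c : R) = c.
Proof. by rewrite /mean Rintegral_cst//= lebesgue_measure_itv/= lte_fin ltr01 sube0 mulr1. Qed.

Lemma approx1 : approximable (fun=> 1 : R).
Proof.
apply: (eq_approx _ (@approx_itv R 0 1 _ _)) => // x /andP[x0 x1].
by rewrite (ltW x0) x1.
Qed.

Lemma approx_cst c : approximable (fun=> c : R).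
Proof. by apply: (eq_approx _ (approxZ c approx1)) => x _; rewrite mulr1. Qed.

Lemma test1_unit_mean : exists2 f : R -> R, test1 f & mean f = 1.
Proof.
have [p [p1 [M pM] pw]] := approx1.
have := approx_Rint_cvg p1 pM pw (measurable_itv `]0, 1[) (@subset_refl _ _).
rewrite -/(mean (fun=> 1)) mean_cst => H.
have /cvgrPdist_lt /(_ 1 ltr01) [N _ /(_ N (leqnn N)) /= HN] := H.
have m0 : mean (p N) != 0.
  by apply/eqP => m0; move: HN; rewrite -/(mean (p N)) m0 subr0 normr1 ltxx.
exists (fun x => (mean (p N))^-1 * p N x); first exact: test1Z.
rewrite [LHS]RintegralZl//; first by rewrite -/(mean (p N)) mulVf.
exact/approx_mean/test1_approx.
Qed.

Lemma mean_bound f (M : R) : 0 <= M -> approximable f -> (forall x, 0 < x < 1 -> `|f x| <= M) ->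
  `|mean f| <= M.
Proof.
move=> M0 af fM; apply: (le_trans (le_normr_Rintegral _ _)) => //.
  exact: approx_mean.
rewrite -[leRHS]mean_cst; apply: le_Rintegral => //.
- by have := approx_mean af => /integrable_norm; apply: eq_integrable.
- exact: approx_mean (approx_cst M).
Qed.

Definition approximable2 (w W : R -> R) := exists phi : nat -> R -> R,
  [/\ forall k, test1 (phi k),
      exists M, forall k x, `|phi k x| <= M /\ `|derive1 (phi k) x| <= M &
      forall x, 0 < x < 1 -> phi ^~ x @ \oo --> W x /\
        (fun k => derive1 (phi k) x) @ \oo --> w x].

Lemma approx2_approx w W : approximable2 w W -> approximable W.
Proof.
move=> [p [p1 [M pM] pw]]; exists p; split=> //.
- by exists M => k x; have [] := pM k x.
- by move=> x /pw [].
Qed.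

Lemma approxB w c : approximable w -> approximable (fun x => w x - c).
Proof. by move=> aw; apply: approxD => //; exact: approx_cst. Qed.

Lemma approx2_prim w : approximable w -> let c := mean w in
  approximable2 (fun x => w x - c) (prim (fun x => w x - c)).
Proof.
move=> aw c; have [p [p1 [M pM] pw]] := aw.
have [q [q1 [N qN] qw]] := approx1.
have [th tth mth] := test1_unit_mean.
have [K thK] := test1_bounded tth.
pose r k x := p k x + (- c) * q k x.
have tr k : test1 (r k) by apply: test1D => //; exact: test1Z.
have rw x : 0 < x < 1 -> r ^~ x @ \oo --> w x - c.
  move=> x01; rewrite -[c in X in _ --> X]mulr1 -mulNr; apply: cvgD; first exact: pw.
  by apply: cvgM; [exact: cvg_cst|exact: qw].
pose B := M + `|c| * N.
have rB k x : `|r k x| <= B.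
  apply: (le_trans (ler_normD _ _)); apply: lerD => //.
  by rewrite normrM normrN ler_wpM2l.
have B0 : 0 <= B by apply: le_trans (rB 0%N 0).
have mr : (fun k => mean (r k)) @ \oo --> (0:R).
  have -> : 0 = mean (fun x => w x - c) :> R.
    have := mean_lin (- c) aw approx1; rewrite mean_cst mulr1 subrr => <-.
    by congr mean; apply/funext => x; rewrite mulr1.
  by apply: (approx_Rint_cvg tr rB rw).
pose r' k x := r k x + (- mean (r k)) * th x.
have tr' k : test1 (r' k) by apply: test1D => //; exact: test1Z.
have mr' k : mean (r' k) = 0.
  by rewrite mean_lin ?mth ?mulr1 ?subrr//; exact: test1_approx.
pose B' := B + B * K.
have K0 : 0 <= K by apply: le_trans (thK 0).
have r'B k x : `|r' k x| <= B'.
  apply: (le_trans (ler_normD _ _)); apply: lerD => //.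
  rewrite normrM normrN; apply: ler_pM => //.
  apply: mean_bound => //; exact: test1_approx.
have r'w x : 0 < x < 1 -> r' ^~ x @ \oo --> w x - c.
  move=> x01; rewrite -[w x - c]addr0 -[X in _ + X](mul0r (th x)) -[X in _ + X * _]oppr0.
  apply: cvgD; first exact: rw.
  by apply: cvgM; [exact: cvgN|exact: cvg_cst].
exists (fun k => prim (r' k)); split.
- by move=> k; have [] := test1_prim (tr' k) (mr' k).
- exists B' => k x; have [[_ [d d0 td]] ->] := test1_prim (tr' k) (mr' k).
  split => //; have [->|/td /andP[x0 x1]] := eqVneq (prim (r' k) x) 0.
    by rewrite normr0; apply: le_trans (r'B 0%N 0).
  have x01 : 0 < x < 1 by apply/andP; split; lra.
  apply: (le_trans (prim_bound _ (test1_approx (tr' k)) (fun x _ => r'B k x) x01)).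
    by apply: le_trans (r'B 0%N 0).
  rewrite ler_piMr//; first by apply: le_trans (r'B 0%N 0).
  by case/andP: x01 => _ /ltW.
- move=> x x01; split.
    apply: (approx_Rint_cvg tr' r'B r'w) => // t /=.
    by case/andP: x01 => _ x1; rewrite !in_itv/= => /andP[-> /le_lt_trans]; apply.
  by under eq_fun do rewrite (test1_prim (tr' _) (mr' _)).2; exact: r'w.
Qed.

Fixpoint prim_bounded d (K : R) w : Prop :=
  approximable w /\
  if d is k.+1 then `|mean w| <= K /\ prim_bounded k K (prim (fun x => w x - mean w))
  else forall x, 0 < x < 1 -> `|w x| <= K.

Lemma approx_prim w : approximable w -> approximable (prim (fun x => w x - mean w)).
Proof. by move=> /approx2_prim /approx2_approx. Qed.

Lemma le_prim_bounded d K K' w : K <= K' -> prim_bounded d K w -> prim_bounded d K' w.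
Proof.
move=> KK'; elim: d w => [|d IH] w /= [aw]; first by move=> H; split=> // x /H /le_trans; apply.
by move=> [H1 H2]; split => //; split; [exact: le_trans H1 KK'|exact: IH].
Qed.

Lemma prim_bound1 f (M : R) x : 0 <= M -> approximable f -> (forall x, 0 < x < 1 -> `|f x| <= M) ->
  0 < x < 1 -> `|prim f x| <= M.
Proof.
move=> M0 af fM x01; apply: (le_trans (prim_bound M0 af fM x01)).
by rewrite ler_piMr//; case/andP: x01 => _ /ltW.
Qed.

Lemma prim_bounded_sup d L w : 0 <= L -> approximable w -> (forall x, 0 < x < 1 -> `|w x| <= L) ->
  prim_bounded d (2 ^+ d * L) w.
Proof.
elim: d L w => [|d IH] L w L0 aw wL /=; first by rewrite mul1r.
have mL : `|mean w| <= L by exact: mean_bound.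
split=> //; split.
  apply: (le_trans mL); rewrite ler_peMl//.
  by apply: exprn_ege1; rewrite (ler_nat _ 1 2).
rewrite exprSr -mulrA; apply: IH.
- by rewrite mulr_ge0.
- exact: approx_prim.
- move=> x x01; apply: prim_bound1 => //; first by rewrite mulr_ge0.
    exact: approxB.
  move=> y y01; apply: (le_trans (ler_normB _ _)).
  by have := wL y y01; lra.
Qed.

End approximable_pairs.

(** * E *)

Lemma cell_unique (R : realType) (b n c d : nat) (x : R) : (1 < b)%N ->
  c%:R * b%:R ^- n <= x < c.+1%:R * b%:R ^- n ->
  d%:R * b%:R ^- n <= x < d.+1%:R * b%:R ^- n -> c = d.
Proof.
move=> b1 /andP[x1 x2] /andP[y1 y2].
have Bn : 0 < b%:R ^- n :> R by rewrite invr_gt0 exprn_gt0// ltr0n (ltnW b1).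
have : (d < c.+1)%N by rewrite -(ltr_nat R) -(ltr_pM2r Bn); exact: le_lt_trans x2.
have : (c < d.+1)%N by rewrite -(ltr_nat R) -(ltr_pM2r Bn); exact: le_lt_trans y2.
by lia.
Qed.

Section zero_sum.
Context {R : realType}.
Local Notation leb := (@lebesgue_measure R).
Implicit Types (w f g : R -> R).

Definition incr w (u v : R) : R := \int[leb]_(t in `]u, v[) w t.

Let sub01 (u v : R) : 0 <= u -> v <= 1 -> `]u, v[%classic `<=` `]0, 1[%classic.
Proof.
move=> u0 v1 t /=; rewrite !in_itv/= => /andP[ut tv].
by rewrite (le_lt_trans u0 ut) (lt_le_trans tv v1).
Qed.

Lemma incr_integrable w u v : approximable w -> 0 <= u -> v <= 1 ->
  leb.-integrable `]u, v[ (EFin \o w).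
Proof. by move=> aw u0 v1; apply: approx_integrable => //; exact: sub01. Qed.

Lemma incrD w u v x : approximable w -> 0 <= u -> u <= v -> v <= x -> x <= 1 ->
  incr w u x = incr w u v + incr w v x.
Proof.
move=> aw u0; rewrite le_eqVlt => /predU1P[<- _ _|uv].
  by rewrite {2}/incr set_itv_ge ?bnd_simp ?ltxx// Rintegral_set0 add0r.
rewrite le_eqVlt => /predU1P[-> _|vx x1].
  by rewrite {3}/incr set_itv_ge ?bnd_simp ?ltxx// Rintegral_set0 addr0.
have iw : leb.-integrable `]u, x[ (EFin \o w) by exact: incr_integrable.
have := @Rintegral_itvB R w (BRight u) (BLeft x) v iw.
rewrite !bnd_simp (ltW uv) => /(_ isT vx) => H.
rewrite /incr -H; rewrite [X in _ = X + _](_ : _ = \int[leb]_(t in `]u, v]) w t); first by rewrite addrC subrK.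
apply: Rintegral_itv_bndo_bndc; apply: incr_integrable => //.
by rewrite (le_trans (ltW vx)).
Qed.

Lemma prim_incr w x : approximable w -> 0 < x < 1 -> prim w x = incr w 0 x.
Proof.
move=> aw /andP[x0 x1]; rewrite /prim -Rintegral_itv_bndo_bndc//.
by apply: incr_integrable => //; exact: ltW.
Qed.

Lemma incr_bound w L u v : approximable w -> 0 <= u -> u <= v -> v <= 1 ->
  0 <= L -> (forall x, 0 < x < 1 -> `|w x| <= L) -> `|incr w u v| <= L * (v - u).
Proof.
move=> aw u0; rewrite le_eqVlt => /predU1P[<- _ L0 wL|uv v1 L0 wL].
  by rewrite /incr set_itv_ge ?bnd_simp ?ltxx// Rintegral_set0 normr0 subrr mulr0.
apply: (le_trans (le_normr_Rintegral _ _)) => //; first exact: incr_integrable.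
have -> : L * (v - u) = \int[leb]_(t in `]u, v[) L.
  by rewrite Rintegral_cst//= lebesgue_measure_itv/= lte_fin uv.
apply: le_Rintegral => //.
- have := incr_integrable aw u0 v1 => /integrable_norm.
  by apply: eq_integrable.
- exact: (incr_integrable (approx_cst L)).
- by move=> t tx; apply: wL; have := sub01 u0 v1 tx; rewrite /= in_itv.
Qed.

Lemma lebesgue_measure_shift (c : R) (A : set R) : measurable A ->
  pushforward leb ((fun t => c + t) : _ -> measurableTypeR R) A = leb A.
Proof.
have mc : measurable_fun [set: measurableTypeR R] ((fun t => c + t) : measurableTypeR R -> measurableTypeR R).
  by apply: measurable_funD => //; exact: measurable_cst.
move=> mA; apply/esym/lebesgue_measure_unique => //= _ [[a b]] _ <-.
rewrite /pushforward.
have -> : (fun t => c + t) @^-1` `]a, b]%classic = `]a - c, b - c]%classic.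
  by apply/seteqP; split => t /=; rewrite !in_itv/= ltrBlDl lerBrDl.
rewrite !lebesgue_measure_itv/= !lte_fin ltrD2r; case: ifP => // _.
by rewrite -!EFinB; congr (_%:E); lra.
Qed.

Lemma integral_shift (f : R -> \bar R) (c u v : R) :
  measurable_fun (`]u + c, v + c[%classic : set (measurableTypeR R)) f ->
  (\int[leb]_(t in `](u + c)%R, (v + c)%R[) f t = \int[leb]_(t in `]u, v[) f (c + t)%R)%E.
Proof.
have mc : measurable_fun [set: measurableTypeR R] ((fun t => c + t) : measurableTypeR R -> measurableTypeR R).
  by apply: measurable_funD => //; exact: measurable_cst.
have pre : ((fun t => c + t) : measurableTypeR R -> measurableTypeR R) @^-1` `](u + c)%R, (v + c)%R[%classic = `]u, v[%classic.
  by apply/seteqP; split => t /=; rewrite !in_itv/= ![_ + c]addrC ltrD2l ltrD2l.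
have ge0 (g : R -> \bar R) : measurable_fun (`]u + c, v + c[%classic : set (measurableTypeR R)) g ->
   (forall x, 0 <= g x)%E ->
  (\int[leb]_(t in `](u + c)%R, (v + c)%R[) g t = \int[leb]_(t in `]u, v[) g (c + t)%R)%E.
  move=> mg g0; rewrite -pre.
  rewrite -(ge0_integral_pushforward mc leb)//.
  by apply: eq_measure_integral => A mA _; exact/esym/lebesgue_measure_shift.
move=> mf; rewrite [LHS]integralE [RHS]integralE.
congr (_ - _)%E.
- by rewrite (ge0 _ (measurable_funepos mf))// [in RHS]funepos_comp.
- by rewrite (ge0 _ (measurable_funeneg mf))// [in RHS]funeneg_comp.
Qed.

Lemma incr_shift w c y : approximable w -> 0 <= c -> c + y <= 1 ->
  incr w c (c + y) = \int[leb]_(t in `]0, y[) w (c + t).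
Proof.
move=> aw c0 cy1; rewrite /incr /Rintegral.
rewrite -[in LHS](add0r c) -addrA [0 + (c + y)]addrC addr0 [c + y]addrC integral_shift//.
rewrite add0r [y + c]addrC; apply/measurable_EFinP.
by apply: measurable_funS (approx_measurable aw) => //; exact: sub01.
Qed.

Lemma shift_integrable w c y : approximable w -> 0 <= c -> c + y <= 1 ->
  leb.-integrable `]0, y[ (EFin \o (fun t => w (c + t))).
Proof.
move=> aw c0 cy1; have [M M0 wM] := approx_bounded aw.
have c01 t : 0 < t < y -> 0 < c + t < 1.
  by move=> /andP[t0 ty]; apply/andP; split; lra.
apply: measurable_bounded_integrable => //.
- rewrite /= lebesgue_measure_itv/= lte_fin; case: ifP => _; last exact: ltry.
  by rewrite sube0 ltry.
- apply: (measurable_comp (F := `]0, 1[%classic : set (measurableTypeR R))) => //.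
  + move=> _ [t tI <-]; move: tI; rewrite /= !in_itv/=; exact: c01.
  + exact: approx_measurable.
  + by apply: measurable_funD => //; exact: measurable_cst.
- exists M; split; rewrite ?num_real// => N MN t /=; rewrite in_itv/= => /c01 /wM H.
  exact: le_trans H (ltW MN).
Qed.

Lemma sum_incr_zero w (c : nat -> R) y m : approximable w ->
  (forall e, (e < m)%N -> 0 <= c e /\ c e + y <= 1) ->
  (forall t, 0 < t < y -> \sum_(e < m) w (c e + t) = 0) ->
  \sum_(e < m) incr w (c e) (c e + y) = 0.
Proof.
move=> aw c01 ct.
have H k : (k <= m)%N ->
    leb.-integrable `]0, y[ (EFin \o (fun t => \sum_(e < k) w (c e + t))) /\
    \sum_(e < k) incr w (c e) (c e + y) = \int[leb]_(t in `]0, y[) (\sum_(e < k) w (c e + t)).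
  elim: k => [_|k IH km].
    split.
      apply: (@eq_integrable _ _ _ leb _ _ (EFin \o cst 0)) => //.
        by move=> t _; rewrite /= big_ord0.
      exact: integrable0.
    rewrite big_ord0; under eq_Rintegral do rewrite big_ord0.
    by rewrite Rintegral_cst//= mul0r.
  have [I1 I2] := IH (ltnW km); have [ck0 ck1] := c01 k km.
  have I3 := shift_integrable aw ck0 ck1.
  split.
    apply: (@eq_integrable _ _ _ leb _ _ (EFin \o (fun t => \sum_(e < k) w (c e + t) + w (c k + t)))) => //.
      by move=> t _; rewrite /= big_ord_recr.
    have mI : measurable (`]0, y[%classic : set (measurableTypeR R)) by exact: measurable_itv.
    by have := integrableD mI I1 I3; apply: eq_integrable.
  rewrite big_ord_recr/= I2 incr_shift// -RintegralD//.
  by apply: eq_Rintegral => t _; rewrite big_ord_recr.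
have [_ ->] := H m (leqnn m).
rewrite (@eq_Rintegral _ _ _ leb _ (cst 0)); last first.
  by move=> t /set_mem /=; rewrite in_itv/= => /ct.
by rewrite Rintegral_cst//= mul0r.
Qed.

Variable b : nat.
Hypothesis b_gt1 : (1 < b)%N.

Let B : R := b%:R.
Let B_gt0 : 0 < B. Proof. by rewrite ltr0n (ltnW b_gt1). Qed.
Let B_neq0 : B != 0. Proof. by rewrite gt_eqF. Qed.

Definition balanced (a : nat) w := forall (z : nat) y, (z < b ^ a)%N -> 0 < y < B ^- a.+1 ->
  \sum_(e < b) w ((z * b + e)%:R * B ^- a.+1 + y) = 0.

Let cell_le1 (z a : nat) : (z < b ^ a)%N -> z%:R * B ^- a + B ^- a <= 1.
Proof.
move=> za; rewrite -[X in _ + X]mul1r -mulrDl natr1 ler_pdivrMr ?exprn_gt0// mul1r.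
by rewrite /B -natrX ler_nat.
Qed.

Let cell_lt (z a e : nat) : (z < b ^ a)%N -> (e < b)%N -> (z * b + e < b ^ a.+1)%N.
Proof. by move=> za eb; rewrite expnSr; nia. Qed.

Lemma balanced_block a w z : approximable w -> balanced a w -> (z < b ^ a)%N ->
  incr w (z%:R * B ^- a) (z.+1%:R * B ^- a) = 0.
Proof.
move=> aw zw za.
have hE : B ^- a = b%:R * B ^- a.+1 by rewrite exprS invfM mulrA divff ?mul1r.
transitivity (\sum_(e < b) incr w ((z * b + e)%:R * B ^- a.+1) ((z * b + e)%:R * B ^- a.+1 + B ^- a.+1)); last first.
  apply: (sum_incr_zero (c := fun e => (z * b + e)%:R * B ^- a.+1)) => //.
    move=> e eb; split; first by rewrite mulr_ge0// invr_ge0 exprn_ge0// ltW.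
    exact/cell_le1/cell_lt.
  by move=> t t0; exact: zw.
have H k : (k <= b)%N -> incr w (z%:R * B ^- a) ((z * b + k)%:R * B ^- a.+1) =
    \sum_(e < k) incr w ((z * b + e)%:R * B ^- a.+1) ((z * b + e)%:R * B ^- a.+1 + B ^- a.+1).
  elim: k => [_|k IH kb].
    rewrite big_ord0 addn0 hE mulrA -natrM /incr set_itv_ge ?Rintegral_set0//.
    by rewrite bnd_simp ltxx.
  have E : (z * b + k.+1)%:R * B ^- a.+1 = (z * b + k)%:R * B ^- a.+1 + B ^- a.+1.
    by rewrite addnS -natr1 mulrDl mul1r.
  rewrite big_ord_recr/= -IH; last exact: ltnW.
  rewrite E; apply: incrD => //.
  - by rewrite mulr_ge0// invr_ge0 exprn_ge0// ltW.
  - rewrite hE mulrA -natrM; apply: ler_wpM2r; first by rewrite invr_ge0 exprn_ge0// ltW.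
    by rewrite ler_nat leq_addr.
  - by rewrite lerDl invr_ge0 exprn_ge0// ltW.
  - exact/cell_le1/cell_lt.
rewrite -H//; congr incr; rewrite hE mulrA -natrM; congr (_%:R * _).
by rewrite mulSn addnC.
Qed.

Lemma balanced_grid a w z : approximable w -> balanced a w -> (z <= b ^ a)%N ->
  incr w 0 (z%:R * B ^- a) = 0.
Proof.
move=> aw zw; elim: z => [_|z IH za].
  by rewrite mul0r /incr set_itv_ge ?Rintegral_set0// bnd_simp ltxx.
rewrite (@incrD _ _ (z%:R * B ^- a))//.
- by rewrite IH ?(ltnW za)// balanced_block// addr0.
- by rewrite mulr_ge0// invr_ge0 exprn_ge0// ltW.
- by apply: ler_wpM2r; [rewrite invr_ge0 exprn_ge0// ltW|rewrite ler_nat].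
- rewrite -natr1 mulrDl mul1r; exact: cell_le1.
Qed.

Lemma balanced_mean a w : approximable w -> balanced a w -> mean w = 0.
Proof.
move=> aw zw; have := balanced_grid aw zw (leqnn _).
by rewrite natrX divff ?expf_neq0.
Qed.

Lemma balanced_prim_bound a w L : approximable w -> balanced a w -> 0 <= L ->
  (forall x, 0 < x < 1 -> `|w x| <= L) ->
  forall x, 0 < x < 1 -> `|prim w x| <= L * B ^- a.
Proof.
move=> aw zw L0 wL x x01; rewrite prim_incr//; case/andP: x01 => x0 x1.
have Ba0 : 0 < B ^+ a by rewrite exprn_gt0.
pose z := Num.trunc (x * B ^+ a).
have /andP[z1 z2] : z%:R <= x * B ^+ a < z.+1%:R.
  by apply: truncn_itv; rewrite mulr_ge0// ltW.
have za : (z < b ^ a)%N.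
  rewrite -(ltr_nat R); apply: le_lt_trans z1 _.
  by rewrite natrX -/B -[ltRHS]mul1r ltr_pM2r.
have zx : z%:R * B ^- a <= x by rewrite ler_pdivrMr.
rewrite (@incrD _ _ (z%:R * B ^- a))//; last exact: ltW.
  rewrite balanced_grid// ?add0r; last exact: ltnW.
  apply: (le_trans (incr_bound aw _ zx (ltW x1) L0 wL)).
    by rewrite mulr_ge0// invr_ge0 exprn_ge0// ltW.
  rewrite ler_wpM2l// lerBlDr -[X in X + _]mul1r -mulrDl ler_pdivlMr//.
  by rewrite addrC natr1 ltW.
by rewrite mulr_ge0// invr_ge0 exprn_ge0// ltW.
Qed.

Lemma balanced_prim a a' w : approximable w -> balanced a w -> balanced a' w -> (a' < a)%N ->
  balanced a' (prim w).
Proof.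
move=> aw zw zw' aa z y za /andP[y0 y1].
pose c (e : nat) := (z * b + e)%:R * B ^- a'.+1.
have c0 e : 0 <= c e by rewrite mulr_ge0// invr_ge0 exprn_ge0// ltW.
have cy (e : nat) : (e < b)%N -> c e + y < 1.
  move=> eb; apply: (@lt_le_trans _ _ (c e + B ^- a'.+1)); first by rewrite ltrD2l.
  exact/cell_le1/cell_lt.
rewrite -[RHS](@sum_incr_zero w c y b aw); last 2 first.
- by move=> e eb; split => //; apply/ltW/cy.
- move=> t /andP[t0 ty]; apply: zw' => //; rewrite t0/=; exact: lt_trans ty y1.
apply: eq_bigr => e _; rewrite -/(c e).
rewrite prim_incr//; last by rewrite cy// andbT; apply: ltr_wpDl.
rewrite (@incrD _ _ (c e)) ?lerDl ?(ltW y0) ?(ltW (cy e _))//.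
suff -> : incr w 0 (c e) = 0 by rewrite add0r.
have -> : c e = ((z * b + e) * b ^ (a - a'.+1))%:R * B ^- a.
  rewrite /c natrM natrX -/B -mulrA; congr (_ * _).
  have -> : B ^+ a = B ^+ (a - a'.+1) * B ^+ a'.+1 by rewrite -exprD subnK.
  by rewrite invfM mulrA divff ?mul1r// expf_neq0.
apply: balanced_grid => //; rewrite -[X in (_ <= b ^ X)%N](subnK aa) expnD mulnC.
by rewrite leq_mul2l; apply/orP; right; apply/ltnW/cell_lt.
Qed.

Lemma balanced_prim_bounded d (S : seq nat) L w : sorted gtn S -> approximable w ->
  (forall a, a \in S -> balanced a w) -> 0 <= L -> (forall x, 0 < x < 1 -> `|w x| <= L) ->
  prim_bounded d (2 ^+ d * L * \prod_(a <- take d S) B ^- a) w.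
Proof.
elim: d S L w => [|d IH] S L w sS aw zS L0 wL.
  by rewrite take0 big_nil mulr1 mul1r.
case: S sS zS => [|a S] sS zS.
  by rewrite big_nil mulr1; exact: prim_bounded_sup.
have za : balanced a w by apply: zS; rewrite mem_head.
have prod0 : 0 <= \prod_(a0 <- take d S) B ^- a0.
  by apply: prodr_ge0 => i _; rewrite invr_ge0 exprn_ge0// ltW.
have Ba : 0 <= B ^- a by rewrite invr_ge0 exprn_ge0// ltW.
rewrite /= big_cons; split => //.
have mw := balanced_mean aw za; split.
  by rewrite mw normr0 !mulr_ge0.
have -> : (fun x => w x - mean w) = w by apply/funext => x; rewrite mw subr0.
apply: (@le_prim_bounded _ _ (2 ^+ d * (L * B ^- a) * \prod_(a0 <- take d S) B ^- a0)).
  rewrite exprSr -!mulrA ler_wpM2l ?exprn_ge0// ler_peMl ?mulr_ge0//.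
  by rewrite (ler_nat _ 1 2).
apply: IH => //.
- exact: path_sorted sS.
- by have := approx_prim aw; rewrite mw; under eq_fun do rewrite subr0.
- move=> a' aS'; apply: (balanced_prim aw za).
    by apply: zS; rewrite in_cons aS' orbT.
  by have /allP := order_path_min (rev_trans ltn_trans) sS; apply.
- exact: mulr_ge0.
- exact: balanced_prim_bound.
Qed.

Definition cell_step n (V : nat -> R) (x : R) : R :=
  \sum_(c < b ^ n) V c * (c%:R * B ^- n <= x < c.+1%:R * B ^- n)%R%:R.

Lemma cell_step_approx n V : approximable (cell_step n V).
Proof.
rewrite /cell_step; elim: (index_enum _) => [|c s IH].
  by apply: (eq_approx _ (approx_cst 0)) => x _; rewrite big_nil.
have Bn : 0 <= B ^- n by rewrite invr_ge0 exprn_ge0// ltW.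
apply: (@eq_approx _ (fun x => V c * (c%:R * B ^- n <= x < c.+1%:R * B ^- n)%R%:R +
   \sum_(j <- s) V j * (j%:R * B ^- n <= x < j.+1%:R * B ^- n)%R%:R)).
  by move=> x _; rewrite big_cons.
apply: approxD => //; apply: approxZ; apply: approx_itv; first by rewrite mulr_ge0.
by rewrite -natr1 mulrDl mul1r; exact: cell_le1.
Qed.

Lemma cell_stepE n V (c : nat) x : (c < b ^ n)%N ->
  c%:R * B ^- n <= x < c.+1%:R * B ^- n -> cell_step n V x = V c.
Proof.
move=> cn /andP[x1 x2]; rewrite /cell_step (bigD1 (Ordinal cn))//= x1 x2 mulr1.
rewrite big1 ?addr0// => d dc.
case: (boolP (_ && _)) => [xd|_]; last by rewrite mulr0.
case/negP: dc; apply/eqP/val_inj => /=.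
exact: (cell_unique b_gt1 xd (introT andP (conj x1 x2))).
Qed.

Lemma cell_index n (x : R) : 0 <= x -> x < 1 ->
  exists2 c : nat, (c < b ^ n)%N & c%:R * B ^- n <= x < c.+1%:R * B ^- n.
Proof.
move=> x0 x1; have Bn0 : 0 < B ^+ n by rewrite exprn_gt0.
exists (Num.trunc (x * B ^+ n)); last first.
  rewrite ler_pdivrMr// ltr_pdivlMr//; apply: truncn_itv.
  by rewrite mulr_ge0// ltW.
rewrite -(ltr_nat R) natrX -/B; apply: (@le_lt_trans _ _ (x * B ^+ n)).
  by rewrite truncn_le mulr_ge0// ltW.
by rewrite -[ltRHS]mul1r ltr_pM2r.
Qed.

Lemma cell_step_bound n V L : (forall c, (c < b ^ n)%N -> `|V c| <= L) ->
  forall x, 0 < x < 1 -> `|cell_step n V x| <= L.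
Proof.
move=> VL x /andP[x0 x1]; have [c cn cx] := cell_index n (ltW x0) x1.
by rewrite (cell_stepE V cn cx); exact: VL.
Qed.

Lemma balanced_cell_step n V a : (a < n)%N ->
  (forall z c0, (z < b ^ a)%N -> (c0 < b ^ (n - a.+1))%N ->
     \sum_(e < b) V ((z * b + e) * b ^ (n - a.+1) + c0)%N = 0) ->
  balanced a (cell_step n V).
Proof.
move=> an HV z y za /andP[y0 y1].
have BnE : B ^- a.+1 = (b ^ (n - a.+1))%:R * B ^- n.
  have -> : B ^+ n = B ^+ (n - a.+1) * B ^+ a.+1 by rewrite -exprD subnK.
  by rewrite natrX invfM mulrA divff ?mul1r// expf_neq0.
have Bn0 : 0 < B ^+ n by rewrite exprn_gt0.
have Bn : 0 < B ^- n by rewrite invr_gt0.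
pose c0 := Num.trunc (y * B ^+ n).
have /andP[c1 c2] : c0%:R <= y * B ^+ n < c0.+1%:R.
  by apply: truncn_itv; rewrite mulr_ge0// ltW.
have c0n : (c0 < b ^ (n - a.+1))%N.
  rewrite -(ltr_nat R); apply: le_lt_trans c1 _.
  by rewrite -ltr_pdivlMr// -BnE.
rewrite -[RHS](HV z c0 za c0n); apply: eq_bigr => e _; apply: cell_stepE.
  have := cell_lt za (ltn_ord e).
  have -> : (b ^ n = b ^ (n - a.+1) * b ^ a.+1)%N by rewrite -expnD subnK.
  by move=> H; nia.
have E : ((z * b + e) * b ^ (n - a.+1) + c0)%:R * B ^- n = (z * b + e)%:R * B ^- a.+1 + c0%:R * B ^- n.
  by rewrite BnE mulrA -natrM -mulrDl -natrD.
have y1' : c0%:R * B ^- n <= y by rewrite ler_pdivrMr.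
have y2' : y < c0%:R * B ^- n + B ^- n.
  by rewrite -[X in _ + X]mul1r -mulrDl natr1 ltr_pdivlMr.
by rewrite -[(_ + c0).+1%:R]natr1 mulrDl E mul1r; apply/andP; split; lra.
Qed.

End zero_sum.

(** * F *)

Section densities.
Context {R : realType}.
Local Notation leb := (@lebesgue_measure R).
Implicit Types (w f g : R -> R).

Lemma incr_cst w u v c : u <= v -> (forall t, u < t < v -> w t = c) ->
  incr w u v = c * (v - u).
Proof.
rewrite le_eqVlt => /predU1P[<- _|uv wc].
  by rewrite /incr set_itv_ge ?bnd_simp ?ltxx// Rintegral_set0 subrr mulr0.
rewrite /incr (@eq_Rintegral _ _ _ leb _ (cst c)); last first.
  by move=> t /set_mem /=; rewrite in_itv/= => /wc.
by rewrite Rintegral_cst//= lebesgue_measure_itv/= lte_fin uv.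
Qed.

Lemma incr_ge0 w u v : (forall t, 0 <= w t) -> 0 <= incr w u v.
Proof. by move=> w0; apply: Rintegral_ge0. Qed.

Lemma incr_lin f g c u v : approximable f -> approximable g -> 0 <= u -> v <= 1 ->
  incr (fun x => f x + c * g x) u v = incr f u v + c * incr g u v.
Proof.
move=> af ag u0 v1.
have mI : measurable (`]u, v[%classic : set (measurableTypeR R)) by exact: measurable_itv.
have i1 := incr_integrable af u0 v1; have i2 := incr_integrable ag u0 v1.
rewrite /incr RintegralD//=; last by apply: (incr_integrable (approxZ c ag)).
by rewrite RintegralZl.
Qed.

Lemma le_incr f g u v : approximable f -> approximable g -> 0 <= u -> v <= 1 ->
  (forall x, 0 < x < 1 -> `|f x| <= g x) -> `|incr f u v| <= incr g u v.
Proof.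
move=> af ag u0 v1 fg.
have mI : measurable (`]u, v[%classic : set (measurableTypeR R)) by exact: measurable_itv.
apply: (le_trans (le_normr_Rintegral mI (incr_integrable af u0 v1))).
apply: le_Rintegral => //.
- by have := integrable_norm (incr_integrable af u0 v1); apply: eq_integrable.
- exact: incr_integrable.
- move=> t /=; rewrite in_itv/= => /andP[ut tv]; apply: fg.
  by rewrite (le_lt_trans u0 ut) (lt_le_trans tv v1).
Qed.

Definition density (a h : R) (x : R) : R := h^-1 * (a <= x < a + h)%R%:R.

Section density.
Variables a h : R.
Hypotheses (a0 : 0 <= a) (h0 : 0 < h) (ah1 : a + h <= 1).

Lemma density_approx : approximable (density a h).
Proof. exact/approxZ/approx_itv. Qed.

Lemma density_ge0 x : 0 <= density a h x.
Proof. by rewrite mulr_ge0// invr_ge0 ltW. Qed.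

Lemma incr_density_lt x : 0 <= x -> x <= a -> incr (density a h) 0 x = 0.
Proof.
move=> x0 xa; rewrite (@incr_cst _ _ _ 0) ?mul0r// => t /andP[_ tx].
by rewrite /density leNgt (lt_le_trans tx xa) /= mulr0.
Qed.

Lemma incr_density_gt x : a + h <= x -> x <= 1 -> incr (density a h) 0 x = 1.
Proof.
move=> ahx x1.
have aah : a <= a + h by rewrite lerDl ltW.
rewrite (@incrD _ _ _ (a + h))//; last 2 first.
- exact: density_approx.
- exact: le_trans a0 aah.
rewrite (@incrD _ _ _ a)//; last exact: density_approx.
rewrite incr_density_lt// add0r (@incr_cst _ a (a + h) h^-1)//; last first.
  by move=> t /andP[at_ tah]; rewrite /density (ltW at_) tah mulr1.
rewrite (@incr_cst _ (a + h) x 0)//; last first.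
  by move=> t /andP[at_ tah]; rewrite /density [t < _]ltNge (ltW at_) andbF mulr0.
by rewrite mul0r addr0 [a + h]addrC addrK mulVf// gt_eqF.
Qed.

Lemma incr_density01 x : 0 <= x -> x <= 1 -> 0 <= incr (density a h) 0 x <= 1.
Proof.
move=> x0 x1; apply/andP; split; first by apply: incr_ge0; exact: density_ge0.
rewrite -(incr_density_gt ah1 (lexx 1)) (@incrD _ (density a h) 0 x 1)//; last exact: density_approx.
by rewrite lerDl; apply: incr_ge0; exact: density_ge0.
Qed.

Lemma mean_density : mean (density a h) = 1.
Proof. exact: incr_density_gt. Qed.

Lemma density_prim_bounded d : prim_bounded d.+1 (2 ^+ d) (density a h).
Proof.
split; first exact: density_approx.
rewrite mean_density; split.
  by rewrite normr1; apply: exprn_ege1; rewrite (ler_nat _ 1 2).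
have aw := approxB 1 density_approx.
rewrite -[2 ^+ d]mulr1; apply: prim_bounded_sup => //.
  by have := approx_prim density_approx; rewrite mean_density.
move=> x x01; rewrite prim_incr//; case/andP: x01 => x0 x1.
have -> : incr (fun y => density a h y - 1) 0 x = incr (density a h) 0 x - x.
  have -> : (fun y => density a h y - 1) = (fun y => density a h y + (- 1) * 1).
    by apply/funext => y; rewrite mulr1.
  rewrite (incr_lin (-1) density_approx approx1 (lexx 0) (ltW x1)).
  by rewrite (@incr_cst (fun=> 1) 0 x 1) ?(ltW x0)// mul1r subr0 mulN1r.
have /andP[] := incr_density01 (ltW x0) (ltW x1).
by rewrite ler_norml => *; apply/andP; split; lra.
Qed.

End density.

Lemma density_diff_prim_bounded d (a h h' : R) : 0 <= a -> 0 < h' -> h' <= h -> a + h <= 1 ->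
  prim_bounded d.+2 (2 ^+ d.+1 * h) (fun x => density a h' x - density a h x).
Proof.
move=> a0 h'0 h'h ah1.
have h0 : 0 < h by exact: lt_le_trans h'h.
have ah'1 : a + h' <= 1 by lra.
have a1 : approximable (density a h') by exact: density_approx.
have a2 : approximable (density a h) by exact: density_approx.
have DE : (fun x => density a h' x - density a h x) = (fun x => density a h' x + (- 1) * density a h x).
  by apply/funext => x; rewrite mulN1r.
have aD : approximable (fun x => density a h' x - density a h x).
  by rewrite DE; apply: approxD => //; exact: approxZ.
have mD : mean (fun x => density a h' x - density a h x) = 0.
  by rewrite DE mean_lin// !mean_density// mulr1 subrr.
have K0 : 0 <= 2 ^+ d.+1 * h by rewrite mulr_ge0 ?exprn_ge0// ltW.
split=> //; rewrite mD normr0; split => //.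
have -> : (fun x => density a h' x - density a h x - 0) = (fun x => density a h' x - density a h x).
  by apply/funext => x; rewrite subr0.
set V := prim _.
have aV : approximable V.
  by have := approx_prim aD; rewrite mD; under eq_fun do rewrite subr0.
have VE x : 0 < x < 1 -> V x = incr (density a h') 0 x - incr (density a h) 0 x.
  move=> x01; rewrite /V prim_incr//; case/andP: x01 => x0 x1.
  by rewrite DE incr_lin ?(ltW x1)// mulN1r.
have VX x : 0 < x < 1 -> `|V x| <= h * density a h x.
  move=> x01; rewrite VE//; case/andP: x01 => x0 x1.
  have hd : h * density a h x = (a <= x < a + h)%R%:R by rewrite /density mulrA divff ?mul1r// gt_eqF.
  rewrite hd.
  have [ax|xa] := leP a x; last by rewrite !incr_density_lt ?subrr ?normr0//; exact: ltW.
  have [xah|ahx] := ltP x (a + h); last first.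
    by rewrite !incr_density_gt ?subrr ?normr0//; lra.
  have /andP[u1 u2] := incr_density01 a0 h'0 ah'1 (ltW x0) (ltW x1).
  have /andP[v1 v2] := incr_density01 a0 h0 ah1 (ltW x0) (ltW x1).
  by rewrite ler_norml /=; apply/andP; split; lra.
have incrV x : 0 <= x -> x <= 1 -> `|incr V 0 x| <= h.
  move=> x0 x1; apply: (le_trans (le_incr aV (approxZ h a2) (lexx 0) x1 VX)).
  have -> : (fun x => h * density a h x) = (fun x => 0 + h * density a h x).
    by apply/funext => y; rewrite add0r.
  rewrite (incr_lin h (approx_cst 0) a2 (lexx 0) x1) (@incr_cst (fun=> 0) 0 x 0)// mul0r add0r.
  have /andP[u1 u2] := incr_density01 a0 h0 ah1 x0 x1.
  by rewrite ler_piMr// ltW.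
split=> //; split.
  apply: (le_trans (incrV 1 ler01 (lexx 1))).
  by rewrite ler_peMl ?(ltW h0)//; apply: exprn_ege1; rewrite (ler_nat _ 1 2).
rewrite exprSr -mulrA; apply: prim_bounded_sup => //.
- by rewrite mulr_ge0// ltW.
- exact: approx_prim.
- move=> x x01; rewrite prim_incr//; last exact: approxB.
  case/andP: x01 => x0 x1.
  have -> : (fun y => V y - mean V) = (fun y => V y + (- mean V) * 1).
    by apply/funext => y; rewrite mulr1.
  rewrite (incr_lin _ aV approx1 (lexx 0) (ltW x1)) (@incr_cst (fun=> 1) 0 x 1) ?(ltW x0)//.
  rewrite mul1r subr0.
  have H1 := incrV x (ltW x0) (ltW x1).
  have H2 := incrV 1 ler01 (lexx 1).
  apply: (le_trans (ler_normD _ _)); rewrite normrM normrN [`|x|]ger0_norm ?(ltW x0)//.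
  have -> : mean V = incr V 0 1 by [].
  by have := normr_ge0 (incr V 0 1); nra.
Qed.

End densities.

(** * G *)

Lemma cvg_prod_seq (R : realType) (I T : Type) (F : set_system T) {FF : Filter F}
    (l : seq I) (f : I -> T -> R) (a : I -> R) :
  (forall i, f i x @[x --> F] --> a i) ->
  \prod_(i <- l) f i x @[x --> F] --> \prod_(i <- l) a i.
Proof.
move=> fa; elim: l => [|i l IH].
  rewrite big_nil; under eq_fun do rewrite big_nil.
  exact: cvg_cst.
rewrite big_cons; under eq_fun do rewrite big_cons.
exact: cvgM.
Qed.

Section products.
Context {R : realType} {s : nat}.
Local Notation Rs := 'rV[R]_s.
Local Notation mu := (@lebesgue_rV R s).
Implicit Types (phi w : 'I_s -> R -> R).

Definition tprod phi (x : Rs) : R := \prod_j phi j (x ord0 j).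

Definition update phi i (g : R -> R) j := if j == i then g else phi j.

Lemma tprod_update phi i g x :
  tprod (update phi i g) x = g (x ord0 i) * \prod_(j | j != i) phi j (x ord0 j).
Proof.
rewrite /tprod (bigD1 i)//= {1}/update eqxx; congr (_ * _).
by apply: eq_bigr => j ji; rewrite /update (negbTE ji).
Qed.

Lemma tprodD1 phi i x :
  tprod phi x = phi i (x ord0 i) * \prod_(j | j != i) phi j (x ord0 j).
Proof. by rewrite /tprod (bigD1 i). Qed.

Lemma partial_tprod phi i : (forall j, smooth1 (phi j)) ->
  partial i (tprod phi) = tprod (update phi i (derive1 (phi i))) /\
  forall x, derivable (tprod phi) x (delta_mx ord0 i).
Proof.
move=> sphi.
have E x h : h^-1 *: (tprod phi (h *: delta_mx ord0 i + x) - tprod phi x) =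
   (h^-1 *: (phi i (h *: (1:R) + x ord0 i) - phi i (x ord0 i))) *
     (\prod_(j | j != i) phi j (x ord0 j)).
  rewrite !(tprodD1 _ i) !mxE /= eqxx mulr1.
  have -> : \prod_(j | j != i) phi j ((h *: delta_mx ord0 i + x) ord0 j) =
            \prod_(j | j != i) phi j (x ord0 j).
    by apply: eq_bigr => j ji; rewrite !mxE /= (negbTE ji) mulr0 add0r.
  by rewrite -mulrBl /GRing.scale/= mulr1 mulrA.
have D x : h^-1 *: (tprod phi (h *: delta_mx ord0 i + x) - tprod phi x) @[h --> (0:R)^'] -->
    derive1 (phi i) (x ord0 i) * \prod_(j | j != i) phi j (x ord0 j).
  under eq_fun do rewrite E.
  apply: cvgM; last exact: cvg_cst.
  have [d <-] := smooth1_derivable (x ord0 i) (sphi i).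
  exact: d.
split=> [|x]; last by apply/cvg_ex; eexists; exact: D.
apply/funext => x; rewrite tprod_update; exact: (cvg_lim (@norm_hausdorff _ _) (D x)).
Qed.

Lemma update_smooth phi i g : (forall j, smooth1 (phi j)) -> smooth1 g ->
  forall j, smooth1 (update phi i g j).
Proof. by move=> sphi sg j; rewrite /update; case: ifP. Qed.

Lemma continuous_tprod phi : (forall j, continuous (phi j)) -> continuous (tprod phi).
Proof.
move=> cphi x; apply: (@cvg_prod_seq _ _ _ (nbhs x) (nbhs_filter x)) => j.
apply: (continuous_comp (f := fun y : Rs => y ord0 j)); last exact: cphi.
exact: coord_continuous.
Qed.

Lemma smooth_tprod phi : (forall j, smooth1 (phi j)) -> smooth (tprod phi).
Proof.
move=> sphi js.
suff [psi [spsi E]] : exists psi, (forall j, smooth1 (psi j)) /\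
    foldr (@partial R s) (tprod phi) js = tprod psi.
  rewrite E; split; first by apply: continuous_tprod => j; exact: smooth1_continuous.
  by move=> x j; have [] := partial_tprod j spsi.
elim: js => [|i js [psi [spsi E]]]; first by exists phi.
exists (update psi i (derive1 (psi i))); split.
  by apply: update_smooth => //; exact: smooth1_deriv.
by rewrite /= E; have [] := partial_tprod i spsi.
Qed.

Lemma test_tprod phi : (forall j, test1 (phi j)) -> test_function (tprod phi).
Proof.
move=> tphi; split; first by apply: smooth_tprod => j; have [] := tphi j.
have /choice [d dP] j : exists d : R, 0 < d /\ forall x, phi j x != 0 -> d <= x <= 1 - d.
  by have [_ [d d0 H]] := tphi j; exists d.
have [e e0 ed] : exists2 e : R, 0 < e & forall j, e <= d j.
  suff [e e0 ed] : exists2 e : R, 0 < e & forall j, j \in enum 'I_s -> e <= d j.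
    by exists e => // j; apply: ed; rewrite mem_enum.
  elim: (enum 'I_s) => [|j l [e e0 el]]; first by exists 1.
  exists (Num.min e (d j)); first by rewrite lt_min e0; have [] := dP j.
  move=> i; rewrite in_cons ge_min => /predU1P[->|/el ->] //.
  by rewrite lexx orbT.
exists e => // x; rewrite /tprod => /prodf_neq0 H j.
have [_ dj] := dP j; have /andP[h1 h2] := dj _ (H j isT).
by have := ed j; move=> h3; apply/andP; split; lra.
Qed.

Lemma iter_partial_tprod phi i k : (forall j, smooth1 (phi j)) ->
  iter k (partial i) (tprod phi) = tprod (update phi i (derive1n k (phi i))).
Proof.
move=> sphi; elim: k => [|k IH] /=.
  by congr tprod; apply/funext => j; rewrite /update; case: eqP => // ->.
rewrite IH; have [-> _] := partial_tprod i (update_smooth i sphi (smooth1_derivn k (sphi i))).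
congr tprod; apply/funext => j; rewrite /update eqxx; case: eqP => // _.
Qed.

Lemma mixed_partial_tprod (h : 'I_s -> nat) phi : (forall j, smooth1 (phi j)) ->
  mixed_partial h (tprod phi) = tprod (fun j => derive1n (h j) (phi j)).
Proof.
move=> sphi; rewrite /mixed_partial.
suff H l : uniq l -> foldr (fun j => iter (h j) (partial j)) (tprod phi) l =
    tprod (fun j => if j \in l then derive1n (h j) (phi j) else phi j).
  rewrite H ?enum_uniq//; congr tprod; apply/funext => j.
  by rewrite mem_enum.
elim: l => [_|i l IH /= /andP[il ul]]; first by congr tprod.
rewrite IH// iter_partial_tprod; last first.
  by move=> j; case: ifP => // _; exact: smooth1_derivn.
congr tprod; apply/funext => j; rewrite /update in_cons (negbTE il).
by case: eqP => [->|].
Qed.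

Lemma measurable_open_cube : measurable (@open_cube R s).
Proof.
have -> : @open_cube R s = box (fun=> `]0, 1[%classic).
  by apply/seteqP; split => x /= H j; have := H j; rewrite /= in_itv.
by apply: measurable_box => j; exact: measurable_itv.
Qed.

Lemma open_cube_sub : @open_cube R s `<=` cube.
Proof. by move=> x H j; have /andP[h1 h2] := H j; rewrite ltW. Qed.

Lemma Rintegral_open_cube (F : Rs -> R) : mu.-integrable cube (EFin \o F) ->
  \int[mu]_(x in cube) F x = \int[mu]_(x in open_cube) F x.
Proof.
move=> iF; rewrite /Rintegral; congr fine.
have mN : measurable (@cube R s `\` @open_cube R s).
  by apply: measurableD; [exact: measurable_cube|exact: measurable_open_cube].
rewrite (@negligible_integral _ _ _ mu cube (cube `\` open_cube))//.
- congr (integral _ _ _); rewrite setDD setIC; apply/setIidl; exact: open_cube_sub.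
- exact: measurable_cube.
- apply/negligibleP => //.
  have := @cube_boundary_negligible R s; apply: negligibleS => x /= [cx ox] H.
  by apply: ox; exact: H.
Qed.

Lemma measurable_coord01 (w : R -> R) j :
  measurable_fun (`]0, 1[%classic : set (measurableTypeR R)) w ->
  measurable_fun (@open_cube R s) (fun x => w (x ord0 j)).
Proof.
move=> mw.
apply: (measurable_comp (F := `]0, 1[%classic : set (measurableTypeR R)) (f := w) (g := fun x : Rs => (x ord0 j : measurableTypeR R))) => //.
- by move=> _ [x ox <-] /=; rewrite in_itv/=; exact: ox.
- by apply: measurable_funTS; exact: (@measurable_rV_coord _ R s j).
Qed.

Lemma measurable_tprod w : (forall j, measurable_fun (`]0, 1[%classic : set (measurableTypeR R)) (w j)) ->
  measurable_fun (@open_cube R s) (tprod w).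
Proof.
move=> mw; rewrite /tprod; elim: (index_enum _) => [|j l IH].
  by under eq_fun do rewrite big_nil; exact: measurable_cst.
under eq_fun do rewrite big_cons.
by apply: measurable_funM => //; exact: measurable_coord01.
Qed.

Lemma tprod_bound w (K : 'I_s -> R) : (forall j x, 0 < x < 1 -> `|w j x| <= K j) ->
  forall x, open_cube x -> `|tprod w x| <= \prod_j K j.
Proof.
move=> wK x ox; rewrite /tprod normr_prod; apply: ler_prod => j _.
by rewrite normr_ge0 wK//; exact: ox.
Qed.

End products.

(** * H *)

Section weak_ibp.
Context {R : realType}.

Lemma test1_derive1 (f : R -> R) : test1 f -> test1 (derive1 f).
Proof.
move=> [sf [d d0 fd]]; split; first exact: smooth1_deriv.
exists d => // x; apply: contraNT; rewrite negb_and -!ltNge => xd.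
rewrite derive1E (near_eq_derive (g := fun=> 0)) ?derive_cst//.
have f0 y : (y < d) || (1 - d < y) -> f y = 0.
  by move=> yd; apply/eqP; apply: contraLR yd => /fd; rewrite negb_or -!leNgt.
case/orP: xd => xd; near=> y; apply: f0; apply/orP.
- by left; near: y; exact: lt_nbhsl.
- by right; near: y; exact: lt_nbhsr.
Unshelve. all: by end_near. Qed.

Context {s : nat}.
Local Notation Rs := 'rV[R]_s.
Local Notation mu := (@lebesgue_rV R s).
Implicit Types (h : 'I_s -> nat) (w : 'I_s -> R -> R) (G : Rs -> R).

Let mo : measurable (open_cube : set Rs) := @measurable_open_cube R s.
Let mc : measurable (cube : set Rs) := @measurable_cube R s.

Lemma tprod_Rint_cvg G (phi : nat -> 'I_s -> R -> R) w (M : 'I_s -> R) :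
  mu.-integrable open_cube (EFin \o G) -> (forall k j, test1 (phi k j)) ->
  (forall k j x, `|phi k j x| <= M j) ->
  (forall j x, 0 < x < 1 -> (fun k => phi k j x) @ \oo --> w j x) ->
  \int[mu]_(x in open_cube) (G x * tprod (phi k) x) @[k --> \oo] -->
  \int[mu]_(x in open_cube) (G x * tprod w x).
Proof.
move=> mg tphi phiM phiw.
have aw j : approximable (w j).
  exists (fun k => phi k j); split => //; first by exists (M j).
  exact: phiw.
have mtp k : measurable_fun (open_cube : set Rs) (tprod (phi k)).
  by apply: measurable_tprod => j; apply: approx_measurable; exact: test1_approx.
have mtw : measurable_fun (open_cube : set Rs) (tprod w).
  by apply: measurable_tprod => j; exact: approx_measurable.
have [mgo _] := integrableP _ _ _ mg.
have mgR : measurable_fun (open_cube : set Rs) G by exact/measurable_EFinP.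
apply: (@Rdominated_cvg _ _ _ mu open_cube (fun k x => G x * tprod (phi k) x)
  (fun x => G x * tprod w x) (fun x => (\prod_j M j) * `|G x|) mo _ _ _ _ _).2.
- by move=> k; exact: measurable_funM.
- exact: measurable_funM.
- apply: aeW => x ox; apply: cvgM; first exact: cvg_cst.
  by apply: cvg_prod_seq => j; apply: phiw; exact: ox.
- have := integrableZl mo (\prod_j M j) (integrable_norm mg).
  by apply: eq_integrable.
- move=> k x ox; rewrite normrM mulrC ler_wpM2r//.
  by apply: tprod_bound => // j y _; exact: phiM.
Qed.

Lemma integrable_bddM (D : set Rs) G (phi : Rs -> R) (M : R) : measurable D ->
  mu.-integrable D (EFin \o G) ->
  measurable_fun D phi -> (forall x, D x -> `|phi x| <= M) ->
  mu.-integrable D (EFin \o (fun x => G x * phi x)).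
Proof.
move=> mD ig mphi pM.
have bphi : [bounded phi x | x in D].
  exists M; split; first exact: num_real.
  by move=> N MN x cx; apply: (le_trans (pM x cx)); exact: ltW.
have := integrableMl mD ig mphi bphi.
by apply: eq_integrable => // x _; rewrite /= EFinM.
Qed.

Lemma integrable_tprod G w : mu.-integrable open_cube (EFin \o G) ->
  (forall j, approximable (w j)) ->
  mu.-integrable open_cube (EFin \o (fun x => G x * tprod w x)).
Proof.
move=> iG aw.
have /choice [M HM] j : exists M : R, forall x, 0 < x < 1 -> `|w j x| <= M.
  by have [M _ HM] := approx_bounded (aw j); exists M.
apply: (@integrable_bddM _ _ _ (\prod_j M j)) => //.
  by apply: measurable_tprod => j; exact: approx_measurable.
exact: tprod_bound.
Qed.

Lemma measurable_tprod_cube w : (forall j, measurable_fun [set: R] (w j)) ->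
  measurable_fun (cube : set Rs) (tprod w).
Proof.
move=> mw; rewrite /tprod; elim: (index_enum _) => [|j l IH].
  by under eq_fun do rewrite big_nil; exact: measurable_cst.
under eq_fun do rewrite big_cons.
apply: measurable_funM => //.
apply: measurable_funTS; apply: (measurableT_comp (f := w j)); first exact: mw.
exact: (@measurable_rV_coord _ R s j).
Qed.

Lemma Rintegral_sum (I : Type) (l : seq I) (F : I -> Rs -> R) :
  (forall i, mu.-integrable open_cube (EFin \o F i)) ->
  \int[mu]_(x in open_cube) (\sum_(i <- l) F i x) =
  \sum_(i <- l) \int[mu]_(x in open_cube) F i x.
Proof.
move=> iF; suff H : mu.-integrable open_cube (EFin \o (fun x => \sum_(i <- l) F i x)) /\
  \int[mu]_(x in open_cube) (\sum_(i <- l) F i x) =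
  \sum_(i <- l) \int[mu]_(x in open_cube) F i x by case: H.
elim: l => [|i l [IH1 IH2]].
  split.
    apply: (@eq_integrable _ _ _ mu open_cube mo (EFin \o cst 0)).
      by move=> x _; rewrite /= big_nil.
    exact: integrable0.
  rewrite big_nil; under eq_Rintegral do rewrite big_nil.
  by rewrite Rintegral_cst// mul0r.
split.
  have := integrableD mo (iF i) IH1.
  by apply: eq_integrable => // x _; rewrite /= big_cons.
rewrite big_cons -IH2 -RintegralD//.
by apply: eq_Rintegral => x _; rewrite big_cons.
Qed.

Variables (alpha : nat) (f : Rs -> R) (g : ('I_s -> nat) -> Rs -> R).
Hypothesis weak_g : forall h, (forall j, (h j <= alpha)%N) -> weak_mixed_partial h f (g h).

Definition order_incr i h j := if j == i then (h j).+1 else h j.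

Definition deriv_pairing h w : R := \int[mu]_(x in open_cube) (g h x * tprod w x).

Lemma sum_order_incr i h : (\sum_j order_incr i h j = (\sum_j h j).+1)%N.
Proof.
rewrite (bigD1 i)//= {1}/order_incr eqxx [in RHS](bigD1 i)//= -addSn; congr (_ + _)%N.
by apply: eq_bigr => j ji; rewrite /order_incr (negbTE ji).
Qed.

Lemma g_integrable h : (forall j, (h j <= alpha)%N) -> mu.-integrable open_cube (EFin \o g h).
Proof.
move=> ha; have [ig _] := weak_g ha.
by apply: integrableS ig => //; exact: open_cube_sub.
Qed.

Lemma deriv_pairing_cvg h (phi : nat -> 'I_s -> R -> R) w (M : 'I_s -> R) :
  (forall j, (h j <= alpha)%N) -> (forall k j, test1 (phi k j)) ->
  (forall k j x, `|phi k j x| <= M j) ->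
  (forall j x, 0 < x < 1 -> (fun k => phi k j x) @ \oo --> w j x) ->
  deriv_pairing h (phi k) @[k --> \oo] --> deriv_pairing h w.
Proof. by move=> ha; apply: tprod_Rint_cvg; exact: g_integrable. Qed.

Lemma deriv_pairing_cube h phi : (forall j, (h j <= alpha)%N) -> (forall j, test1 (phi j)) ->
  cube_integral (fun x => g h x * tprod phi x) = deriv_pairing h phi.
Proof.
move=> ha tphi; rewrite /cube_integral /deriv_pairing Rintegral_open_cube//.
have [ig _] := weak_g ha.
have [M phiM] : exists M : 'I_s -> R, forall j x, `|phi j x| <= M j.
  have /choice [M HM] j : exists m : R, forall x, `|phi j x| <= m by exact: test1_bounded.
  by exists M.
have mphi : measurable_fun (cube : set Rs) (tprod phi).
  apply: measurable_tprod_cube => j; apply: continuous_measurable_fun.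
  by have [sj _] := tphi j; exact: smooth1_continuous.
apply: (@integrable_bddM _ _ _ (\prod_j M j)) => // x cx.
by rewrite /tprod normr_prod; apply: ler_prod => j _; rewrite normr_ge0 phiM.
Qed.

Lemma weak_by_parts_test h i phi : (forall j, (h j <= alpha)%N) -> (h i < alpha)%N ->
  (forall j, test1 (phi j)) ->
  deriv_pairing (order_incr i h) phi = - deriv_pairing h (update phi i (derive1 (phi i))).
Proof.
move=> ha hi tphi.
have hSa j : (order_incr i h j <= alpha)%N by rewrite /order_incr; case: eqP => // ->.
have tu j : test1 (update phi i (derive1 (phi i)) j).
  by rewrite /update; case: ifP => // _; exact: test1_derive1.
have sphi j : smooth1 (phi j) by case: (tphi j).
have su j : smooth1 (update phi i (derive1 (phi i)) j) by case: (tu j).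
have [_ W1] := weak_g hSa; have [_ W2] := weak_g ha.
have := W1 _ (test_tprod tphi); have := W2 _ (test_tprod tu).
rewrite !deriv_pairing_cube// !mixed_partial_tprod// sum_order_incr exprS.
have -> : (fun j => derive1n (h j) (update phi i (derive1 (phi i)) j)) =
    (fun j => derive1n (order_incr i h j) (phi j)).
  by apply/funext => j; rewrite /update /order_incr; case: eqP => // ->; rewrite derive1Sn.
set e := (-1) ^+ (\sum_j h j) : R.
have ee : e * e = 1 by rewrite /e -exprMn mulrNN mulr1 expr1n.
set B := deriv_pairing h _; set C := deriv_pairing _ phi => E2 E1.
have H : B = - C.
  rewrite -[LHS]mul1r -ee -mulrA -E2 E1 (_ : e * (-1 * e * C) = - ((e * e) * C)); last by ring.
  by rewrite ee mul1r.
by rewrite H opprK.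
Qed.

Lemma weak_by_parts h i w v W : (forall j, (h j <= alpha)%N) -> (h i < alpha)%N ->
  (forall j, j != i -> approximable (w j)) -> approximable2 v W ->
  deriv_pairing (order_incr i h) (update w i W) = - deriv_pairing h (update w i v).
Proof.
move=> ha hi aw [p [p1 [M pM] pv]].
have hSa j : (order_incr i h j <= alpha)%N by rewrite /order_incr; case: eqP => // ->.
have /choice [q Hq] j : exists q : nat -> R -> R, [/\ forall k, test1 (q k),
    exists N, forall k x, `|q k x| <= N &
    j != i -> forall x, 0 < x < 1 -> q ^~ x @ \oo --> w j x].
  have [->|ji] := eqVneq j i; last by have [q [q1 q2 q3]] := aw j ji; exists q.
  exists p; split => //; exists M => k x; have [] := pM k x => //.
have /choice [N HN] j : exists N, forall k x, `|q j k x| <= N by have [_ ] := Hq j.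
pose phi k := update (fun j => q j k) i (p k).
have tphi k j : test1 (phi k j) by rewrite /phi /update; case: ifP => // _; have [] := Hq j.
have dphi k : update (phi k) i (derive1 (phi k i)) = update (phi k) i (derive1 (p k)).
  by have -> : phi k i = p k by rewrite /phi /update eqxx.
have tphi' k j : test1 (update (phi k) i (derive1 (p k)) j).
  by rewrite /update; case: ifP => // _; exact: test1_derive1.
pose M' := update (fun j => fun=> N j) i (fun=> M).
have C1 : deriv_pairing (order_incr i h) (phi k) @[k --> \oo] --> deriv_pairing (order_incr i h) (update w i W).
  apply: (@deriv_pairing_cvg _ phi _ (fun j => M' j 0)) => //.
    move=> k j x; rewrite /phi /M' /update; case: eqP => _; last exact: HN.
    by have [] := pM k x.
  move=> j x x01; rewrite /phi /update; case: eqP => [_|/eqP ji]; first by have [] := pv x x01.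
  by have [_ _ H] := Hq j; exact: H.
have C2 : deriv_pairing h (update (phi k) i (derive1 (p k))) @[k --> \oo] --> deriv_pairing h (update w i v).
  apply: (@deriv_pairing_cvg _ (fun k => update (phi k) i (derive1 (p k))) _ (fun j => M' j 0)) => //.
    move=> k j x; rewrite /phi /M' /update; case: eqP => _; last exact: HN.
    by have [] := pM k x.
  move=> j x x01; rewrite /phi /update; case: eqP => [_|/eqP ji]; first by have [] := pv x x01.
  by have [_ _ H] := Hq j; exact: H.
apply: (cvg_unique _ C1); first exact: norm_hausdorff.
have -> : (fun k => deriv_pairing (order_incr i h) (phi k)) = (fun k => - deriv_pairing h (update (phi k) i (derive1 (p k)))).
  by apply/funext => k; rewrite (weak_by_parts_test ha hi (tphi k)) dphi.
exact: cvgN.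
Qed.

Lemma deriv_pairing_split h i w c : (forall j, (h j <= alpha)%N) -> (forall j, approximable (w j)) ->
  deriv_pairing h w = c * deriv_pairing h (update w i (fun=> 1)) + deriv_pairing h (update w i (fun x => w i x - c)).
Proof.
move=> ha aw.
have au u j : approximable u -> approximable (update w i u j) by move=> au; rewrite /update; case: ifP.
have ig := g_integrable ha.
have I1 := integrable_tprod ig (fun j => au _ j (@approx1 R)).
have I2 := integrable_tprod ig (fun j => au _ j (approxB c (aw i))).
rewrite /deriv_pairing -RintegralZl// -RintegralD//; last first.
  by have := integrableZl mo c I1; apply: eq_integrable.
apply: eq_Rintegral => x _; rewrite !tprod_update (tprodD1 _ i).
by ring.
Qed.

Lemma deriv_pairing_updateD h i w (u v : R -> R) c : (forall j, (h j <= alpha)%N) ->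
  (forall j, approximable (w j)) -> approximable u -> approximable v ->
  deriv_pairing h (update w i (fun x => u x + c * v x)) = deriv_pairing h (update w i u) + c * deriv_pairing h (update w i v).
Proof.
move=> ha aw au av.
have a' z j : approximable z -> approximable (update w i z j) by move=> az; rewrite /update; case: ifP.
have ig := g_integrable ha.
have I1 := integrable_tprod ig (fun j => a' _ j au).
have I2 := integrable_tprod ig (fun j => a' _ j av).
rewrite /deriv_pairing -RintegralZl// -RintegralD//; last first.
  by have := integrableZl mo c I2; apply: eq_integrable.
by apply: eq_Rintegral => x _; rewrite !tprod_update; ring.
Qed.

End weak_ibp.

(** * I *)

Section norm_estimate.
Context {R : realType} {s : nat}.
Local Notation Rs := 'rV[R]_s.
Local Notation mu := (@lebesgue_rV R s).
Variables (alpha : nat) (gamma : {set 'I_s} -> R) (q : \bar R) (f : Rs -> R).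
Hypothesis gamma_gt0 : forall u, 0 < gamma u.
Hypothesis q_ge1 : (1 <= q)%E.
Hypothesis norm_le1 : (sob_norm alpha gamma q f <= 1)%E.

Let mc : measurable (cube : set Rs) := @measurable_cube R s.

Lemma sob_local_norm_le u : (sob_local_norm alpha q f u <= (gamma u)%:E)%E.
Proof.
have H : ((gamma u)^-1%:E * sob_local_norm alpha q f u <= 1)%E.
  by apply: le_trans norm_le1; exact: (le_bigmax 0%E (fun u => ((gamma u)^-1%:E * sob_local_norm alpha q f u)%E)).
have := lee_wpmul2l (_ : (0 <= (gamma u)%:E)%E) H.
rewrite lee_fin ltW// => /(_ isT).
by rewrite muleA -EFinM divff ?mul1e ?mule1// gt_eqF.
Qed.

Lemma sob_average_bound (u v : {set 'I_s}) (tau : {ffun 'I_s -> 'I_alpha.+1}) :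
  v \subset u -> tau_on (u :\: v)%SET tau ->
  measurable_fun (cube : set Rs) (sob_average f v tau) ->
  (\int[mu]_(x in cube) `|sob_average f v tau x|%:E <= (2 * gamma u)%:E)%E.
Proof.
move=> vu tu mA; have g0 := gamma_gt0 u.
have mnA : measurable_fun (cube : set Rs) (fun x => `|sob_average f v tau x|).
  exact: measurableT_comp mA.
have cst_int c : (\int[mu]_(x in cube) c%:E = c%:E)%E.
  rewrite integral_cst//; transitivity (c%:E * 1)%E; last by rewrite mule1.
  by congr (_ * _)%E; exact: lebesgue_rV_cube.
have := sob_local_norm_le u; case: q q_ge1 => [r|_|//] /=.
- rewrite lee_fin => r1.
  have r0 : 0 < r by exact: lt_le_trans r1.
  set S := (\sum_(_ | _) _)%E => HS.
  have S0 : (0 <= S)%E.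
    apply: sume_ge0 => v' _; apply: sume_ge0 => t _; apply: integral_ge0 => x _.
    by rewrite lee_fin powR_ge0.
  have {}HS : (S <= (gamma u `^ r)%:E)%E.
    have := gt0_ler_poweR (ltW r0) _ _ HS; rewrite -poweRrM mulVf ?gt_eqF// poweRe1//.
    rewrite poweR_EFin; apply; rewrite in_itv/= ?leey ?andbT.
      exact: poweR_ge0.
    by rewrite lee_fin ltW.
  have HI : (\int[mu]_(x in cube) (`|sob_average f v tau x| `^ r)%:E <= (gamma u `^ r)%:E)%E.
    pose I v' t := (\int[mu]_(x in cube) (`|@sob_average R s alpha f v' t x| `^ r)%:E)%E.
    have I0 v' t : (0 <= I v' t)%E.
      by apply: integral_ge0 => x _; rewrite lee_fin powR_ge0.
    have T1 : (I v tau <= \sum_(t | tau_on (u :\: v)%SET t) I v t)%E.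
      by rewrite (bigD1 tau tu) /=; apply: leeDl; apply: sume_ge0 => t _; exact: I0.
    apply: le_trans HS; apply: (le_trans T1).
    rewrite /S (bigD1 v vu) /=; apply: leeDl; apply: sume_ge0 => v' _.
    by apply: sume_ge0 => t _; exact: I0.
  pose c := gamma u * (gamma u `^ r)^-1.
  have gr0 : 0 < gamma u `^ r by rewrite powR_gt0.
  have c0 : 0 <= c by rewrite mulr_ge0 ?invr_ge0// ltW.
  have mp : measurable_fun (cube : set Rs) (fun x => `|sob_average f v tau x| `^ r).
    exact: measurableT_comp (measurable_powR r) mnA.
  apply: (@le_trans _ _ (\int[mu]_(x in cube) ((gamma u)%:E + c%:E * (`|sob_average f v tau x| `^ r)%:E))%E).
    apply: ge0_le_integral => //.
    + exact/measurable_EFinP.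
    + apply: emeasurable_funD => //.
      by apply: measurable_funeM; exact/measurable_EFinP.
    + move=> x _; rewrite -EFinM -EFinD lee_fin /c.
      set a := `|_|; have a0 : 0 <= a by rewrite /a.
      have [ag|ga] := leP a (gamma u).
        by rewrite ler_wpDr// mulr_ge0// powR_ge0.
      apply: ler_wpDl; first exact: ltW.
      have t1 : 1 <= a / gamma u by rewrite ler_pdivlMr// mul1r ltW.
      have := ler_powR t1 r1; rewrite powRr1; last by rewrite (le_trans ler01).
      rewrite powRM ?invr_ge0 ?(ltW g0)// ler_pdivrMr// => /le_trans; apply.
      rewrite -powR_inv1 ?(ltW g0)// -powRrM mulN1r powRN.
      by rewrite le_eqVlt; apply/orP; left; apply/eqP; ring.
  have h2 : measurable_fun (cube : set Rs) (fun x => (`|sob_average f v tau x| `^ r)%:E).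
    exact/measurable_EFinP.
  have h1 x : cube x -> (0 <= (`|sob_average f v tau x| `^ r)%:E)%E.
    by move=> _; rewrite lee_fin powR_ge0.
  have -> : (\int[mu]_(x in cube) ((gamma u)%:E + c%:E * (`|sob_average f v tau x| `^ r)%:E) =
     \int[mu]_(x in cube) (gamma u)%:E + \int[mu]_(x in cube) (c%:E * (`|sob_average f v tau x| `^ r)%:E))%E.
    apply: ge0_integralD => //.
    - by move=> x _; rewrite lee_fin ltW.
    - by move=> x cx; rewrite mule_ge0// ?lee_fin// h1.
    - exact: measurable_funeM.
  rewrite cst_int (ge0_integralZl mu mc h2 h1)//.
  have -> : ((2 * gamma u)%:E = (gamma u)%:E + c%:E * (gamma u `^ r)%:E)%E.
    by rewrite -EFinM -EFinD /c mulfVK ?gt_eqF//; congr (_%:E); ring.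
  by rewrite leeD2l// lee_wpmul2l// lee_fin.
- move=> H.
  have Hs : (ess_sup mu ((fun x => `|sob_average f v tau x|%:E) \_ cube) <= (gamma u)%:E)%E.
    apply: le_trans H.
    apply: le_trans (le_bigmax_cond 0%E (fun v => \big[maxe/0%E]_(t | tau_on (u :\: v)%SET t)
        ess_sup mu ((fun x => `|sob_average f v t x|%:E) \_ cube)) vu).
    exact: (le_bigmax_cond 0%E (fun t => ess_sup mu ((fun x => `|sob_average f v t x|%:E) \_ cube)) tu).
  have /ess_supP Hae := Hs.
  apply: (@le_trans _ _ (\int[mu]_(x in cube) (gamma u)%:E)%E).
    apply: ae_ge0_le_integral => //.
    + exact/measurable_EFinP.
    + by move=> x _; rewrite lee_fin ltW.
    apply: filterS Hae => x /= + cx.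
    by rewrite patchE mem_set.
  by rewrite cst_int lee_fin ler_peMl ?(ltW g0)// (ler_nat _ 1 2).
Qed.

End norm_estimate.

(** * J *)

Section main_estimate.
Context {R : realType} {s : nat}.
Local Notation Rs := 'rV[R]_s.
Local Notation mu := (@lebesgue_rV R s).
Variables (alpha : nat) (gamma : {set 'I_s} -> R) (q : \bar R) (f : Rs -> R) (Gam : R).
Hypothesis alpha_gt0 : (0 < alpha)%N.
Hypothesis gamma_gt0 : forall u, 0 < gamma u.
Hypothesis gamma_le : forall u, gamma u <= Gam.
Hypothesis q_ge1 : (1 <= q)%E.
Hypothesis f_sob : sob_space alpha gamma q f.
Hypothesis norm_le1 : (sob_norm alpha gamma q f <= 1)%E.
Implicit Types (h : 'I_s -> nat) (w : 'I_s -> R -> R) (K : 'I_s -> R).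

Let mc : measurable (cube : set Rs) := @measurable_cube R s.
Let g h := sob_deriv h f.

Let Gam_gt0 : 0 < Gam. Proof. exact: lt_le_trans (gamma_le finset.set0). Qed.

Lemma sob_derivP h : (forall j, (h j <= alpha)%N) -> weak_mixed_partial h f (g h).
Proof.
move=> ha; have [_ [/(_ h ha) ex _]] := f_sob.
exact: (xgetPex (fun=> 0) ex).
Qed.

Lemma pairing_bound_terminal h (v : {set 'I_s}) w K : (forall j, (h j <= alpha)%N) ->
  (forall j, j \in v -> h j = alpha) ->
  (forall j, approximable (w j)) -> (forall j, 0 <= K j) ->
  (forall j, j \in v -> forall x, 0 < x < 1 -> `|w j x| <= K j) ->
  (forall j, j \notin v -> w j = fun=> 1) ->
  `|deriv_pairing g h w| <= 2 * Gam * \prod_(j in v) K j.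
Proof.
move=> ha hv aw K0 wK w1.
pose w' j := (w j) \_ (`]0, 1[%classic : set (measurableTypeR R)).
pose phi (x : Rs) := \prod_(j in v) w' j (x ord0 j).
have mI : measurable (`]0, 1[%classic : set (measurableTypeR R)) by exact: measurable_itv.
have mw' j : measurable_fun [set: measurableTypeR R] (w' j).
  by apply: (measurable_restrictT _ mI).1; exact: approx_measurable.
have mphi : measurable_fun (cube : set Rs) phi.
  apply: measurable_funTS; rewrite /phi.
  elim: (index_enum _) => [|j l IH].
    by under eq_fun do rewrite big_nil; exact: measurable_cst.
  under eq_fun do rewrite big_cons.
  case: (j \in v) => //; apply: measurable_funM => //.
  apply: (measurableT_comp (f := w' j)); first exact: mw'.
  exact: (@measurable_rV_coord _ R s j).
have w'K j x : j \in v -> `|w' j x| <= K j.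
  move=> jv; rewrite /w' patchE; case: ifPn => [/set_mem /=|_]; last by rewrite normr0.
  by rewrite in_itv/= => /(wK j jv).
have phiK x : cube x -> `|phi x| <= \prod_(j in v) K j.
  move=> _; rewrite /phi normr_prod; apply: ler_prod => j jv.
  by rewrite normr_ge0 w'K.
have phig (x y : Rs) : cube x -> cube y -> phi (Defs.glue v (x, y).1 (x, y).2) = phi x.
  by move=> _ _; apply: eq_bigr => j jv; rewrite mxE jv.
have KK0 : 0 <= \prod_(j in v) K j by apply: prodr_ge0.
have [ig _] := sob_derivP ha.
have [mavg B] := @glue_average_bound R s v (g h) phi _ KK0 ig mphi phiK phig.
pose u : {set 'I_s} := (v :|: [set j | h j != 0%N])%SET.
pose tau : {ffun 'I_s -> 'I_alpha.+1} := [ffun j => if j \in v then ord0 else inord (h j)].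
have vu : v \subset u by apply: finset.subsetUl.
have tu : tau_on (u :\: v)%SET tau.
  apply/forallP => j; rewrite ffunE; have [jv|jv] := boolP (j \in v).
    by rewrite !inE jv.
  by rewrite !inE (negbTE jv) /= inordK// ltnS.
have hE : sob_order v tau = h.
  apply/funext => j; rewrite /sob_order ffunE; have [jv|jv] := boolP (j \in v).
    by rewrite hv.
  by rewrite inordK// ltnS.
have avgE : (fun x => \int[mu]_(y in cube) g h (Defs.glue v (x, y).1 (x, y).2)) =
    sob_average f v tau.
  by apply/funext => x; rewrite /sob_average hE.
have LE : deriv_pairing g h w = \int[mu]_(x in cube) (g h x * phi x).
  rewrite Rintegral_open_cube; last first.
    have bphi : [bounded phi x | x in (cube : set Rs)].
      exists (\prod_(j in v) K j); split; first exact: num_real.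
      by move=> N MN x cx; apply: (le_trans (phiK x cx)); exact: ltW.
    have := integrableMl mc ig mphi bphi.
    by apply: eq_integrable => // x _; rewrite /= EFinM.
  apply: eq_Rintegral => x /set_mem ox; congr (_ * _).
  rewrite /tprod /phi (bigID (mem v))/= [X in _ * X]big1 ?mulr1.
    apply: eq_bigr => j jv; rewrite /w' patchE mem_set//=.
    by rewrite in_itv/=; exact: ox.
  by move=> j jv; rewrite w1.
rewrite -lee_fin LE; apply: (le_trans B).
have mA : measurable_fun (cube : set Rs) (sob_average f v tau) by rewrite -avgE.
have SB := sob_average_bound gamma_gt0 q_ge1 norm_le1 vu tu mA.
rewrite mulrC EFinM; apply: lee_wpmul2l; first by rewrite lee_fin.
have -> : (\int[mu]_(x in cube) `|\int[mu]_(y in cube) g h (Defs.glue v (x, y).1 (x, y).2)|%:E =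
   \int[mu]_(x in cube) `|sob_average f v tau x|%:E)%E by rewrite -avgE.
by apply: (le_trans SB); rewrite lee_fin ler_wpM2l.
Qed.

Lemma pairing_bound_rec N h (v : {set 'I_s}) w K : (forall j, (h j <= alpha)%N) ->
  (forall j, j \in v -> prim_bounded (alpha - h j) (K j) (w j)) -> (forall j, 0 <= K j) ->
  (forall j, j \notin v -> w j = fun=> 1) ->
  (\sum_(j in v) (alpha - h j) <= N)%N ->
  `|deriv_pairing g h w| <= 2 ^+ N * (2 * Gam * \prod_(j in v) K j).
Proof.
elim: N h v w => [|N IH] h v w ha bw K0 w1 hN.
all: have aw j : approximable (w j).
all: try by case: (boolP (j \in v)) => [/bw|/w1 ->]; [case: (alpha - h j)%N => [|?] []|exact: approx1].
  have hv j : j \in v -> h j = alpha.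
    move=> jv; move: hN; rewrite leqn0 sum_nat_eq0 => /forall_inP /(_ j jv).
    rewrite subn_eq0 => H; apply/eqP; rewrite eqn_leq H andbT; exact: ha.
  rewrite expr0 mul1r; apply: pairing_bound_terminal => // j jv x x01.
  by have := bw j jv; rewrite hv// subnn => -[_]; apply.
have KK0 (v' : {set 'I_s}) : 0 <= 2 * Gam * \prod_(j in v') K j.
  by rewrite !mulr_ge0 ?prodr_ge0// ltW.
have [/forall_inP hv|] := boolP [forall j in v, h j == alpha].
  apply: (@le_trans _ _ (2 * Gam * \prod_(j in v) K j)).
    apply: pairing_bound_terminal => // j jv; first exact/eqP/hv.
    by move=> x x01; have := bw j jv; rewrite (eqP (hv j jv)) subnn => -[_]; apply.
  by rewrite ler_peMl//; apply: exprn_ege1; rewrite (ler_nat _ 1 2).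
rewrite negb_forall_in => /exists_inP[i iv hia].
have hi : (h i < alpha)%N by rewrite ltn_neqAle hia ha.
have [d dE] : exists d, (alpha - h i = d.+1)%N by exists (alpha - h i).-1; lia.
have := bw i iv; rewrite dE => -[_ [mi bi]].
pose c := mean (w i).
have weak_g := fun h ha => @sob_derivP h ha.
rewrite (deriv_pairing_split weak_g i c ha aw).
have P2 := approx2_prim (aw i).
have := @weak_by_parts _ _ _ _ _ weak_g h i w _ _ ha hi (fun j _ => aw j) P2.
move=> /eqP; rewrite -eqr_oppLR => /eqP <-.
apply: (le_trans (ler_normB _ _)).
have sumE : (\sum_(j in v) (alpha - h j) = d.+1 + \sum_(j in v | j != i) (alpha - h j))%N.
  by rewrite (bigD1 i)//= dE.
have E2 : 2 ^+ N.+1 * (2 * Gam * \prod_(j in v) K j) =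
   K i * (2 ^+ N * (2 * Gam * \prod_(j in (v :\ i)%SET) K j)) +
   2 ^+ N * (2 * Gam * \prod_(j in v) K j).
  rewrite (big_setD1 i)//= exprS; ring.
rewrite E2; apply: lerD.
- rewrite normrM; apply: ler_pM => //.
  apply: IH => //.
  + move=> j; rewrite !inE => /andP[ji jv]; rewrite /update (negbTE ji); exact: bw.
  + move=> j; rewrite !inE negb_and negbK /update; case: eqP => //= _; exact: w1.
  + move: hN; rewrite sumE.
    rewrite [X in _ -> (X <= _)%N](eq_bigl (fun j => (j \in v) && (j != i))); last by move=> j; rewrite !inE andbC.
    by lia.
- apply: IH => //.
  + by move=> j; rewrite /order_incr; case: eqP => // ->.
  + move=> j jv; rewrite /order_incr /update; case: eqP => [->|_]; last exact: bw.
    by rewrite subnS dE.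
  + move=> j jv; rewrite /update; case: eqP => [ji|_]; last exact: w1.
    by rewrite ji iv in jv.
  + suff -> : (\sum_(j in v) (alpha - order_incr i h j) = d + \sum_(j in v | j != i) (alpha - h j))%N.
      by move: hN; rewrite sumE.
    rewrite (bigD1 i)//= {1}/order_incr eqxx subnS dE /=; congr (_ + _)%N.
    by apply: eq_bigr => j /andP[_ ji]; rewrite /order_incr (negbTE ji).
Qed.

Lemma pairing_bound w K : (forall j, prim_bounded alpha (K j) (w j)) -> (forall j, 0 <= K j) ->
  `|deriv_pairing g (fun=> 0%N) w| <= 2 ^+ (s * alpha) * (2 * Gam) * \prod_j K j.
Proof.
move=> bw K0.
have := @pairing_bound_rec (s * alpha) (fun=> 0%N) finset.setT w K.
rewrite -!mulrA [X in _ <= _ * (_ * (_ * X))](eq_bigl xpredT); last by move=> j; rewrite inE.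
apply => //.
- by move=> j _; rewrite subn0.
- by move=> j; rewrite inE.
- rewrite (eq_bigr (fun=> alpha)); last by move=> j _; rewrite subn0.
  by rewrite sum_nat_const cardsT card_ord.
Qed.

End main_estimate.

(** * K *)

Section cube_functions.
Context {R : realType} {s : nat}.
Local Notation Rs := 'rV[R]_s.
Local Notation mu := (@lebesgue_rV R s).
Let mo : measurable (open_cube : set Rs) := @measurable_open_cube R s.
Let mc : measurable (cube : set Rs) := @measurable_cube R s.

Lemma within_cube_eps (f : Rs -> R) x e : {within cube, continuous f} ->
  cube x -> 0 < e -> exists2 d : R, 0 < d & forall y, cube y ->
    (forall j, `|x ord0 j - y ord0 j| < d) -> `|f x - f y| < e.
Proof.
move=> /subspace_continuousP cf cx e0.
have /cvgrPdist_lt /(_ e e0) := cf x cx.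
rewrite /within/= => /nbhs_ballP [d d0 H]; exists d => // y cy xy.
by apply: H => //=; split => // i j; rewrite !ord1; exact: xy.
Qed.

Lemma measurable_itv_indic (a b : R) :
  measurable_fun [set: R] (fun t : R => (a <= t < b)%R%:R : R).
Proof.
have -> : (fun t : R => (a <= t < b)%R%:R : R) = \1_(`[a, b[%classic : set R).
  apply/funext => t; rewrite indicE; congr (nat_of_bool _)%:R.
  by apply/idP/idP => [H|/set_mem]; [apply/mem_set; rewrite /= in_itv|rewrite /= in_itv].
exact: measurable_indic.
Qed.

Lemma within_cube_measurable (f : Rs -> R) : {within cube, continuous f} ->
  measurable_fun (cube : set Rs) f.
Proof.
move=> cf.
pose pt k (c : {ffun 'I_s -> 'I_(2 ^ k)}) : Rs := \row_j ((c j)%:R * 2%:R ^- k).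
pose I k (c : {ffun 'I_s -> 'I_(2 ^ k)}) : Rs -> R :=
  tprod (fun j t => ((c j)%:R * 2%:R ^- k <= t < (c j).+1%:R * 2%:R ^- k)%R%:R : R).
pose F k (x : Rs) : R := \sum_(c : {ffun 'I_s -> 'I_(2 ^ k)}) f (pt k c) * I k c x.
apply: (@measurable_fun_cvg _ _ _ (cube : set Rs) F).
  move=> k; rewrite /F; elim: (index_enum _) => [|c l IH].
    by under eq_fun do rewrite big_nil; exact: measurable_cst.
  under eq_fun do rewrite big_cons.
  apply: measurable_funD => //; apply: measurable_funM; first exact: measurable_cst.
  by apply: measurable_tprod_cube => j; exact: measurable_itv_indic.
move=> x cx; apply/cvgrPdist_lt => e e0.
have [d d0 H] := within_cube_eps cf cx e0.
near=> k.
have kd : 2%:R ^- k < d.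
  rewrite -div1r; near: k; exact: (near_infty_natSinv_expn_lt (PosNum d0)).
have /choice [c Hc] j : exists c : 'I_(2 ^ k), c%:R * 2%:R ^- k <= x ord0 j < c.+1%:R * 2%:R ^- k.
  have /andP[x0 x1] := cx j.
  have [c cn Hc] := @cell_index R 2 isT k _ x0 x1.
  by exists (Ordinal cn).
pose cf' : {ffun 'I_s -> 'I_(2 ^ k)} := [ffun j => c j].
have -> : F k x = f (pt k cf').
  rewrite /F (bigD1 cf')//= big1 ?addr0.
    rewrite /I /tprod big1 ?mulr1// => j _; rewrite ffunE; by have := Hc j => ->.
  move=> c' /eqP c'c; rewrite /I /tprod.
  have [j Hj] : exists j, c' j <> c j.
    apply: contrapT => /forallNP H'; apply: c'c; apply/ffunP => j; rewrite ffunE.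
    exact: contrapT (H' j).
  rewrite (bigD1 j)//=; case: (boolP (_ && _)) => [Hx|_]; last by rewrite mul0r mulr0.
  exfalso; apply: Hj; apply: val_inj => /=.
  exact: (@cell_unique R 2 k _ _ _ isT Hx (Hc j)).
apply: H.
- move=> j; rewrite mxE ffunE; have /andP[h1 h2] := Hc j; have /andP[x0 x1] := cx j.
  by rewrite (le_lt_trans h1 x1) andbT mulr_ge0// invr_ge0 exprn_ge0.
- move=> j; rewrite mxE ffunE; have /andP[h1 h2] := Hc j.
  rewrite ger0_norm ?subr_ge0//; apply: lt_trans kd.
  by rewrite ltrBlDr addrC -[X in _ < _ + X]mul1r -mulrDl natr1.
Unshelve. all: by end_near. Qed.

Lemma Rintegral_density (a : Rs) h : (forall j, 0 <= a ord0 j) -> 0 < h ->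
  (forall j, a ord0 j + h <= 1) ->
  \int[mu]_(x in open_cube) (1 * tprod (fun j => density (a ord0 j) h) x) = 1.
Proof.
move=> a0 h0 ah.
pose B : set Rs := box (fun j => `[a ord0 j, a ord0 j + h[%classic).
have mB : measurable B by apply: measurable_box => j; exact: measurable_itv.
have BE x : tprod (fun j => density (a ord0 j) h) x = h^-1 ^+ s * \1_B x.
  rewrite /tprod /density big_split/= prodr_const card_ord; congr (_ * _).
  rewrite indicE; have [/set_mem xB|xB] := boolP (x \in B).
    rewrite big1// => j _; have := xB j; rewrite /= in_itv/= => -> //.
  have [j Hj] : exists j, ~ (a ord0 j <= x ord0 j < a ord0 j + h).
    apply: contrapT => /forallNP H; move/negP: xB; apply; apply/mem_set => j /=.
    by rewrite in_itv/=; exact: contrapT (H j).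
  by rewrite (bigD1 j)//= (negbTE (introN idP Hj)) mul0r.
have mt : measurable_fun (cube : set Rs) (\1_B : Rs -> R).
  by apply: measurable_funTS; exact: measurable_indic.
have m1 : mu cube = 1%E := lebesgue_rV_cube s.
have i1 : mu.-integrable cube (EFin \o (\1_B : Rs -> R)).
  apply: measurable_bounded_integrable => //.
    by move: m1; rewrite /= => ->; exact: ltry.
  exists 1; split; first exact: num_real.
  move=> M M1 x _ /=; rewrite indicE; case: (x \in B); rewrite ?normr1 ?normr0; apply: ltW => //.
  exact: lt_trans M1.
under eq_Rintegral do rewrite mul1r BE.
rewrite RintegralZl//; last first.
  by apply: integrableS i1 => //; exact: open_cube_sub.
rewrite -Rintegral_open_cube//.
have -> : \int[mu]_(x in cube) (\1_B x : R) = h ^+ s.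
  rewrite /Rintegral integral_indic//.
  have -> : B `&` cube = B.
    apply: setIidl => x xB j; have := xB j; rewrite /= in_itv/= => /andP[h1 h2].
    by rewrite (le_trans (a0 j) h1) (lt_le_trans h2 (ah j)).
  rewrite [X in fine X](_ : _ = (\prod_(j < s) h%:E)%E); last first.
    rewrite [LHS](lebesgue_rV_box (fun j => measurable_itv _)).
    apply: eq_bigr => j _; rewrite lebesgue_measure_itv/= lte_fin ltrDl h0.
    by rewrite -EFinB addrC addKr.
  by rewrite prodEFin /= prodr_const card_ord.
by rewrite -exprMn mulVf ?gt_eqF// expr1n.
Qed.

End cube_functions.

(** * L *)

Lemma density_approx_seq (R : realType) (a h : R) : 0 <= a -> 0 < h -> a + h <= 1 ->
  exists p : nat -> R -> R,
  [/\ forall k, test1 (p k), forall k x, 0 <= p k x <= h^-1,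
      forall k x, p k x != 0 -> a - k.+1%:R^-1 < x < a + h &
      forall x, 0 < x < 1 -> p ^~ x @ \oo --> density a h x].
Proof.
move=> a0 h0 ah; have [p [p1 p2 p3 p4]] := approx_itv_seq a0 ah.
have hi : 0 <= h^-1 by rewrite invr_ge0 ltW.
exists (fun k x => h^-1 * p k x); split.
- by move=> k; exact: test1Z.
- move=> k x; have /andP[h1 h2] := p2 k x.
  by rewrite mulr_ge0//= ler_piMr.
- by move=> k x; rewrite mulf_eq0 negb_or => /andP[_]; exact: p3.
- by move=> x x01; apply: cvgM; [exact: cvg_cst|exact: p4].
Qed.

Section evaluation.
Context {R : realType} {s : nat}.
Local Notation Rs := 'rV[R]_s.
Local Notation mu := (@lebesgue_rV R s).
Let mo : measurable (open_cube : set Rs) := @measurable_open_cube R s.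
Let mc : measurable (cube : set Rs) := @measurable_cube R s.
Variables (alpha : nat) (gamma : {set 'I_s} -> R) (q : \bar R) (f : Rs -> R) (Gam : R).
Hypothesis alpha_ge2 : (2 <= alpha)%N.
Hypothesis gamma_gt0 : forall u, 0 < gamma u.
Hypothesis gamma_le : forall u, gamma u <= Gam.
Hypothesis q_ge1 : (1 <= q)%E.
Hypothesis f_sob : sob_space alpha gamma q f.
Hypothesis norm_le1 : (sob_norm alpha gamma q f <= 1)%E.

Let alpha_gt0 : (0 < alpha)%N. Proof. exact: leq_trans alpha_ge2. Qed.
Let Gam_gt0 : 0 < Gam. Proof. exact: lt_le_trans (gamma_le finset.set0). Qed.
Let g h := sob_deriv h f.
Definition pairing (w : 'I_s -> R -> R) := deriv_pairing (fun h => sob_deriv h f) (fun=> 0%N) w.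

Let weak_g h : (forall j, (h j <= alpha)%N) -> weak_mixed_partial h f (g h) :=
  fun ha => sob_derivP f_sob ha.
Let h0a : forall j : 'I_s, ((fun=> 0%N) j <= alpha)%N. Proof. by []. Qed.
Let cf : {within cube, continuous f}. Proof. by case: f_sob. Qed.

Let mu_cube_fin : (mu cube < +oo)%E.
Proof. by have -> : mu cube = 1%E := lebesgue_rV_cube s; rewrite ltry. Qed.

Lemma bounded_integrable_cube (F : Rs -> R) (M : R) :
  measurable_fun (cube : set Rs) F -> (forall x, cube x -> `|F x| <= M) ->
  mu.-integrable cube (EFin \o F).
Proof.
move=> mF FM; apply: measurable_bounded_integrable => //.
exists M; split; first exact: num_real.
by move=> N MN x cx; apply: (le_trans (FM x cx)); exact: ltW.
Qed.

Lemma pairing_test phi : (forall j, test1 (phi j)) ->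
  cube_integral (fun x => f x * tprod phi x) = pairing phi.
Proof.
move=> tphi; have [_ /(_ _ (test_tprod tphi))] := weak_g h0a.
rewrite mixed_partial_tprod; last by move=> j; case: (tphi j).
by rewrite big1// expr0 mul1r (deriv_pairing_cube weak_g h0a tphi).
Qed.

Lemma tprod_ge0 (phi : 'I_s -> R -> R) x : (forall j t, 0 <= phi j t) -> 0 <= tprod phi x.
Proof. by move=> p0; apply: prodr_ge0. Qed.

Lemma pairing_density_cvg x e : cube x -> 0 < e ->
  exists2 d : R, 0 < d & forall del, 0 < del -> del < d ->
   (forall j, x ord0 j + del <= 1) /\
   `|pairing (fun j => density (x ord0 j) del) - f x| <= e.
Proof.
move=> cx e0; have [d d0 Hd] := within_cube_eps cf cx e0.
have [d' d'0 d'1] : exists2 d' : R, 0 < d' & forall j, x ord0 j + d' <= 1.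
  suff [c c0 cj] : exists2 c : R, 0 < c & forall j, j \in enum 'I_s -> x ord0 j + c <= 1.
    by exists c => // j; apply: cj; rewrite mem_enum.
  elim: (enum 'I_s) => [|j l [c c0 cl]]; first by exists 1.
  have /andP[xj0 xj1] := cx j.
  exists (Num.min c (1 - x ord0 j)); first by rewrite lt_min c0 subr_gt0.
  move=> i; rewrite in_cons => /predU1P[->|/cl H].
    have := ge_min (1 - x ord0 j) c (1 - x ord0 j); rewrite lexx orbT => H; lra.
  have := ge_min c c (1 - x ord0 j); rewrite lexx => H'; lra.
exists (Num.min d d'); first by rewrite lt_min d0.
move=> del del0; rewrite lt_min => /andP[deld deld'].
have xdel j : x ord0 j + del <= 1 by have := d'1 j; lra.
split=> //.
have x0 j : 0 <= x ord0 j by case/andP: (cx j).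
have /choice [p Hp] j : exists p : nat -> R -> R,
  [/\ forall k, test1 (p k), forall k t, 0 <= p k t <= del^-1,
      forall k t, p k t != 0 -> x ord0 j - k.+1%:R^-1 < t < x ord0 j + del &
      forall t, 0 < t < 1 -> p ^~ t @ \oo --> density (x ord0 j) del t].
  exact: density_approx_seq.
pose phi k j := p j k.
have tphi k j : test1 (phi k j) by have [H _ _ _] := Hp j; exact: H.
have p0 k j t : 0 <= phi k j t by have [_ /(_ k t) /andP[h1 h2] _ _] := Hp j.
have pM k j t : `|phi k j t| <= del^-1.
  by rewrite ger0_norm//; have [_ /(_ k t) /andP[h1 h2] _ _] := Hp j.
have pcvg j t : 0 < t < 1 -> (fun k => phi k j t) @ \oo --> density (x ord0 j) del t.
  by have [_ _ _ H] := Hp j; exact: H.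
have CA : pairing (phi k) @[k --> \oo] --> pairing (fun j => density (x ord0 j) del).
  exact: (deriv_pairing_cvg weak_g h0a tphi pM pcvg).
have i1 : mu.-integrable cube (EFin \o (fun=> 1 : R)).
  apply: (@bounded_integrable_cube _ 1); first exact: measurable_cst.
  by move=> *; rewrite normr1.
have i1o : mu.-integrable open_cube (EFin \o (fun=> 1 : R)).
  by apply: integrableS i1 => //; exact: open_cube_sub.
have mphi k : measurable_fun (cube : set Rs) (tprod (phi k)).
  apply: measurable_tprod_cube => j; apply: continuous_measurable_fun.
  by have [sj _] := tphi k j; exact: smooth1_continuous.
have tM k y : `|tprod (phi k) y| <= \prod_(j < s) del^-1.
  by rewrite /tprod normr_prod; apply: ler_prod => j _; rewrite normr_ge0 pM.
have iphi k : mu.-integrable cube (EFin \o (tprod (phi k))).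
  exact: (@bounded_integrable_cube _ (\prod_(j < s) del^-1)).
pose B k := \int[mu]_(y in cube) tprod (phi k) y.
have CB : B k @[k --> \oo] --> (1 : R).
  rewrite -(Rintegral_density x0 del0 xdel).
  have := tprod_Rint_cvg i1o tphi pM pcvg.
  rewrite [X in X @ _ --> _](_ : _ = B)//; apply/funext => k.
  rewrite /B Rintegral_open_cube//.
  by apply: eq_Rintegral => y _; rewrite mul1r.
have mf : measurable_fun (cube : set Rs) f by exact: within_cube_measurable.
have near_x k : k.+1%:R^-1 < d -> forall y, cube y -> tprod (phi k) y != 0 -> `|f x - f y| < e.
  move=> kd y cy; rewrite /tprod => /prodf_neq0 H; apply: Hd => // j.
  have [_ _ /(_ k _ (H j isT)) /andP[h1 h2] _] := Hp j.
  move: h1 h2 kd deld. set iv := k.+1%:R^-1; set yj := y ord0 j; set xj := x ord0 j => h1 h2 kd deld.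
  by rewrite ltr_norml; apply/andP; split; lra.
have NEAR : \forall k \near \oo, `|pairing (phi k) - f x * B k| <= e * B k.
  near=> k.
  have kd : k.+1%:R^-1 < d by near: k; exact: (near_infty_natSinv_lt (PosNum d0)).
  have iF : mu.-integrable cube (EFin \o (fun y => f y * tprod (phi k) y)).
    apply: (@bounded_integrable_cube _ ((`|f x| + e) * \prod_(j < s) del^-1)).
      exact: measurable_funM.
    move=> y cy; rewrite normrM; have [->|ty] := eqVneq (tprod (phi k) y) 0.
      rewrite normr0 mulr0 mulr_ge0 ?addr_ge0// ?(ltW e0)//.
      by apply: prodr_ge0 => j _; rewrite invr_ge0 ltW.
    apply: ler_pM => //; have H := near_x k kd y cy ty.
    rewrite -[f y](subrK (f x)) addrC; apply: (le_trans (ler_normD _ _)).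
    by rewrite lerD2l distrC ltW.
  have iFx : mu.-integrable cube (EFin \o (fun y => f x * tprod (phi k) y)).
    by have := integrableZl mc (f x) (iphi k); apply: eq_integrable.
  have -> : pairing (phi k) - f x * B k =
      \int[mu]_(y in cube) (f y * tprod (phi k) y - f x * tprod (phi k) y).
    by rewrite RintegralB// -(pairing_test (tphi k)) RintegralZl.
  have iD : mu.-integrable cube (EFin \o (fun y => f y * tprod (phi k) y - f x * tprod (phi k) y)).
    by have := integrableB mc iF iFx; apply: eq_integrable.
  apply: (le_trans (le_normr_Rintegral mc iD)).
  rewrite /B -RintegralZl//; apply: le_Rintegral => //.
  + by have := integrable_norm iD; apply: eq_integrable.
  + by have := integrableZl mc e (iphi k); apply: eq_integrable.
  + move=> y cy; rewrite -mulrBl normrM [`|tprod _ _|]ger0_norm; last by apply: tprod_ge0.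
    have [->|ty] := eqVneq (tprod (phi k) y) 0; first by rewrite !mulr0.
    by apply: ler_wpM2r; [apply: tprod_ge0|rewrite distrC ltW//; exact: near_x ty].
have C1 : `|pairing (phi k) - f x * B k| @[k --> \oo] --> `|pairing (fun j => density (x ord0 j) del) - f x * 1|.
  by apply: cvg_norm; apply: cvgB => //; apply: cvgM => //; exact: cvg_cst.
have C2 : e * B k @[k --> \oo] --> e * 1 by apply: cvgM => //; exact: cvg_cst.
rewrite [f x * 1]mulr1 [e * 1]mulr1 in C1 C2.
exact: (ler_cvg_to C1 C2 NEAR).
Unshelve. all: by end_near. Qed.

Definition eval_bound : R := 2 ^+ (s * alpha) * (2 * Gam) * \prod_(j < s) 2 ^+ alpha.-1.

Lemma pairing_density_bound (x : Rs) (h : R) : (forall j, 0 <= x ord0 j) -> 0 < h -> (forall j, x ord0 j + h <= 1) ->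
  `|pairing (fun j => density (x ord0 j) h)| <= eval_bound.
Proof.
move=> x0 h0 xh; rewrite /eval_bound.
apply: (pairing_bound alpha_gt0 gamma_gt0 gamma_le q_ge1 f_sob norm_le1) => [j|j]; last first.
  by rewrite exprn_ge0.
by rewrite -{1}(prednK alpha_gt0); exact: density_prim_bounded.
Qed.

Lemma f_bounded x : cube x -> `|f x| <= eval_bound.
Proof.
move=> cx; apply/ler_addgt0Pr => e e0.
have [d d0 H] := pairing_density_cvg cx e0.
have d2 : 0 < d / 2 by rewrite divr_gt0.
have d2d : d / 2 < d by lra.
have [xd Hd] := H _ d2 d2d.
have x0 j : 0 <= x ord0 j by case/andP: (cx j).
have := pairing_density_bound x0 d2 xd.
move: Hd; set A := pairing _ => H1 H2.
have -> : f x = A - (A - f x) by rewrite subKr.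
by apply: (le_trans (ler_normB _ _)); lra.
Qed.

Lemma cube_integralE : cube_integral f = pairing (fun _ _ => 1).
Proof.
have mf : measurable_fun (cube : set Rs) f by exact: within_cube_measurable.
have fi : mu.-integrable cube (EFin \o f) by exact: (bounded_integrable_cube mf f_bounded).
have fio : mu.-integrable open_cube (EFin \o f).
  by apply: integrableS fi => //; exact: open_cube_sub.
have [p [p1 [M pM] pw]] := @approx1 R.
have C1 := tprod_Rint_cvg (phi := fun k _ => p k) (w := fun _ _ => 1) (M := fun=> M) fio
   (fun k _ => p1 k) (fun k _ x => pM k x) (fun _ x x01 => pw x x01).
have C2 : pairing (fun _ => p k) @[k --> \oo] --> pairing (fun _ _ => 1).
  exact: (deriv_pairing_cvg (phi := fun k _ => p k) (M := fun=> M) weak_g h0a (fun k _ => p1 k) (fun k _ x => pM k x) (fun _ x x01 => pw x x01)).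
have E k : \int[mu]_(x in open_cube) (f x * tprod (fun=> p k) x) = pairing (fun _ => p k).
  rewrite -pairing_test// /cube_integral Rintegral_open_cube//.
  apply: (@integrable_bddM _ _ _ _ _ (\prod_(j < s) M)) => //.
    apply: measurable_tprod_cube => j; apply: continuous_measurable_fun.
    by have [sj _] := p1 k; exact: smooth1_continuous.
  move=> x _; rewrite /tprod normr_prod; apply: ler_prod => j _.
  by rewrite normr_ge0 pM.
have C3 : pairing (fun _ => p k) @[k --> \oo] --> \int[mu]_(x in open_cube) (f x * tprod (fun _ _ => 1) x).
  by under eq_fun do rewrite -E.
rewrite -(cvg_unique (@norm_hausdorff _ _) C3 C2) /cube_integral Rintegral_open_cube//.
by apply: eq_Rintegral => x _; rewrite /tprod big1// mulr1.
Qed.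

Lemma eval_density (x : Rs) (h : R) : cube x -> 0 < h -> (forall j, x ord0 j + h <= 1) ->
  `|f x - pairing (fun j => density (x ord0 j) h)| <= s%:R * (eval_bound * h).
Proof.
move=> cx h0 xh; apply/ler_addgt0Pr => e e0.
have [d d0 H] := pairing_density_cvg cx e0.
pose del := Num.min (d / 2) h.
have del0 : 0 < del by rewrite lt_min h0 divr_gt0.
have deld : del < d by rewrite gt_min; apply/orP; left; lra.
have delh : del <= h by rewrite ge_min lexx orbT.
have [xd Hd] := H _ del0 deld.
have x0 j : 0 <= x ord0 j by case/andP: (cx j).
pose W i (j : 'I_s) := if (j < i)%N then density (x ord0 j) h else density (x ord0 j) del.
have aW i j : approximable (W i j) by rewrite /W; case: ifP => _; exact: density_approx.
have step (i : 'I_s) : `|pairing (W i) - pairing (W i.+1)| <= eval_bound * h.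
  have Wi : W i = update (W i) i (density (x ord0 i) del).
    by apply/funext => j; rewrite /update; case: eqP => // ->; rewrite /W ltnn.
  have Wi1 : W i.+1 = update (W i) i (density (x ord0 i) h).
    apply/funext => j; rewrite /update /W ltnS leq_eqVlt.
    by case: (eqVneq j i) => [->|ji]; rewrite ?eqxx//= val_eqE (negbTE ji).
  have -> : pairing (W i) - pairing (W i.+1) =
      pairing (update (W i) i (fun t => density (x ord0 i) del t + (-1) * density (x ord0 i) h t)).
    rewrite {1}Wi Wi1 /pairing (deriv_pairing_updateD weak_g i (-1) h0a (aW i)) ?mulN1r//; exact: density_approx.
  pose K j := if j == i then 2 ^+ alpha.-1 * h else 2 ^+ alpha.-1 : R.
  have -> : eval_bound * h = 2 ^+ (s * alpha) * (2 * Gam) * \prod_j K j.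
    rewrite /eval_bound (bigD1 i)//= [X in _ = _ * X](bigD1 i)//= {1}/K eqxx.
    rewrite [X in _ = _ * (_ * X)](eq_bigr (fun=> 2 ^+ alpha.-1)); first by ring.
    by move=> j ji; rewrite /K (negbTE ji).
  apply: (pairing_bound alpha_gt0 gamma_gt0 gamma_le q_ge1 f_sob norm_le1) => j; last first.
    by rewrite /K; case: ifP => _; rewrite ?mulr_ge0 ?exprn_ge0// ltW.
  rewrite /update /K; case: eqP => [_|_].
    have -> : (fun t => density (x ord0 i) del t + -1 * density (x ord0 i) h t) =
        (fun t => density (x ord0 i) del t - density (x ord0 i) h t).
      by apply/funext => t; rewrite mulN1r.
    have [a aE] : exists a, alpha = a.+2 by exists alpha.-2; lia.
    by rewrite aE /=; exact: density_diff_prim_bounded.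
  rewrite -{1}(prednK alpha_gt0) /W; case: ifP => _; apply: density_prim_bounded => //.
have tele k : (k <= s)%N -> `|pairing (W 0%N) - pairing (W k)| <= k%:R * (eval_bound * h).
  elim: k => [_|k IH ks]; first by rewrite subrr normr0 mul0r.
  have := step (Ordinal ks) => /= H1; have := IH (ltnW ks) => H2.
  rewrite -natr1 mulrDl mul1r -(subrK (pairing (W k)) (pairing (W 0%N))) -addrA.
  by apply: (le_trans (ler_normD _ _)); apply: lerD.
have := tele s (leqnn s).
have -> : W 0%N = (fun j => density (x ord0 j) del) by apply/funext => j.
have -> : W s = (fun j => density (x ord0 j) h) by apply/funext => j; rewrite /W ltn_ord.
move: Hd; set A := pairing _; set B := pairing _ => H1 H2.
have -> : f x - B = (A - B) - (A - f x) by ring.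
by apply: (le_trans (ler_normB _ _)); apply: lerD.
Qed.

End evaluation.

(** * M *)

Section median.
Context {R : realType}.

Lemma median_close (l : seq R) (I t : R) : odd (size l) ->
  ((size l)./2 < count (fun x => (`|x - I| <= t)%R) l)%N -> `|median l - I| <= t.
Proof.
move=> ol; rewrite /median; set a := fun x : R => (`|x - I| <= t)%R; set k := (size l)./2.
have sl : size l = (k + k).+1.
  by have := odd_double_half (size l); rewrite ol add1n -addnn.
set s := sort _ l; have ss : size s = (k + k).+1 by rewrite size_sort.
have -> : count a l = count a s by apply/permP; rewrite perm_sym perm_sort.
have sor : sorted <=%R s by apply: sort_sorted; exact: le_total.
have mono i j : (i <= j)%N -> (j < size s)%N -> nth 0 s i <= nth 0 s j.
  by move=> ij js; apply: (sorted_leq_nth le_trans le_refl) => //; rewrite inE// (leq_ltn_trans ij).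
move=> ck; rewrite leNgt; apply/negP => mI.
have [mlt|mge] := ltP (nth 0 s k) I.
- have : (count a s <= k)%N.
    rewrite -(cat_take_drop k.+1 s) count_cat.
    have -> : count a (take k.+1 s) = 0%N.
      apply/eqP; rewrite -leqn0 leqNgt -has_count; apply/hasPn => x /(nthP 0)[i].
      rewrite size_takel; last by rewrite ss ltnS leq_addr.
      move=> ik <-; rewrite nth_take// /a -ltNge.
      have H : nth 0 s i <= nth 0 s k by apply: mono => //; rewrite ss ltnS leq_addr.
      rewrite ltr0_norm ?subr_lt0// in mI.
      by rewrite ltr0_norm ?subr_lt0; lra.
    rewrite add0n; apply: (leq_trans (count_size _ _)).
    by rewrite size_drop ss subSS addnK.
  by rewrite leqNgt ck.
- have : (count a s <= k)%N.
    rewrite -(cat_take_drop k s) count_cat.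
    have -> : count a (drop k s) = 0%N.
      apply/eqP; rewrite -leqn0 leqNgt -has_count; apply/hasPn => x /(nthP 0)[i].
      rewrite size_drop => ik <-; rewrite nth_drop /a -ltNge.
      have H : nth 0 s k <= nth 0 s (k + i)%N.
        by apply: mono; rewrite ?leq_addr// -ltn_subRL.
      rewrite ger0_norm ?subr_ge0// in mI.
      by rewrite ger0_norm ?subr_ge0; lra.
    rewrite addn0; apply: (leq_trans (count_size _ _)).
    by rewrite size_takel// ss ltnW// ltnS leq_addr.
  by rewrite leqNgt ck.
Qed.

End median.

Section amplification.
Variables (T : finType) (r : nat).
Implicit Types (G B : {set T}).

Lemma card_family_sub (G B : {set T}) (J : {set 'I_r}) :
  #|[set Q : {ffun 'I_r -> T} | [forall l, Q l \in if l \in J then B else G]]%SET| =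
  (#|B| ^ #|J| * #|G| ^ (r - #|J|))%N.
Proof.
rewrite cardsE.
have -> : #|[pred Q : {ffun 'I_r -> T} | [forall l, Q l \in if l \in J then B else G]]| =
   #|(family (fun l : 'I_r => mem (if l \in J then B else G)) : pred {ffun 'I_r -> T})|.
  by apply: eq_card => Q; apply/forallP/familyP.
rewrite card_family foldrE big_map big_enum /=.
rewrite (bigID (mem J))/=; congr (_ * _)%N.
  rewrite (eq_bigr (fun=> #|B|)); last by move=> l lJ; rewrite lJ.
  by rewrite prod_nat_const.
rewrite (eq_bigr (fun=> #|G|)); last by move=> l lJ; rewrite (negbTE lJ).
rewrite prod_nat_const; congr (_ ^ _)%N.
have -> : #|[pred i | i \notin J]| = #|[predC J]| by apply: eq_card.
have H : (#|J| + #|[predC J]|)%N = r by have := cardC (mem J); rewrite card_ord.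
by rewrite -[LHS](addKn #|J|) H.
Qed.

Lemma card_many_bad (G B : {set T}) k : B \subset G -> (k <= r)%N ->
  (#|[set Q : {ffun 'I_r -> T} | [forall l, Q l \in G] &&
      (k <= #|[set l | Q l \in B]|)]%SET| <=
   'C(r, k) * (#|B| ^ k * #|G| ^ (r - k)))%N.
Proof.
move=> BG kr.
pose F (J : {set 'I_r}) := [set Q : {ffun 'I_r -> T} | [forall l, Q l \in if l \in J then B else G]]%SET.
apply: (@leq_trans #|(\bigcup_(J : {set 'I_r} | #|J| == k) F J)%SET|).
  apply: subset_leq_card; apply/fintype.subsetP => Q; rewrite inE => /andP[/forallP QG kB].
  have : (0 < #|[set J : {set 'I_r} | (J \subset [set l | Q l \in B]) && (#|J| == k)]%SET|)%N.
    by rewrite cards_draws bin_gt0.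
  move=> /card_gt0P[J]; rewrite inE => /andP[/fintype.subsetP JB Jk].
  apply/bigcupP; exists J => //; rewrite inE; apply/forallP => l.
  by case: ifP => [/JB|_]; [rewrite inE|exact: QG].
apply: (@leq_trans (\sum_(J : {set 'I_r} | #|J| == k) #|F J|)).
  elim/big_rec2 : _ => [|J m X _ H]; first by rewrite cards0.
  by apply: leq_trans (leq_card_setU (F J) X) _; rewrite leq_add2l.
rewrite (eq_bigr (fun=> (#|B| ^ k * #|G| ^ (r - k))%N)); last first.
  by move=> J /eqP Jk; rewrite card_family_sub Jk.
rewrite sum_nat_const.
rewrite [X in (X * _)%N](_ : _ = 'C(r, k)) //.
by have := cards_draws [set: 'I_r]%SET k; rewrite cardsT card_ord => <-; rewrite cardsE; apply: eq_card => J; rewrite unfold_in /= [RHS]unfold_in /= finset.subsetT.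
Qed.

End amplification.

Lemma bin_odd_le k : ('C(k.*2.+1, k.+1) <= 4 ^ k)%N.
Proof.
have H : (2 ^ (k.*2.+1) = \sum_(i < k.*2.+2) 'C(k.*2.+1, i))%N.
  have := Pascal 1 1 k.*2.+1; rewrite addn1 => ->.
  by apply: eq_bigr => i _; rewrite !exp1n !muln1.
have E : 'C(k.*2.+1, k) = 'C(k.*2.+1, k.+1).
  by rewrite -[RHS]bin_sub; [congr 'C(_, _)|]; lia.
have k1 : (k < k.*2.+2)%N by lia.
have k2 : (k.+1 < k.*2.+2)%N by lia.
have : ('C(k.*2.+1, k) + 'C(k.*2.+1, k.+1) <= 2 ^ (k.*2.+1))%N.
  rewrite H (bigD1 (Ordinal k1))//= leq_add2l (bigD1 (Ordinal k2))//=; first by rewrite leq_addr.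
  by rewrite -val_eqE/= gtn_eqF.
by rewrite E addnn -mul2n expnS leq_mul2l -mul2n expnM.
Qed.

Lemma amplification_bound (R : realType) (T : finType) (G B : {set T}) (r : nat) (rho : R) :
  odd r -> B \subset G -> (0 < #|G|)%N -> 0 <= rho ->
  4 * #|B|%:R <= rho * #|G|%:R ->
  #|[set Q : {ffun 'I_r -> T} | [forall l, Q l \in G] &&
      (r.+1./2 <= #|[set l | Q l \in B]|)%N]%SET|%:R <=
  rho ^+ (r.+1)./2 / 4 * #|G|%:R ^+ r :> R.
Proof.
move=> oddr BG G0 rho0 BrG.
pose k := r./2.
have rE : r = k.*2.+1 by rewrite -[LHS]odd_double_half oddr add1n.
have r2 : r.+1./2 = k.+1 by rewrite rE; lia.
rewrite r2.
have kr : (k.+1 <= r)%N by rewrite rE; lia.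
have := card_many_bad BG kr; rewrite -(ler_nat R) => /le_trans; apply.
rewrite natrM natrM !natrX.
have Gp : 0 < #|G|%:R :> R by rewrite ltr0n.
have H1 : 'C(r, k.+1)%:R <= 4 ^+ k :> R.
  by rewrite rE -natrX ler_nat; exact: bin_odd_le.
have H2 : #|B|%:R ^+ k.+1 <= (rho / 4 * #|G|%:R) ^+ k.+1 :> R.
  by rewrite lerXn2r// ?nnegrE ?mulr_ge0//; lra.
apply: (@le_trans _ _ (4 ^+ k * ((rho / 4 * #|G|%:R) ^+ k.+1 * #|G|%:R ^+ (r - k.+1)))).
  by apply: ler_pM => //; rewrite ?mulr_ge0// ler_wpM2r.
rewrite le_eqVlt; apply/orP; left; apply/eqP.
have -> : #|G|%:R ^+ r = #|G|%:R ^+ k.+1 * #|G|%:R ^+ (r - k.+1) :> R.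
  by rewrite -exprD subnKC.
rewrite !exprMn exprVn [4 ^+ k.+1]exprS; field.
by rewrite expf_neq0.
Qed.

(** * N *)

Section equidistribution.
Variables (b : nat) (b_prime : prime b).

Lemma equidistributed (T : finType) (phi : T -> 'F_b) (sig : T -> T) :
  injective sig -> (forall v, phi (sig v) = phi v + 1) ->
  forall t, (#|[pred v | phi v == t]| * b = #|T|)%N.
Proof.
move=> isig phisig.
pose N t := #|[pred v | phi v == t]|.
have step t : (N t <= N (t + 1)%R)%N.
  rewrite /N -(fintype.card_image isig); apply: fintype.subset_leq_card.
  apply/fintype.subsetP => v /fintype.imageP[u]; rewrite !inE => /eqP <- ->.
  by rewrite phisig.
have mono t k : (N t <= N (t + k%:R)%R)%N.
  elim: k => [|k IH]; first by rewrite addr0.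
  by apply: leq_trans IH _; rewrite -natr1 addrA.
have le (t t' : 'F_b) : (N t <= N t')%N.
  have -> : t' = t + (nat_of_ord (t' - t)%R)%:R.
    by rewrite natr_Zp addrC subrK.
  exact: mono.
have eqN t t' : N t = N t' by apply/eqP; rewrite eqn_leq !le.
move=> t; rewrite -/(N t).
have -> : #|T| = (\sum_(t' : 'F_b) N t')%N.
  rewrite -sum1_card (partition_big phi xpredT)//=; apply: eq_bigr => t' _.
  by rewrite sum1_card.
rewrite (eq_bigr (fun=> N t)); last by move=> t' _; exact: eqN.
by rewrite sum_nat_const card_Fp// mulnC.
Qed.

End equidistribution.

Section digital_fourier.
Context {R : realType}.
Variables (b : nat) (b_prime : prime b) (s n m : nat).
Local Notation F := 'F_b.
Local Notation V := {ffun 'I_s -> {ffun 'I_n -> F}}.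
Local Notation A := {ffun 'I_m -> F}.

Definition dotF (k z : {ffun 'I_n -> F}) : F := \sum_i k i * z i.
Definition dotV (k z : V) : F := \sum_j dotF (k j) (z j).

Definition theta (t : F) : R := (if t == 0 then b%:R else 0) - 1.

Let bR : R := b%:R.
Let b_gt1 : 1 < bR. Proof. by rewrite ltr1n prime_gt1. Qed.
Let b1_neq0 : bR - 1 != 0. Proof. by rewrite subr_eq0 gt_eqF. Qed.
Let b_neq0 : bR != 0. Proof. by rewrite gt_eqF// (lt_trans ltr01). Qed.

Lemma theta_equi (T : finType) (phi : T -> F) (sig : T -> T) (t : F) :
  injective sig -> (forall v, phi (sig v) = phi v + 1) ->
  \sum_v theta (phi v - t) = 0.
Proof.
move=> isig ps; rewrite /theta sumrB sumr_const.
have := equidistributed b_prime isig ps t => H.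
rewrite -big_mkcond/= sumr_const.
have -> : #|[pred v | phi v - t == 0]| = #|[pred v | phi v == t]|.
  by apply: eq_card => v; rewrite !inE subr_eq0.
by rewrite -[b%:R *+ _]mulr_natl -natrM H subrr.
Qed.

Lemma sum_theta_dot (y : V) : y != 0 -> \sum_(k : V) theta (dotV k y) = 0.
Proof.
move=> y0.
have [j0 [i0 yji]] : exists j0 i0, y j0 i0 != 0.
  apply: contrapT => H; move/eqP: y0; apply; apply/ffunP => j; apply/ffunP => i.
  rewrite !ffunE; apply/eqP/negPn/negP => yji; apply: H; by exists j, i.
pose sig (k : V) : V := [ffun j => [ffun i => k j i + (if (j == j0) && (i == i0) then (y j0 i0)^-1 else 0)]].
have isig : injective sig.
  move=> k k' /ffunP E; apply/ffunP => j; apply/ffunP => i.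
  by have /ffunP /(_ i) := E j; rewrite !ffunE => /addIr.
have ps k : dotV (sig k) y = dotV k y + 1.
  rewrite /dotV (bigD1 j0)//= [in RHS](bigD1 j0)//= -addrA [X in _ = _ + X]addrC addrA.
  congr (_ + _); last first.
    apply: eq_bigr => j jj0; apply: eq_bigr => i _.
    by rewrite !ffunE (negbTE jj0) addr0.
  rewrite /dotF (bigD1 i0)//= [in RHS](bigD1 i0)//= -addrA [X in _ = _ + X]addrC addrA.
  congr (_ + _); last first.
    by apply: eq_bigr => i ii0; rewrite !ffunE (negbTE ii0) andbF addr0.
  by rewrite !ffunE !eqxx/= mulrDl mulVf.
have := @theta_equi _ (fun k : V => dotV k y) sig 0 isig ps.
by under eq_bigr do rewrite subr0.
Qed.

Lemma theta0 : theta 0 = bR - 1. Proof. by rewrite /theta eqxx. Qed.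

Lemma dotV0 (y : V) : dotV 0 y = 0.
Proof. by rewrite /dotV big1// => j _; rewrite /dotF big1// => i _; rewrite !ffunE mul0r. Qed.

Lemma dotVB (k y z : V) : dotV k (y - z) = dotV k y - dotV k z.
Proof.
rewrite /dotV -sumrB; apply: eq_bigr => j _; rewrite /dotF -sumrB.
by apply: eq_bigr => i _; rewrite !ffunE mulrBr.
Qed.

Lemma dotV0r (k : V) : dotV k 0 = 0.
Proof. by rewrite /dotV big1// => j _; rewrite /dotF big1// => i _; rewrite !ffunE mulr0. Qed.

Lemma delta_expansion (y z : V) :
  (#|V|%:R : R) * (y == z)%:R = 1 + (bR - 1)^-1 * \sum_(k : V | k != 0) theta (dotV k y - dotV k z).
Proof.
have E : \sum_(k : V | k != 0) theta (dotV k y - dotV k z) =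
    \sum_(k : V) theta (dotV k (y - z)) - (bR - 1).
  rewrite [in RHS](bigD1 (0 : V))//= dotV0 theta0 [RHS]addrC addKr.
  by apply: eq_bigr => k _; rewrite dotVB.
rewrite E; have [->|yz] := eqVneq y z.
  rewrite mulr1 subrr (eq_bigr (fun=> bR - 1)); last by move=> k _; rewrite dotV0r theta0.
  rewrite sumr_const -[(bR - 1) *+ _]mulr_natr mulrBr mulrA mulVf// mul1r; ring.
rewrite sum_theta_dot ?subr_eq0// sub0r mulrN mulVf// subrr mulr0//.
Qed.

Variable psi : 'I_m -> V.

Definition point_digits (a : A) : V := [ffun j => [ffun i => \sum_e a e * psi e j i]].

Definition dual_net : {set V} := finset (fun k : V => [forall e, dotV k (psi e) == 0]).

Lemma dot_point_digits k a : dotV k (point_digits a) = \sum_e a e * dotV k (psi e).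
Proof.
under [RHS]eq_bigr do rewrite /dotV mulr_sumr.
rewrite exchange_big/=; apply: eq_bigr => j _.
rewrite /dotF; under [RHS]eq_bigr do rewrite mulr_sumr.
rewrite exchange_big/=; apply: eq_bigr => i _; rewrite !ffunE mulr_sumr.
by apply: eq_bigr => e _; rewrite mulrCA.
Qed.

Lemma sum_theta_point_digits (k z : V) :
  (#|A|%:R : R)^-1 * \sum_(a : A) theta (dotV k (point_digits a) - dotV k z) =
  if k \in dual_net then theta (dotV k z) else 0.
Proof.
have A0 : (#|A|%:R : R) != 0.
  by rewrite pnatr_eq0 -lt0n; apply/card_gt0P; exists 0.
case: ifPn => [|]; rewrite inE.
  move=> /forallP kd; rewrite (eq_bigr (fun=> theta (dotV k z))).
    by rewrite sumr_const -[theta _ *+ _]mulr_natl mulrA mulVf// mul1r.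
  move=> a _; rewrite dot_point_digits big1 ?sub0r; last by move=> e _; rewrite (eqP (kd e)) mulr0.
  by rewrite /theta oppr_eq0.
rewrite negb_forall => /existsP[e ke].
pose sig (a : A) : A := [ffun e' => a e' + (if e' == e then (dotV k (psi e))^-1 else 0)].
have isig : injective sig.
  by move=> a a' /ffunP E; apply/ffunP => e'; have := E e'; rewrite !ffunE => /addIr.
have ps a : dotV k (point_digits (sig a)) = dotV k (point_digits a) + 1.
  rewrite !dot_point_digits (bigD1 e)//= [in RHS](bigD1 e)//= -addrA [X in _ = _ + X]addrC addrA.
  congr (_ + _); first by rewrite !ffunE eqxx mulrDl mulVf.
  by apply: eq_bigr => e' ee'; rewrite !ffunE (negbTE ee') addr0.
by rewrite (@theta_equi _ (fun a => dotV k (point_digits a)) sig _ isig ps) mulr0.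
Qed.

Lemma digital_rule (G : V -> R) :
  (#|A|%:R)^-1 * \sum_(a : A) G (point_digits a) =
  (#|V|%:R)^-1 * \sum_z G z + (bR - 1)^-1 *
    \sum_(k in dual_net | k != 0) (#|V|%:R)^-1 * \sum_z G z * theta (dotV k z).
Proof.
have A0 : (#|A|%:R : R) != 0.
  by rewrite pnatr_eq0 -lt0n; apply/card_gt0P; exists 0.
have V0 : (#|V|%:R : R) != 0.
  by rewrite pnatr_eq0 -lt0n; apply/card_gt0P; exists 0.
have E a : G (point_digits a) = (#|V|%:R)^-1 * \sum_z G z *
    (1 + (bR - 1)^-1 * \sum_(k : V | k != 0) theta (dotV k (point_digits a) - dotV k z)).
  under eq_bigr do rewrite -delta_expansion.
  rewrite (bigD1 (point_digits a))//= eqxx mulr1 big1; last first.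
    by move=> z zd; rewrite eq_sym (negbTE zd) !mulr0.
  by rewrite addr0 [G _ * _]mulrC mulrA mulVf// mul1r.
pose H a z := G z * (1 + (bR - 1)^-1 * \sum_(k : V | k != 0) theta (dotV k (point_digits a) - dotV k z)).
have E3 : \sum_a G (point_digits a) = #|V|%:R^-1 * \sum_z \sum_a H a z.
  by rewrite (eq_bigr _ (fun a _ => E a)) -mulr_sumr exchange_big.
rewrite E3.
have E2 z : \sum_(a : A) H a z =
   #|A|%:R * (G z + (bR - 1)^-1 * \sum_(k in dual_net | k != 0) G z * theta (dotV k z)).
  rewrite /H -[LHS]mulr_sumr [in LHS]big_split/= sumr_const -[X in _ + X]mulr_sumr [in LHS]exchange_big/=.
  have -> : \sum_(k : V | k != 0) \sum_(a : A) theta (dotV k (point_digits a) - dotV k z) =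
      #|A|%:R * \sum_(k in dual_net | k != 0) theta (dotV k z).
    rewrite mulr_sumr [RHS](eq_bigl (fun k => (k != 0) && (k \in dual_net))); last by move=> k; rewrite andbC.
    rewrite [RHS]big_mkcondr/=; apply: eq_bigr => k _.
    have := sum_theta_point_digits k z => /(congr1 (fun x => #|A|%:R * x)).
    rewrite mulrA divff// mul1r => ->; case: ifP => // _; by rewrite mulr0.
  rewrite -mulr_sumr; ring.
rewrite (eq_bigr _ (fun z _ => E2 z)).
pose X z := \sum_(k in dual_net | k != 0) G z * theta (dotV k z).
have -> : \sum_z #|A|%:R * (G z + (bR - 1)^-1 * X z) =
    #|A|%:R * (\sum_z G z + (bR - 1)^-1 * \sum_z X z).
  by rewrite [(bR - 1)^-1 * \sum_z _]mulr_sumr -big_split/= mulr_sumr.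
rewrite [LHS]mulrCA (mulrA _ #|A|%:R) mulVf// mul1r mulrDr; congr (_ + _).
rewrite mulrCA; congr (_ * _); rewrite /X exchange_big/= mulr_sumr.
by apply: eq_bigr => k _.
Qed.

Lemma sum_theta (x : F) : \sum_(t : F) theta (x + t) = 0.
Proof.
have := @theta_equi F id (fun t => t + 1) (- x) (@addIr _ 1) (fun=> erefl).
by under eq_bigr do rewrite opprK addrC.
Qed.

Lemma sum_theta_shift (j0 : 'I_s) (g : {ffun 'I_s -> F} -> R) :
  (forall (a : {ffun 'I_s -> F}) (t : F),
    g [ffun j => a j + (if j == j0 then t else 0)] = g a) ->
  \sum_(a : {ffun 'I_s -> F}) theta (\sum_j a j) * g a = 0.
Proof.
move=> gs; pose S t := \sum_(a : {ffun 'I_s -> F}) theta (\sum_j a j + t) * g a.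
have SE t : S t = \sum_(a : {ffun 'I_s -> F}) theta (\sum_j a j) * g a.
  pose sg t (a : {ffun 'I_s -> F}) : {ffun 'I_s -> F} :=
    [ffun j => a j + (if j == j0 then t else 0)].
  rewrite [RHS](reindex (sg t))/=; last first.
    exists (sg (- t)) => a _; apply/ffunP => j; rewrite !ffunE;
      by case: ifP => _; rewrite ?addr0 ?addrK ?subrK.
  apply: eq_bigr => a _; rewrite gs; congr (theta _ * _).
  under [RHS]eq_bigr do rewrite ffunE.
  by rewrite big_split/= -big_mkcond/= big_pred1_eq.
have : \sum_(t : F) S t = 0.
  rewrite /S exchange_big/= big1// => a _.
  by rewrite -mulr_suml sum_theta mul0r.
rewrite (eq_bigr _ (fun t _ => SE t)) sumr_const card_Fp// => /eqP.
by rewrite -mulr_natl mulf_eq0 (negbTE b_neq0)/= => /eqP.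
Qed.

Lemma theta_expansion (t : 'I_s -> F) (c : 'I_s -> R) :
  theta (\sum_j t j) = \sum_(a : {ffun 'I_s -> F})
    theta (\sum_j a j) * \prod_j ((t j == a j)%:R - c j).
Proof.
pose P (r : seq 'I_s) := \sum_(a : {ffun 'I_s -> F})
    theta (\sum_j a j) * \prod_j ((t j == a j)%:R - (if j \in r then c j else 0)).
have PE r : uniq r -> P r = theta (\sum_j t j).
  elim: r => [_|j0 r IH /= /andP[j0r ur]].
    rewrite /P (bigD1 [ffun j => t j])//= [X in _ + X = _]big1 ?addr0; last first.
      move=> a ta; have [j tj] : exists j, t j != a j.
        apply: contrapT => H; move/eqP: ta; apply; apply/ffunP => j; rewrite ffunE.
        by apply/eqP/negPn/negP => e; apply: H; exists j; rewrite eq_sym.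
      by rewrite [X in _ * X](bigD1 j)//= (negbTE tj) subr0 mul0r mulr0.
    rewrite [X in _ * X]big1 ?mulr1; last by move=> j _; rewrite ffunE eqxx subr0.
    by congr theta; apply: eq_bigr => j _; rewrite ffunE.
  rewrite -(IH ur).
  pose rest (a : {ffun 'I_s -> F}) := \prod_(j | j != j0)
     ((t j == a j)%:R - (if j \in r then c j else 0)) : R.
  have E (a : {ffun 'I_s -> F}) : \prod_j ((t j == a j)%:R - (if j \in j0 :: r then c j else 0)) =
      \prod_j ((t j == a j)%:R - (if j \in r then c j else 0)) - c j0 * rest a.
    rewrite (bigD1 j0)//= [X in _ = X - _](bigD1 j0)//= mem_head (negbTE j0r) subr0.
    rewrite (eq_bigr (fun j => (t j == a j)%:R - (if j \in r then c j else 0))).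
      by rewrite mulrBl.
    by move=> j jj0; rewrite inE (negbTE jj0).
  have Z : \sum_(a : {ffun 'I_s -> F}) theta (\sum_j a j) * (c j0 * rest a) = 0.
    apply: (sum_theta_shift (j0 := j0)) => a u; congr (_ * _).
    by apply: eq_bigr => j jj0; rewrite ffunE (negbTE jj0) addr0.
  rewrite /P (eq_bigr (fun a : {ffun 'I_s -> F} =>
    theta (\sum_j a j) * \prod_j ((t j == a j)%:R -
     (if j \in r then c j else 0)) - theta (\sum_j a j) * (c j0 * rest a))).
    by rewrite sumrB Z subr0.
  by move=> a _; rewrite E mulrBr.
have := PE (enum 'I_s) (enum_uniq _); rewrite /P => <-.
by apply: eq_bigr => a _; congr (_ * _); apply: eq_bigr => j _; rewrite mem_enum.
Qed.

Lemma theta_le (t : F) : `|theta t| <= b%:R.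
Proof.
have := b_gt1; rewrite /theta -/bR => bR1; case: eqP => _; rewrite ler_norml; lra.
Qed.

End digital_fourier.

(** * O *)

Section digits.
Variables (b : nat) (b_prime : prime b).
Local Notation F := 'F_b.

Let b_gt0 : (0 < b)%N. Proof. exact: prime_gt0. Qed.

Definition digits_value n (d : {ffun 'I_n -> F}) : nat := (\sum_(i < n) d i * b ^ i)%N.

Lemma ltn_Fp (t : F) : (t < b)%N.
Proof. by rewrite -[X in (_ < X)%N](Fp_cast b_prime) ltn_ord. Qed.

Lemma sum_digits_lt n (d : nat -> nat) : (forall i, d i < b)%N ->
  (\sum_(i < n) d i * b ^ i < b ^ n)%N.
Proof.
move=> db; elim: n => [|n IH]; first by rewrite big_ord0 expn0.
rewrite big_ord_recr/= expnS; apply: (@leq_trans (b ^ n + d n * b ^ n)%N).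
  by rewrite ltn_add2r.
by rewrite -mulSn leq_mul2r db orbT.
Qed.

Lemma digit_sum_digits n (d : nat -> nat) i : (forall i, d i < b)%N -> (i < n)%N ->
  ((\sum_(i < n) d i * b ^ i) %/ b ^ i %% b = d i)%N.
Proof.
move=> db; elim: n => // n IH; rewrite ltnS leq_eqVlt => /orP[/eqP ->|lt_in].
  rewrite big_ord_recr/= divnDMl ?expn_gt0 ?b_gt0// divn_small ?sum_digits_lt//.
  by rewrite add0n modn_small.
rewrite big_ord_recr/=.
have -> : (d n * b ^ n = (d n * b ^ (n - i.+1) * b) * b ^ i)%N.
  by rewrite -!mulnA -expnS -expnD; congr (_ * _ ^ _)%N; lia.
by rewrite divnDMl ?expn_gt0 ?b_gt0// addnC modnMDl IH.
Qed.

Let ext n (d : {ffun 'I_n -> F}) (i : nat) : nat :=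
  if insub i is Some i' then d i' else 0%N.

Let ext_lt n (d : {ffun 'I_n -> F}) i : (ext d i < b)%N.
Proof. by rewrite /ext; case: insubP => // i' _ _; exact: ltn_Fp. Qed.

Let extE n (d : {ffun 'I_n -> F}) (i : 'I_n) : ext d i = d i.
Proof. by rewrite /ext valK. Qed.

Let numE n (d : {ffun 'I_n -> F}) : digits_value d = (\sum_(i < n) ext d i * b ^ i)%N.
Proof. by apply: eq_bigr => i _; rewrite extE. Qed.

Lemma digits_value_lt n (d : {ffun 'I_n -> F}) : (digits_value d < b ^ n)%N.
Proof. by rewrite numE; exact: sum_digits_lt. Qed.

Lemma digit_digits_value n (d : {ffun 'I_n -> F}) (i : 'I_n) : (digits_value d %/ b ^ i %% b = d i)%N.
Proof. by rewrite numE digit_sum_digits// extE. Qed.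

Lemma digits_value_inj n : injective (@digits_value n).
Proof.
move=> d d' E; apply/ffunP => i; apply: val_inj => /=.
by rewrite -!digit_digits_value E.
Qed.

Lemma sum_digits_value {R : nmodType} n (f : nat -> R) :
  \sum_(c < b ^ n) f c = \sum_(d : {ffun 'I_n -> F}) f (digits_value d).
Proof.
pose g (d : {ffun 'I_n -> F}) := Ordinal (digits_value_lt d).
have ig : injective g by move=> d d' [] /digits_value_inj.
have cg : #|'I_(b ^ n)| = #|{: {ffun 'I_n -> F}}|.
  by rewrite card_ord card_ffun card_Fp// card_ord.
rewrite (reindex g)//=; apply: onW_bij; apply: inj_card_bij => //.
by rewrite cg.
Qed.

Definition rev_digits n (d : {ffun 'I_n -> F}) : {ffun 'I_n -> F} :=
  [ffun i => d (rev_ord i)].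

Lemma rev_digitsK n : involutive (@rev_digits n).
Proof. by move=> d; apply/ffunP => i; rewrite !ffunE rev_ordK. Qed.

Definition cell_index_of n (d : {ffun 'I_n -> F}) : nat := digits_value (rev_digits d).

Definition cell_digits n (c : nat) : {ffun 'I_n -> F} :=
  [ffun i : 'I_n => (c %/ b ^ (n - i.+1))%:R].

Lemma cell_index_of_lt n (d : {ffun 'I_n -> F}) : (cell_index_of d < b ^ n)%N.
Proof. exact: digits_value_lt. Qed.

Lemma Fp_natr_mod (k : nat) : (k %% b)%:R = k%:R :> F.
Proof. by apply: val_inj; rewrite /= !val_Fp_nat// modn_mod. Qed.

Lemma Fp_b0 : b%:R = 0 :> F.
Proof. by apply: val_inj; rewrite /= val_Fp_nat// modnn. Qed.

Lemma cell_digitsK n (d : {ffun 'I_n -> F}) : cell_digits n (cell_index_of d) = d.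
Proof.
apply/ffunP => i; rewrite ffunE -[(n - i.+1)%N]/(nat_of_ord (rev_ord i)).
by rewrite -Fp_natr_mod digit_digits_value ffunE rev_ordK natr_Zp.
Qed.

Lemma sum_cell_index_of {R : nmodType} n (f : nat -> R) :
  \sum_(c < b ^ n) f c = \sum_(d : {ffun 'I_n -> F}) f (cell_index_of d).
Proof.
rewrite sum_digits_value (reindex_inj (inv_inj (@rev_digitsK n))).
by apply: eq_bigr => d _.
Qed.

Lemma cell_index_of_sum n (d : {ffun 'I_n -> F}) {R : numFieldType} :
  (cell_index_of d)%:R / (b ^ n)%:R = \sum_(i < n) (d i)%:R / b%:R ^+ i.+1 :> R.
Proof.
have b0 : b%:R != 0 :> R by rewrite pnatr_eq0 -lt0n.
rewrite /cell_index_of /digits_value natr_sum mulr_suml (reindex_inj rev_ord_inj)/=.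
apply: eq_bigr => i _; rewrite ffunE rev_ordK natrM -mulrA; congr (_ * _).
rewrite !natrX.
have -> : b%:R ^+ n = b%:R ^+ (n - i.+1) * b%:R ^+ i.+1 :> R.
  by rewrite -exprD subnK.
by rewrite invfM mulrA divff ?mul1r// expf_neq0.
Qed.

Lemma cell_digits_shift n (a : 'I_n) (z c0 e e' : nat) (i : 'I_n) : (c0 < b ^ (n - a.+1))%N ->
  (e < b)%N -> (e' < b)%N ->
  cell_digits n ((z * b + e) * b ^ (n - a.+1) + c0) i - (if i == a then e%:R else 0) =
  cell_digits n ((z * b + e') * b ^ (n - a.+1) + c0) i - (if i == a then e'%:R else 0).
Proof.
move=> c0n eb e'b; rewrite !ffunE.
have bk k : (0 < b ^ k)%N by rewrite expn_gt0 b_gt0.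
have [->|ia] := eqVneq i a.
  rewrite !divnMDl// !(divn_small c0n) !addn0 !natrD !natrM.
  by rewrite Fp_b0 !mulr0 !add0r !subrr.
rewrite !subr0; have [lt_ia|] := ltnP i a.
  have -> : (b ^ (n - i.+1) = b ^ (n - a.+1) * (b * b ^ (a - i.+1)))%N.
    rewrite -expnS -expnD; congr (_ ^ _)%N; have := ltn_ord a; lia.
  by rewrite !divnMA !divnMDl// !(divn_small c0n) !addn0 !divnMDl// (divn_small eb) (divn_small e'b).
rewrite leq_eqVlt eq_sym => /orP[/eqP E|lt_ai].
  by move/eqP: ia; case; apply: val_inj.
have E : (b ^ (n - a.+1) = (b ^ (i - a.+1) * b) * b ^ (n - i.+1))%N.
  rewrite -expnSr -expnD; congr (_ ^ _)%N; have := ltn_ord i; lia.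
rewrite E !mulnA !divnMDl// !natrD !natrM.
by rewrite Fp_b0 !mulr0.
Qed.

End digits.

(** * P *)

Section lattice_digits.
Variables (b : nat) (b_prime : prime b) (s n m : nat).
Local Notation F := 'F_b.
Local Notation V := {ffun 'I_s -> {ffun 'I_n -> F}}.
Local Notation A := {ffun 'I_m -> F}.
Variable p : {poly F}.
Implicit Types q : 'I_s -> {poly F}.

Lemma digit_poly_digits_value (a : A) : digit_poly b (digits_value a) = \sum_(e < m) a e *: 'X^e.
Proof.
apply/polyP => i; rewrite coef_poly coef_sum.
under eq_bigr do rewrite coefZ coefXn.
have b1 := prime_gt1 b_prime.
have -> : (if (i < digits_value a)%N then ((digits_value a %/ b ^ i) %% b)%:R else 0 : F) =
    (digits_value a %/ b ^ i %% b)%:R.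
  case: ltnP => // ai; rewrite divn_small ?mod0n//.
  by apply: leq_ltn_trans ai (ltn_expl _ b1).
have [im|mi] := ltnP i m.
  rewrite (bigD1 (Ordinal im))//= eqxx mulr1 big1 ?addr0; last first.
    move=> e ei; rewrite (_ : (i == e) = false) ?mulr0//.
    by apply/negbTE; apply: contraNN ei => /eqP E; apply/eqP/val_inj; exact: esym E.
  by have := digit_digits_value b_prime a (Ordinal im) => /= ->; rewrite natr_Zp.
rewrite divn_small ?mod0n; last first.
  by apply: leq_trans (digits_value_lt b_prime a) _; rewrite leq_exp2l.
rewrite big1// => e _; rewrite (_ : (i == e) = false) ?mulr0//.
by apply/negbTE; rewrite neq_ltn (leq_trans (ltn_ord e) mi) orbT.
Qed.

Lemma lquot_coef_sum (I : finType) (a : I -> F) (f : I -> {poly F}) (k : nat) :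
  lquot_coef (\sum_e a e *: f e) p k = \sum_e a e * lquot_coef (f e) p k.
Proof.
rewrite /lquot_coef mulr_suml.
rewrite (big_morph (fun f => f %/ p) (fun x y => divpD p x y) (div0p p)) coef_sum.
by apply: eq_bigr => e _; rewrite -scalerAl divpZl coefZ.
Qed.

Definition generator q (e : 'I_m) : V :=
  [ffun j => [ffun i : 'I_n => lquot_coef ('X^e * q j) p i.+1]].

Lemma lattice_pointE {R : realType} q (a : A) (j : 'I_s) :
  lattice_point n p q (digits_value a) ord0 j =
  (cell_index_of (point_digits (generator q) a j))%:R / (b ^ n)%:R :> R.
Proof.
rewrite mxE /nu big_add1/= big_mkord cell_index_of_sum//; apply: eq_bigr => i _.
congr (_%:R / _); rewrite !ffunE digit_poly_digits_value mulr_suml.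
under eq_bigr do rewrite -scalerAl.
congr nat_of_ord; transitivity (\sum_e a e * lquot_coef ('X^e * q j) p i.+1).
  exact: (lquot_coef_sum a (fun e : 'I_m => 'X^e * q j) i.+1).
by apply: eq_bigr => e _; rewrite !ffunE.
Qed.

Lemma lattice_ruleE {R : realType} q (f : 'rV[R]_s -> R) :
  lattice_rule m n p q f =
  (#|{: A}|%:R)^-1 * \sum_(a : A) f (lattice_point n p q (digits_value a)).
Proof.
rewrite /lattice_rule big_mkord card_ffun card_Fp// card_ord.
by rewrite (sum_digits_value b_prime m (fun h => f (lattice_point n p q h))).
Qed.

Definition freq_poly (d : {ffun 'I_n -> F}) : {poly F} := \sum_(i < n) d i *: 'X^i.

Lemma coef_freq_poly d (i : 'I_n) : (freq_poly d)`_i = d i.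
Proof.
rewrite coef_sum (bigD1 i)//= coefZ coefXn eqxx mulr1 big1 ?addr0// => j ji.
by rewrite coefZ coefXn (_ : (_ == _) = false) ?mulr0//; apply/negbTE; rewrite eq_sym.
Qed.

Lemma size_freq_poly d : (size (freq_poly d) <= n)%N.
Proof.
apply: (leq_trans (size_sum _ _ _)); apply/bigmax_leqP => i _.
by apply: leq_trans (size_scale_leq _ _) _; rewrite size_polyXn.
Qed.

Lemma quot_coef_sum (I : finType) (a : I -> F) (f : I -> {poly F}) :
  ((\sum_e a e *: f e) %/ p)`_0 = \sum_e a e * (f e %/ p)`_0.
Proof.
rewrite (big_morph (fun f => f %/ p) (fun x y => divpD p x y) (div0p p)) coef_sum.
by apply: eq_bigr => e _; rewrite divpZl coefZ.
Qed.

Lemma dot_generator (k : V) q e : dotV k (generator q e) =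
  ((\sum_j q j * freq_poly (k j)) * 'X^(e.+1) %/ p)`_0.
Proof.
transitivity (((\sum_j 1 *: (q j * freq_poly (k j) * 'X^(e.+1))) %/ p)`_0); last first.
  by rewrite mulr_suml; under eq_bigr do rewrite scale1r.
rewrite quot_coef_sum; apply: eq_bigr => j _; rewrite mul1r /dotF.
transitivity (((\sum_i k j i *: ('X^e * q j * 'X^(i.+1))) %/ p)`_0).
  by rewrite quot_coef_sum; apply: eq_bigr => i _; rewrite !ffunE.
congr ((_ %/ _)`_0); rewrite /freq_poly [RHS]mulrAC [RHS]mulr_sumr; apply: eq_bigr => i _.
by rewrite -[RHS]scalerAr; congr (_ *: _); rewrite !exprS; ring.
Qed.

Hypothesis (p_irr : irreducible_poly p) (size_p : size p = n.+1) (le_mn : (m <= n)%N).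

Let p0 : p != 0. Proof. by rewrite -size_poly_gt0 size_p. Qed.

Definition dual_rem (k : V) q := (\sum_j q j * freq_poly (k j)) %% p.

Lemma size_dual_rem (k : V) q : k \in dual_net (generator q) -> (size (dual_rem k q) <= n - m)%N.
Proof.
rewrite inE => /forallP kd; set r := dual_rem k q.
have rp : (size r <= n)%N by rewrite -ltnS -size_p ltn_modp.
rewrite leqNgt; apply/negP => nmr.
have e_lt : (n - size r < m)%N by lia.
have := kd (Ordinal e_lt); rewrite dot_generator/=.
rewrite (divp_eq (\sum_j q j * freq_poly (k j)) p) -/(dual_rem _ _) -/r.
rewrite mulrDl mulrAC divp_addl_mul// coefD coefMXn/= add0r.
have sr : size (r * 'X^((n - size r).+1)) = n.+1.
  have r0 : r != 0 by rewrite -size_poly_gt0; lia.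
  by rewrite size_mulXn//; lia.
have := size_divp (r * 'X^((n - size r).+1)) p0.
rewrite sr size_p /= subSn// subnn => s1 /eqP c0.
move: s1 => /eqP /size_poly1P[c c_neq0 E]; move: c0; rewrite E coefC/= => /eqP.
by rewrite (negbTE c_neq0).
Qed.

Local Notation Q := {ffun 'I_s -> {poly_n F}}.

Lemma card_dual (k : V) : k != 0 ->
  (#|[pred q : Q | [forall j, q j != 0%R] && (k \in dual_net (generator (fun j => q j : {poly F})))]| * b ^ m <=
   2 * #|[pred q : Q | [forall j, q j != 0%R]]|)%N.
Proof.
move=> k0; set D := [pred q : Q | _ && _]; set G := [pred q : Q | _].
have [j0 kj0] : exists j0, freq_poly (k j0) != 0.
  apply: contrapT => H; move/eqP: k0; apply; apply/ffunP => j; apply/ffunP => i.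
  rewrite !ffunE; apply/eqP/negPn/negP => kji; apply: H; exists j.
  by apply: contraNneq kji => /(congr1 (fun f : {poly F} => f`_i)); rewrite coef_freq_poly coef0 => ->.
pose swap (qg : Q * {poly_n F}) : Q := [ffun j => if j == j0 then qg.2 else qg.1 j].
pose rem (q : Q) : {poly_(n - m) F} := npolyp (n - m) (dual_rem k (fun j => q j : {poly F})).
pose phi (qg : Q * {poly_n F}) := (swap qg, rem qg.1).
have remK (q : Q) : q \in D -> (rem q : {poly F}) = dual_rem k (fun j => q j : {poly F}).
  by rewrite inE => /andP[_ kd]; rewrite npolypK// size_dual_rem.
have iphi : {in predX D (predC1 (0 : {poly_n F})) &, injective phi}.
  move=> [q g] [q' g']; rewrite !inE/= => /andP[Dq _] /andP[Dq' _] [/ffunP E Er].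
  have eg : g = g' by have := E j0; rewrite !ffunE eqxx.
  have eq_off j : j != j0 -> q j = q' j.
    by move=> jj0; have := E j; rewrite !ffunE (negbTE jj0).
  congr pair => //; apply/ffunP => j; have [->|/eq_off//] := eqVneq j j0.
  have := congr1 val Er; rewrite /= !remK ?inE// => Er'.
  have : p %| (q j0 - q' j0 : {poly F}) * freq_poly (k j0).
    have -> : (q j0 - q' j0 : {poly F}) * freq_poly (k j0) =
       \sum_j (q j : {poly F}) * freq_poly (k j) - \sum_j (q' j : {poly F}) * freq_poly (k j).
      rewrite (bigD1 j0)//= [X in _ = _ - X](bigD1 j0)//=.
      rewrite (eq_bigr (fun j => (q' j : {poly F}) * freq_poly (k j))).
        by rewrite mulrBl; ring.
      by move=> j' jj0; rewrite eq_off.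
    by rewrite /dvdp modpD modpN -/(dual_rem _ _) Er' subrr.
  have cop : coprimep p (freq_poly (k j0)).
    rewrite irreducible_poly_coprime// gtNdvdp// size_p ltnS.
    exact: size_freq_poly.
  rewrite Gauss_dvdpl// => pd; apply/val_inj => /=; apply/eqP.
  rewrite -subr_eq0; apply: contraTT pd => d0; rewrite gtNdvdp// size_p ltnS.
  exact: (size_npoly (q j0 - q' j0)).
have sub : {in predX D (predC1 (0 : {poly_n F})), forall qg, phi qg \in predX G predT}.
  move=> [q g]; rewrite !inE/= => /andP[/andP[/forallP q0 _] g0]; rewrite andbT.
  apply/forallP => j; rewrite ffunE /=; case: ifP => _; [exact: g0|exact: q0].
have : (#|D| * (b ^ n).-1 <= #|G| * b ^ (n - m))%N.
  have <- : #|predX D (predC1 (0 : {poly_n F}))| = (#|D| * (b ^ n).-1)%N.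
    by rewrite cardX cardC1 card_npoly card_Fp.
  have <- : #|predX G (predT : pred {poly_(n - m) F})| = (#|G| * b ^ (n - m))%N.
    by rewrite cardX card_npoly card_Fp.
  rewrite -(card_in_image iphi); apply: fintype.subset_leq_card.
  by apply/fintype.subsetP => _ /fintype.imageP[qg Hqg ->]; exact: sub.
have bn : (2 <= b ^ n)%N.
  apply: leq_trans (prime_gt1 b_prime) _; rewrite -[X in (X <= _)%N]expn1 leq_exp2l ?prime_gt1//.
  by have := size_freq_poly (k j0); rewrite -size_poly_gt0 in kj0; apply: leq_trans.
have bE : (b ^ n = b ^ m * b ^ (n - m))%N by rewrite -expnD subnKC.
rewrite bE in bn *; move=> le_DG.
rewrite -(leq_pmul2r (_ : 0 < b ^ (n - m))%N) ?expn_gt0 ?prime_gt0// -mulnA -mulnA.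
apply: (@leq_trans (2 * (#|D| * (b ^ m * b ^ (n - m)).-1))%N); last by rewrite leq_mul2l.
by rewrite [X in (_ <= X)%N]mulnCA leq_mul2l; apply/orP; right; lia.
Qed.

End lattice_digits.

(** * Q *)

Section positions.

Fixpoint positions (n : nat) (P : pred nat) : seq nat :=
  if n is k.+1 then (if P k then k :: positions k P else positions k P) else [::].

Lemma mem_positions n P a : (a \in positions n P) = (a < n)%N && P a.
Proof.
elim: n a => [|n IH] a /=; first by rewrite in_nil.
rewrite ltnS leq_eqVlt.
have [->|an] := eqVneq a n.
  by case: (P n); rewrite ?mem_head// IH ltnn.
by case: ifP => Pn; rewrite ?inE ?(negbTE an)/= IH.
Qed.

Lemma sorted_positions n P : sorted gtn (positions n P).
Proof.
elim: n => // n IH /=; case: ifP => // Pn /=.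
rewrite path_min_sorted//; apply/allP => a; rewrite mem_positions.
by move=> /andP[].
Qed.

Lemma eq_positions n P P' : (forall a, (a < n)%N -> P a = P' a) ->
  positions n P = positions n P'.
Proof.
elim: n => // n IH PP' /=; rewrite PP'// IH// => a an.
by apply: PP'; exact: leq_trans an _.
Qed.

End positions.

Section weight_series.
Context {R : realFieldType}.
Variables (b : nat) (b_gt0 : (0 < b)%N) (x : R).

Definition digits_supp n c := positions n (fun i => c %/ b ^ i %% b != 0)%N.

Definition digit_weight d n c : R := \prod_(a <- take d (digits_supp n c)) x ^+ a.

Definition weight_sum d n : R := \sum_(c < b ^ n) digit_weight d n c.

Lemma weight_sum0 n : weight_sum 0 n = b%:R ^+ n.
Proof.
rewrite /weight_sum (eq_bigr (fun=> 1)); last first.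
  by move=> c _; rewrite /digit_weight take0 big_nil.
by rewrite sumr_const card_ord -natrX.
Qed.

Lemma weight_sum_n0 d : weight_sum d 0 = 1.
Proof.
rewrite /weight_sum expn0 (eq_bigr (fun=> 1)); last first.
  by move=> c _; rewrite /digit_weight/= big_nil.
by rewrite sumr_const card_ord.
Qed.

Lemma digits_supp_recl n t c : (t < b)%N -> (c < b ^ n)%N ->
  digits_supp n.+1 (t * b ^ n + c) =
  if t == 0%N then digits_supp n c else n :: digits_supp n c.
Proof.
move=> tb cn; rewrite /digits_supp/= divnMDl ?expn_gt0 ?b_gt0// divn_small// addn0.
rewrite modn_small//.
rewrite [positions n _](@eq_positions _ _ (fun i => c %/ b ^ i %% b != 0)%N); last first.
  move=> a an; congr (_ != _).
  have -> : (t * b ^ n = (t * b ^ (n - a.+1) * b) * b ^ a)%N.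
    by rewrite -!mulnA -expnS -expnD; congr (_ * _ ^ _)%N; lia.
  by rewrite divnMDl ?expn_gt0 ?b_gt0// modnMDl.
by case: (t == 0)%N.
Qed.

Lemma weight_sumS d n :
  weight_sum d.+1 n.+1 = weight_sum d.+1 n + (b.-1)%:R * (x ^+ n * weight_sum d n).
Proof.
rewrite /weight_sum expnS -(big_mkord xpredT (digit_weight d.+1 n.+1)) big_nat_mul.
rewrite big_mkord.
have E (t : 'I_b) : \sum_(t * b ^ n <= j < t.+1 * b ^ n) digit_weight d.+1 n.+1 j =
   if t == 0%N :> nat then \sum_(c < b ^ n) digit_weight d.+1 n c
   else x ^+ n * \sum_(c < b ^ n) digit_weight d n c.
  rewrite -{1}[(t * b ^ n)%N]add0n big_addn mulSn addnK big_mkord.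
  case: ifPn => t0; last rewrite mulr_sumr; apply: eq_bigr => c _;
    rewrite /digit_weight addnC digits_supp_recl// ?(negbTE t0) ?t0//.
  by rewrite /= big_cons.
rewrite (eq_bigr _ (fun t _ => E t)).
case: b b_gt0 => // b' _; rewrite big_ord_recl/=; congr (_ + _).
by rewrite sumr_const card_ord mulr_natl.
Qed.

Lemma weight_sum_bound (beta : nat -> R) (rho : R) d :
  0 <= x -> 0 <= rho -> rho < 1 -> beta 0%N = b%:R ->
  (forall k, (k < d)%N -> 1 <= beta k.+1) ->
  (forall k, (k < d)%N -> x * beta k <= rho * beta k.+1) ->
  exists2 C : R, 0 <= C & forall n, weight_sum d n <= C * beta d ^+ n.
Proof.
move=> x0 rho0 rho1 beta0; elim: d => [_ _|d IH beta1 xb].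
  by exists 1 => // n; rewrite weight_sum0 beta0 mul1r.
have beta_ge0 k : (k <= d)%N -> 0 <= beta k.
  case: k => [_|k kd]; first by rewrite beta0.
  by apply: le_trans ler01 _; apply: beta1; exact: leqW.
have [||C C0 HC] := IH; [by move=> k kd; apply: beta1; exact: leqW
  |by move=> k kd; apply: xb; exact: leqW|].
pose D := (b.-1)%:R * C; have D0 : 0 <= D by rewrite mulr_ge0.
have b1 : 1 <= beta d.+1 by exact: beta1.
have b0 : 0 <= beta d.+1 by exact: le_trans ler01 b1.
exists (1 + D / (1 - rho)) => [|n].
  by rewrite addr_ge0// divr_ge0// subr_ge0 ltW.
have rho1' : 0 < 1 - rho by rewrite subr_gt0.
apply: (@le_trans _ _ ((1 + D * (1 - rho ^+ n) / (1 - rho)) * beta d.+1 ^+ n)).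
  elim: n => [|n IHn]; first by rewrite weight_sum_n0 expr0 subrr mulr0 mul0r addr0 mulr1.
  rewrite weight_sumS.
  have le2 : (b.-1)%:R * (x ^+ n * weight_sum d n) <= D * (rho ^+ n * beta d.+1 ^+ n).
    rewrite /D -mulrA ler_wpM2l//.
    apply: (@le_trans _ _ (x ^+ n * (C * beta d ^+ n))).
      by rewrite ler_wpM2l// exprn_ge0.
    rewrite mulrCA ler_wpM2l// -!exprMn lerXn2r ?nnegrE ?(mulr_ge0 x0 (beta_ge0 _ _)) ?(mulr_ge0 rho0 b0)//.
    exact: xb.
  apply: le_trans (lerD IHn le2) _.
  rewrite (mulrA D) -mulrDl [beta d.+1 ^+ n.+1]exprS mulrA ler_wpM2r ?exprn_ge0//.
  have -> : 1 + D * (1 - rho ^+ n) / (1 - rho) + D * rho ^+ n =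
      1 + D * (1 - rho ^+ n.+1) / (1 - rho).
    by rewrite exprS; field; rewrite gt_eqF.
  apply: ler_peMr b1.
  by rewrite addr_ge0// divr_ge0 ?mulr_ge0 ?subr_ge0 ?exprn_ile1// ltW.
rewrite ler_wpM2r ?exprn_ge0// lerD2l ler_pM2r ?invr_gt0// ler_piMr//.
by rewrite gerBl exprn_ge0.
Qed.

End weight_series.

(** * R *)

Section walsh.
Context {R : realType}.
Variables (b : nat) (b_prime : prime b) (n : nat).
Local Notation F := 'F_b.
Local Notation B := (b%:R : R).

Let b_gt1 : (1 < b)%N. Proof. exact: prime_gt1. Qed.

Lemma sum_Fp (h : F -> R) : \sum_(e < b) h e%:R = \sum_(u : F) h u.
Proof.
have E N (f : nat -> R) : N = b -> \sum_(e < b) f e = \sum_(e < N) f e by move=> ->.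
rewrite (E _ (fun e => h e%:R) (Fp_cast b_prime)).
by apply: eq_bigr => u _; rewrite natr_Zp.
Qed.

Definition walsh_weight alpha (k : {ffun 'I_n -> F}) : R := digit_weight b B^-1 alpha n (digits_value k).

Definition walsh_step (k : {ffun 'I_n -> F}) (t : F) : R -> R :=
  cell_step b n (fun c => (dotF k (cell_digits b n c) == t)%:R - B^-1).

Lemma balanced_walsh_step k t a : a \in digits_supp b n (digits_value k) -> balanced b a (walsh_step k t).
Proof.
rewrite mem_positions => /andP[an ka].
pose i0 := Ordinal an; rewrite (digit_digits_value b_prime k i0) in ka.
have k0 : k i0 != 0 by apply: contraNneq ka => ->.
apply: balanced_cell_step => // z c0 za c0n.
pose c e := ((z * b + e) * b ^ (n - a.+1) + c0)%N.
pose X := dotF k (cell_digits b n (c 0%N)).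
have dE (e : 'I_b) : dotF k (cell_digits b n (c e)) = X + k i0 * e%:R.
  have -> : k i0 * e%:R = \sum_i k i * (if i == i0 then e%:R else 0).
    rewrite (bigD1 i0)//= eqxx big1 ?addr0// => i ii0.
    by rewrite (negbTE ii0) mulr0.
  rewrite /X /dotF -big_split/=; apply: eq_bigr => i _.
  rewrite -mulrDr; congr (_ * _).
  have := @cell_digits_shift b b_prime n i0 z c0 e 0%N i c0n (ltn_ord e) (ltnW b_gt1).
  by rewrite mulr0n => /eqP; case: ifP => _; rewrite ?subr0 ?addr0 ?subr_eq => /eqP.
rewrite (eq_bigr (fun e : 'I_b => (fun u => (X + k i0 * u == t)%:R - B^-1) e%:R)); last first.
  by move=> e _; rewrite -/(c e) dE.
rewrite (sum_Fp (fun u => (X + k i0 * u == t)%:R - B^-1)) sumrB sumr_const card_Fp//.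
rewrite (bigD1 ((t - X) / k i0))//= big1 => [|u ut].
  have -> : X + k i0 * ((t - X) / k i0) = t by rewrite mulrCA divff// mulr1 addrC subrK.
  rewrite eqxx addr0 -[_ *+ b]mulr_natl divff ?subrr//.
  by rewrite pnatr_eq0 -lt0n prime_gt0.
rewrite (_ : (_ == _) = false)//; apply/negbTE; apply: contraNN ut => /eqP <-.
by rewrite addrC addKr mulrC mulKf.
Qed.

Lemma walsh_step_prim_bounded alpha k t : prim_bounded alpha (2 ^+ alpha * walsh_weight alpha k) (walsh_step k t).
Proof.
have B1 : 1 < B by rewrite ltr1n.
have -> : 2 ^+ alpha * walsh_weight alpha k =
    2 ^+ alpha * 1 * \prod_(a <- take alpha (digits_supp b n (digits_value k))) B ^- a.
  by rewrite mulr1; congr (_ * _); apply: eq_bigr => a _; rewrite exprVn.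
apply: balanced_prim_bounded => //.
- exact: sorted_positions.
- exact: cell_step_approx.
- by move=> a; exact: balanced_walsh_step.
- apply: cell_step_bound => // c _.
  have : 0 < B^-1 by rewrite invr_gt0; lra.
  have : B^-1 < 1 by rewrite invf_lt1; lra.
  by case: eqP => _ /= h1 h2; rewrite ler_norml; lra.
Qed.

Lemma walsh_weight_ge0 alpha k : 0 <= walsh_weight alpha k.
Proof. by apply: prodr_ge0 => a _; rewrite exprn_ge0. Qed.

End walsh.

(** * S *)

Section rule_error.
Context {R : realType} {s : nat}.
Local Notation Rs := 'rV[R]_s.
Local Notation mu := (@lebesgue_rV R s).
Variables (alpha : nat) (gamma : {set 'I_s} -> R) (q : \bar R) (f : Rs -> R) (Gam : R).
Hypothesis alpha_ge2 : (2 <= alpha)%N.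
Hypothesis gamma_gt0 : forall u, 0 < gamma u.
Hypothesis gamma_le : forall u, gamma u <= Gam.
Hypothesis q_ge1 : (1 <= q)%E.
Hypothesis f_sob : sob_space alpha gamma q f.
Hypothesis norm_le1 : (sob_norm alpha gamma q f <= 1)%E.
Variables (b : nat) (b_prime : prime b) (n : nat).
Local Notation F := 'F_b.
Local Notation B := (b%:R : R).
Local Notation V := {ffun 'I_s -> {ffun 'I_n -> F}}.

Definition cell (c : nat) (x : R) : R := (c%:R * B ^- n <= x < c.+1%:R * B ^- n)%R%:R.

Let b_gt1 : (1 < b)%N. Proof. exact: prime_gt1. Qed.
Let B_gt0 : 0 < B. Proof. by rewrite ltr0n prime_gt0. Qed.

Lemma density_cell c x : density (c%:R / (b ^ n)%:R) (B ^- n) x = (b ^ n)%:R * cell c x.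
Proof.
rewrite /density /cell natrX invrK; congr (_ * (_ <= x < _)%R%:R).
by rewrite -natr1 mulrDl mul1r.
Qed.

Lemma cell_approx c : (c < b ^ n)%N -> approximable (cell c).
Proof.
move=> cn; have Bn : 0 < B ^+ n by rewrite exprn_gt0.
apply: approx_itv; first by rewrite divr_ge0// ltW.
by rewrite ler_pdivrMr// mul1r -natrX ler_nat.
Qed.

Let weak_g h : (forall j, (h j <= alpha)%N) -> weak_mixed_partial h f (sob_deriv h f) :=
  fun ha => sob_derivP f_sob ha.
Let h0a : forall j : 'I_s, ((fun=> 0%N) j <= alpha)%N. Proof. by []. Qed.
Let alpha_gt0 : (0 < alpha)%N. Proof. exact: ltnW. Qed.

Lemma pairing_cell_step (W : 'I_s -> {ffun 'I_n -> F} -> R) :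
  \sum_(z : V) (\prod_j W j (z j)) * pairing f (fun j => cell (cell_index_of (z j))) =
  pairing f (fun j => cell_step b n (fun c => W j (cell_digits b n c))).
Proof.
pose T (z : V) (x : Rs) : R :=
  (\prod_j W j (z j)) * (sob_deriv (fun=> 0%N) f x * tprod (fun j => cell (cell_index_of (z j))) x).
have iT0 (z : V) : mu.-integrable open_cube
    (EFin \o (fun x => sob_deriv (fun=> 0%N) f x * tprod (fun j => cell (cell_index_of (z j))) x)).
  apply: integrable_tprod; first exact: (g_integrable weak_g h0a).
  by move=> j; apply: cell_approx; exact: cell_index_of_lt.
have iT (z : V) : mu.-integrable open_cube (EFin \o T z).
  have := integrableZl (@measurable_open_cube R s) (\prod_j W j (z j)) (iT0 z).
  by apply: eq_integrable => //; exact: measurable_open_cube.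
transitivity (\sum_(z : V) \int[mu]_(x in open_cube) T z x).
  apply: eq_bigr => z _; rewrite /T RintegralZl//; exact: measurable_open_cube.
rewrite -(Rintegral_sum (index_enum _) iT) /pairing /deriv_pairing.
apply: eq_Rintegral => x _; rewrite /T.
have -> : tprod (fun j => cell_step b n (fun c => W j (cell_digits b n c))) x =
    \sum_(z : V) \prod_j (W j (z j) * cell (cell_index_of (z j)) (x ord0 j)).
  rewrite -(bigA_distr_bigA (fun j d => W j d * cell (cell_index_of d) (x ord0 j))).
  apply: eq_bigr => j _; rewrite /cell_step.
  rewrite (sum_cell_index_of b_prime n (fun c => W j (cell_digits b n c) * cell c (x ord0 j))).
  by apply: eq_bigr => d _; rewrite cell_digitsK.
rewrite mulr_sumr; apply: eq_bigr => z _.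
by rewrite big_split/= mulrCA.
Qed.

Definition cell_mean (z : V) : R :=
  pairing f (fun j => density ((cell_index_of (z j))%:R / (b ^ n)%:R) (B ^- n)).

Lemma cell_meanE z :
  cell_mean z = #|{: V}|%:R * pairing f (fun j => cell (cell_index_of (z j))).
Proof.
rewrite /cell_mean /pairing /deriv_pairing card_ffun card_ffun card_Fp// !card_ord (natrX _ (b ^ n)%N).
rewrite -RintegralZl//; last first.
- apply: integrable_tprod; first exact: (g_integrable weak_g h0a).
  by move=> j; apply: cell_approx; exact: cell_index_of_lt.
- exact: measurable_open_cube.
apply: eq_Rintegral => x _; rewrite mulrCA; congr (_ * _).
rewrite [LHS](eq_bigr _ (fun j _ => density_cell _ (x ord0 j))).
by rewrite big_split/= prodr_const card_ord.
Qed.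

Let V0 : #|{: V}|%:R != 0 :> R.
Proof. by rewrite pnatr_eq0 -lt0n; apply/card_gt0P; exists 0. Qed.

Lemma mean_cell_mean : (#|{: V}|%:R)^-1 * \sum_z cell_mean z = cube_integral f.
Proof.
under eq_bigr do rewrite cell_meanE.
rewrite -mulr_sumr mulrA mulVf// mul1r.
transitivity (\sum_(z : V) (\prod_(j < s) (1 : R)) * pairing f (fun j => cell (cell_index_of (z j)))).
  by apply: eq_bigr => z _; rewrite big1// mul1r.
rewrite (pairing_cell_step (fun _ _ => 1)).
rewrite (cube_integralE alpha_ge2 gamma_gt0 gamma_le q_ge1 f_sob norm_le1).
rewrite /pairing /deriv_pairing; apply: eq_Rintegral => x; rewrite inE => cx; congr (_ * _).
apply: eq_bigr => j _; have /andP[x0 x1] := cx j.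
have [c cn cx'] := @cell_index R b b_gt1 n (x ord0 j) (ltW x0) x1.
by rewrite (@cell_stepE R b b_gt1 n (fun=> 1) c _ cn cx').
Qed.

Lemma walsh_coeff_bound (k : V) :
  `|(#|{: V}|%:R)^-1 * \sum_z cell_mean z * theta (dotV k z)| <=
  B ^+ s.+1 * (2 ^+ (s * alpha) * (2 * Gam)) * \prod_j (2 ^+ alpha * walsh_weight alpha (k j)).
Proof.
set C1 := 2 ^+ (s * alpha) * (2 * Gam); set Om := \prod_j _.
have -> : (#|{: V}|%:R)^-1 * \sum_z cell_mean z * theta (dotV k z) =
    \sum_(a : {ffun 'I_s -> F}) theta (\sum_j a j) *
      pairing f (fun j => walsh_step (k j) (a j)).
  transitivity (\sum_z theta (dotV k z) * pairing f (fun j => cell (cell_index_of (z j)))).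
    rewrite mulr_sumr; apply: eq_bigr => z _.
    by rewrite cell_meanE -mulrA mulKf// mulrC.
  have E (z : V) : theta (dotV k z) = \sum_(a : {ffun 'I_s -> F})
      theta (\sum_j a j) * \prod_j ((dotF (k j) (z j) == a j)%:R - B^-1).
    exact: (theta_expansion b_prime (fun j => dotF (k j) (z j)) (fun=> B^-1)).
  under eq_bigr do rewrite E mulr_suml.
  rewrite exchange_big/=; apply: eq_bigr => a _.
  rewrite -[X in _ = _ * X](pairing_cell_step (fun j d => (dotF (k j) d == a j)%:R - B^-1)).
  by rewrite mulr_sumr; apply: eq_bigr => z _; rewrite mulrA.
apply: le_trans (ler_norm_sum _ _ _) _.
apply: (@le_trans _ _ (\sum_(a : {ffun 'I_s -> F}) B * (C1 * Om))).
  apply: ler_sum => a _; rewrite normrM ler_pM ?theta_le//.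
  apply: (pairing_bound alpha_gt0 gamma_gt0 gamma_le q_ge1 f_sob norm_le1) => j.
    exact: walsh_step_prim_bounded.
  by rewrite mulr_ge0 ?exprn_ge0 ?walsh_weight_ge0.
rewrite sumr_const card_ffun card_Fp// card_ord -[_ *+ (b ^ s)%N]mulr_natl natrX exprSr -!mulrA.
by [].
Qed.

Definition dual_sum alpha m (psi : 'I_m -> V) : R :=
  \sum_(k in dual_net psi | k != 0) \prod_j walsh_weight alpha (k j).

Definition rule_const : R :=
  (B - 1)^-1 * (B ^+ s.+1 * (2 ^+ (s * alpha) * (2 * Gam)) * (2 ^+ alpha) ^+ s).

Let idx_cell_le1 (d : {ffun 'I_n -> F}) :
  (cell_index_of d)%:R / (b ^ n)%:R + B ^- n <= 1 :> R.
Proof.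
have bn0 : 0 < (b ^ n)%:R :> R by rewrite ltr0n expn_gt0 prime_gt0.
have -> : B ^- n = 1 / (b ^ n)%:R :> R by rewrite natrX mul1r.
by rewrite -mulrDl ler_pdivrMr// mul1r natr1 ler_nat; exact: cell_index_of_lt.
Qed.

Let lattice_point_cube m p (qv : 'I_s -> {poly F}) (a : {ffun 'I_m -> F}) :
  cube (lattice_point n p qv (digits_value a) : Rs).
Proof.
move=> j; have bn0 : 0 < (b ^ n)%:R :> R by rewrite ltr0n expn_gt0 prime_gt0.
by rewrite lattice_pointE// divr_ge0//= ltr_pdivrMr// mul1r ltr_nat; exact: cell_index_of_lt.
Qed.

Lemma lattice_rule_error m p (qv : 'I_s -> {poly F}) :
  `|lattice_rule m n p qv f - cube_integral f| <=
  s%:R * (@eval_bound R s alpha Gam * B ^- n) + rule_const * dual_sum alpha (generator n p qv : 'I_m -> V).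
Proof.
have B1 : 1 < B by rewrite ltr1n.
have bn0 : 0 < (b ^ n)%:R :> R by rewrite ltr0n expn_gt0 prime_gt0.
pose psi : 'I_m -> V := generator n p qv.
pose A := {ffun 'I_m -> F}.
have A0 : 0 < #|{: A}|%:R :> R by rewrite ltr0n; apply/card_gt0P; exists 0.
pose Q := (#|{: A}|%:R : R)^-1 * \sum_(a : A) cell_mean (point_digits psi a).
have pt (a : A) j : lattice_point n p qv (digits_value a) ord0 j =
   (cell_index_of (point_digits psi a j))%:R / (b ^ n)%:R :> R by exact: lattice_pointE.
have le1 : `|lattice_rule m n p qv f - Q| <= s%:R * (@eval_bound R s alpha Gam * B ^- n).
  rewrite lattice_ruleE// /Q -mulrBr -sumrB normrM gtr0_norm ?invr_gt0//.
  rewrite ler_pdivrMl//; apply: le_trans (ler_norm_sum _ _ _) _.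
  apply: (@le_trans _ _ (\sum_(a : A) s%:R * (@eval_bound R s alpha Gam * B ^- n))); last first.
    by rewrite sumr_const [leRHS]mulr_natl.
  apply: ler_sum => a _.
  have -> : cell_mean (point_digits psi a) =
      pairing f (fun j => density (lattice_point n p qv (digits_value a) ord0 j) (B ^- n)).
    by rewrite /cell_mean; congr (pairing f _); apply/funext => j; rewrite pt.
  apply: (eval_density alpha_ge2 gamma_gt0 gamma_le q_ge1 f_sob norm_le1).
  - exact: lattice_point_cube.
  - by rewrite invr_gt0 exprn_gt0.
  - by move=> j; rewrite pt; exact: idx_cell_le1.
have le2 : `|Q - cube_integral f| <= rule_const * dual_sum alpha psi.
  rewrite /Q (digital_rule b_prime) mean_cell_mean addrC addKr normrM.
  rewrite gtr0_norm ?invr_gt0 ?subr_gt0// /rule_const -[leRHS]mulrA.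
  rewrite ler_pM2l ?invr_gt0 ?subr_gt0//.
  apply: le_trans (ler_norm_sum _ _ _) _; rewrite /dual_sum mulr_sumr.
  apply: ler_sum => k _; apply: le_trans (walsh_coeff_bound k) _.
  by rewrite big_split/= prodr_const card_ord [leLHS]mulrA.
rewrite -[lattice_rule _ _ _ _ _](subrK Q) -addrA.
by apply: le_trans (ler_normD _ _) (lerD le1 le2).
Qed.

Lemma lattice_rule_error_trivial m p (qv : 'I_s -> {poly F}) :
  `|lattice_rule m n p qv f - cube_integral f| <= 2 * @eval_bound R s alpha Gam.
Proof.
have mean_le (T : finType) (h : T -> R) (c : R) : 0 < #|T|%:R :> R ->
    (forall t, `|h t| <= c) -> `|(#|T|%:R)^-1 * \sum_t h t| <= c.
  move=> T0 hc; rewrite normrM gtr0_norm ?invr_gt0// ler_pdivrMl//.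
  apply: le_trans (ler_norm_sum _ _ _) _.
  apply: (@le_trans _ _ (\sum_(t : T) c)); first by apply: ler_sum => t _.
  by rewrite sumr_const [leRHS]mulr_natl.
apply: le_trans (ler_normB _ _) _; rewrite mulr_natl mulr2n lerD//.
  rewrite lattice_ruleE//; apply: mean_le => [|a].
    by rewrite ltr0n; apply/card_gt0P; exists 0.
  apply: (f_bounded alpha_ge2 gamma_gt0 gamma_le q_ge1 f_sob norm_le1).
  exact: lattice_point_cube.
rewrite -mean_cell_mean; apply: mean_le => [|z].
  by rewrite ltr0n; apply/card_gt0P; exists 0.
have bn0 : 0 < (b ^ n)%:R :> R by rewrite ltr0n expn_gt0 prime_gt0.
rewrite /cell_mean.
have := @pairing_density_bound R s alpha gamma q f Gam alpha_ge2 gamma_gt0 gamma_le q_ge1 f_sob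
  norm_le1 (\row_j ((cell_index_of (z j))%:R / (b ^ n)%:R)) (B ^- n).
under [in X in `|pairing _ X|]boolp.eq_fun do rewrite mxE.
apply.
- by move=> j; rewrite mxE divr_ge0.
- by rewrite invr_gt0 exprn_gt0.
- by move=> j; rewrite mxE; exact: idx_cell_le1.
Qed.

End rule_error.

(** * T *)

Lemma sum_le_powR {R : realType} (I : finType) (P : pred I) (t : I -> R) (E beta : R) :
  (forall i, P i -> 0 <= t i) -> 1 <= beta -> \sum_(i | P i) t i <= E ->
  \sum_(i | P i) t i `^ beta <= E `^ beta.
Proof.
move=> t0 b1 sE.
have E0 : 0 <= E by apply: le_trans sE; exact: sumr_ge0.
have b0 : 0 < beta by exact: lt_le_trans b1.
have tE i : P i -> t i <= E.
  move=> Pi; apply: le_trans sE; rewrite (bigD1 i)//= lerDl.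
  by apply: sumr_ge0 => j /andP[Pj _]; exact: t0.
apply: (@le_trans _ _ (\sum_(i | P i) t i * E `^ (beta - 1))).
  apply: ler_sum => i Pi; rewrite -(mulr_powRB1 (t0 i Pi) b0) ler_wpM2l ?t0//.
  by apply: ge0_ler_powR; rewrite ?subr_ge0 ?nnegrE ?t0 ?tE.
by rewrite -mulr_suml -[leRHS](mulr_powRB1 E0 b0) ler_wpM2r ?powR_ge0.
Qed.

Section dual_average.
Context {R : realType}.
Variables (b : nat) (b_prime : prime b) (s alpha : nat) (beta : R).
Hypothesis alpha_gt0 : (0 < alpha)%N.
Hypothesis beta_ge1 : 1 <= beta.
Hypothesis beta_lt : beta < alpha%:R.
Local Notation F := 'F_b.
Local Notation B := (b%:R : R).

Let B1 : 1 < B. Proof. by rewrite ltr1n prime_gt1. Qed.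
Let B0 : 0 < B. Proof. exact: lt_trans ltr01 B1. Qed.

Definition scaled_base : R := B^-1 `^ beta^-1.

Lemma walsh_weight_powR n (k : {ffun 'I_n -> F}) :
  (walsh_weight alpha k : R) = digit_weight b scaled_base alpha n (digits_value k) `^ beta.
Proof.
rewrite /walsh_weight /digit_weight; elim: (take _ _) => [|a l IH].
  by rewrite !big_nil powR1.
rewrite !big_cons powRM ?prodr_ge0 ?exprn_ge0 ?powR_ge0//; last first.
  by move=> *; rewrite exprn_ge0 ?powR_ge0.
rewrite IH; congr (_ * _); rewrite /scaled_base -[X in X `^ beta]powR_mulrn ?powR_ge0// -!powRrM.
rewrite mulrCA mulVf ?mulr1 ?powR_mulrn ?invr_ge0 ?ltW// gt_eqF//.
by apply: lt_le_trans beta_ge1.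
Qed.

Lemma scaled_series_bounded : exists2 C : R, 0 < C &
  forall n, weight_sum b scaled_base alpha n <= C.
Proof.
have al0 : 0 < alpha%:R :> R by rewrite ltr0n.
have be0 : 0 < beta by apply: lt_le_trans beta_ge1.
pose bt (d : nat) : R := B `^ (1 - d%:R / alpha%:R).
pose rho : R := B `^ (alpha%:R^-1 - beta^-1).
have xE : scaled_base = B `^ (- beta^-1).
  by rewrite /scaled_base -powR_inv1 ?ltW// -powRrM mulN1r.
have [||||||C C0 HC] := @weight_sum_bound R b (prime_gt0 b_prime) scaled_base bt rho alpha.
- exact: powR_ge0.
- exact: powR_ge0.
- rewrite /rho /powR gt_eqF// expR_lt1 pmulr_llt0 ?ln_gt0// subr_lt0.
  by rewrite ltf_pV2 ?posrE.
- by rewrite /bt mul0r subr0 powRr1// ltW.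
- move=> k ka; rewrite -[leLHS](powRr0 B) /bt; apply: ler_powR; first exact: ltW.
  by rewrite subr_ge0 ler_pdivrMr// mul1r ler_nat.
- move=> k ka; rewrite xE /bt /rho -!powRD ?(gt_eqF B0) ?implybT//.
  rewrite le_eqVlt; apply/orP; left; apply/eqP; congr (_ `^ _).
  by rewrite -natr1; field; rewrite !gt_eqF.
exists (C + 1) => [|n]; first by rewrite ltr_wpDl.
have := HC n; rewrite /bt divff ?gt_eqF// subrr powRr0 expr1n mulr1 => h.
by apply: le_trans h _; rewrite lerDl.
Qed.

Section bad_vectors.
Variables (m n : nat) (p : {poly F}).
Hypotheses (p_irr : irreducible_poly p) (size_p : size p = n.+1) (le_mn : (m <= n)%N).
Local Notation V := {ffun 'I_s -> {ffun 'I_n -> F}}.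
Local Notation T := {ffun 'I_s -> {poly_n F}}.

Definition nonzero_vectors : {set T} := finset (fun q : T => [forall j, q j != 0]).

Definition generator_of (q : T) : 'I_m -> V := generator n p (fun j => q j : {poly F}).

Definition scaled_weight (k : V) : R := \prod_j digit_weight b scaled_base alpha n (digits_value (k j)).

Definition scaled_dual_sum (q : T) : R :=
  \sum_(k in dual_net (generator_of q) | k != 0) scaled_weight k.

Let scaled_weight_ge0 k : 0 <= scaled_weight k.
Proof.
by apply: prodr_ge0 => j _; apply: prodr_ge0 => a _; rewrite exprn_ge0 ?powR_ge0.
Qed.

Lemma sum_scaled_weight :
  \sum_(k : V) scaled_weight k = weight_sum b scaled_base alpha n ^+ s.
Proof.
rewrite /scaled_weight -(bigA_distr_bigA (fun (j : 'I_s) d =>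
  digit_weight b scaled_base alpha n (digits_value d))) prodr_const card_ord; congr (_ ^+ _).
by rewrite /weight_sum (sum_digits_value b_prime n (fun c => digit_weight b scaled_base alpha n c)).
Qed.

Lemma sum_scaled_dual_sum : \sum_(q in nonzero_vectors) scaled_dual_sum q <=
  2 * #|nonzero_vectors|%:R / (b ^ m)%:R * weight_sum b scaled_base alpha n ^+ s.
Proof.
have bm0 : 0 < (b ^ m)%:R :> R by rewrite ltr0n expn_gt0 prime_gt0.
rewrite /scaled_dual_sum (exchange_big_dep (fun k : V => k != 0))/=; last first.
  by move=> q k _ /andP[].
rewrite -sum_scaled_weight mulr_sumr [leRHS](bigID (fun k : V => k != 0))/=.
rewrite -[leLHS]addr0 lerD//; last first.
  by apply: sumr_ge0 => k _; rewrite mulr_ge0// divr_ge0// mulr_ge0.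
apply: ler_sum => k k0; rewrite sumr_const -[leLHS]mulr_natl ler_wpM2r//.
rewrite ler_pdivlMr// -!natrM ler_nat.
have := card_dual b_prime p_irr size_p le_mn k0.
congr (_ * _ <= 2 * _)%N; apply: eq_card => q; rewrite !inE.
  by rewrite unfold_in /= !inE k0 andbT.
by [].
Qed.

Definition bad_vectors (c : R) : {set T} :=
  finset (fun q : T => (q \in nonzero_vectors) && (c < scaled_dual_sum q)).

Lemma card_bad_vectors (C rho : R) : 0 < C -> 0 < rho ->
  weight_sum b scaled_base alpha n <= C ->
  4 * #|bad_vectors (8 * C ^+ s / (rho * (b ^ m)%:R))|%:R <= rho * #|nonzero_vectors|%:R.
Proof.
move=> C0 rho0 sC; set c := 8 * _ / _.
have bm0 : 0 < (b ^ m)%:R :> R by rewrite ltr0n expn_gt0 prime_gt0.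
have Cs0 : 0 < C ^+ s by rewrite exprn_gt0.
have sum0 q : 0 <= scaled_dual_sum q by apply: sumr_ge0.
have H : #|bad_vectors c|%:R * c <= 2 * #|nonzero_vectors|%:R / (b ^ m)%:R * C ^+ s.
  apply: (@le_trans _ _ (\sum_(q in nonzero_vectors) scaled_dual_sum q)).
    apply: (@le_trans _ _ (\sum_(q in bad_vectors c) scaled_dual_sum q)).
      rewrite mulr_natl -sumr_const; apply: ler_sum => q.
      by rewrite inE => /andP[_ /ltW].
    rewrite [leRHS](bigID (fun q => c < scaled_dual_sum q))/=.
    rewrite (eq_bigl (fun q => (q \in nonzero_vectors) && (c < scaled_dual_sum q))).
      by rewrite lerDl; apply: sumr_ge0.
    by move=> q; rewrite inE.
  apply: le_trans sum_scaled_dual_sum _.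
  rewrite ler_wpM2l ?divr_ge0 ?mulr_ge0//.
  rewrite lerXn2r ?nnegrE ?(ltW C0)//.
  by apply: sumr_ge0 => i _; apply: prodr_ge0 => a _; rewrite exprn_ge0 ?powR_ge0.
have K0 : 0 < (rho * (b ^ m)%:R) / (2 * C ^+ s) by rewrite divr_gt0 ?mulr_gt0.
have := ler_wpM2r (ltW K0) H.
have -> : #|bad_vectors c|%:R * c * (rho * (b ^ m)%:R / (2 * C ^+ s)) =
    4 * #|bad_vectors c|%:R.
  by rewrite {2}/c; field; rewrite !gt_eqF//.
suff -> : 2 * #|nonzero_vectors|%:R / (b ^ m)%:R * C ^+ s *
    (rho * (b ^ m)%:R / (2 * C ^+ s)) = rho * #|nonzero_vectors|%:R :> R by [].
by field; rewrite !gt_eqF.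
Qed.

Lemma dual_sum_good (c : R) (q : T) : q \in nonzero_vectors -> q \notin bad_vectors c ->
  dual_sum alpha (generator_of q) <= c `^ beta.
Proof.
rewrite [q \in bad_vectors c]inE => -> /=; rewrite -leNgt => qc.
rewrite /dual_sum (eq_bigr (fun k => scaled_weight k `^ beta)).
  by apply: sum_le_powR.
move=> k _; rewrite /scaled_weight (eq_bigr _ (fun j _ => walsh_weight_powR (k j))).
elim: (index_enum _) => [|j l IH]; first by rewrite !big_nil powR1.
by rewrite !big_cons IH powRM// prodr_ge0// => *; rewrite ?prodr_ge0// => *; rewrite exprn_ge0 ?powR_ge0.
Qed.

End bad_vectors.

End dual_average.

(** * U *)

Section final.
Context {R : realType}.
Variables (b s alpha : nat) (gamma : {set 'I_s} -> R).
Hypotheses (b_prime : prime b) (alpha_ge2 : (2 <= alpha)%N).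
Hypothesis gamma_gt0 : forall u, 0 < gamma u.
Local Notation F := 'F_b.
Local Notation B := (b%:R : R).

Let Gam : R := \sum_(u : {set 'I_s}) gamma u.

Let gamma_le u : gamma u <= Gam.
Proof.
rewrite /Gam (bigD1 u)//= lerDl; apply: sumr_ge0 => v _; exact: ltW.
Qed.

Let Gam_ge0 : 0 <= Gam. Proof. by apply: sumr_ge0 => v _; exact: ltW. Qed.

Let B1 : 1 < B. Proof. by rewrite ltr1n prime_gt1. Qed.
Let B0 : 0 < B. Proof. exact: lt_trans ltr01 B1. Qed.

Let eval_bound_ge0 : 0 <= @eval_bound R s alpha Gam.
Proof. by rewrite /eval_bound !mulr_ge0 ?exprn_ge0// prodr_ge0// => *; rewrite exprn_ge0. Qed.

Let rule_const_ge0 : 0 <= @rule_const R s alpha Gam b.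
Proof.
rewrite /rule_const mulr_ge0 ?invr_ge0 ?subr_ge0 ?(ltW B1)//.
by rewrite !mulr_ge0 ?exprn_ge0// ltW.
Qed.

Lemma good_vector_error (eps : R) : 0 < eps < alpha%:R ->
  exists2 c1 : R, 0 < c1 &
  forall (rho : R) (m n : nat) (p : {poly F}), 0 < rho < 1 -> (alpha * m <= n)%N ->
  irreducible_poly p -> size p = n.+1 ->
  exists2 Bad : {set {ffun 'I_s -> {poly_n F}}},
   (Bad \subset nonzero_vectors b s n) && (4 * #|Bad|%:R <= rho * #|nonzero_vectors b s n|%:R) &
   forall q f qv, (1 <= q)%E -> sob_space alpha gamma q f -> (sob_norm alpha gamma q f <= 1)%E ->
     qv \in nonzero_vectors b s n -> qv \notin Bad ->
     `|lattice_rule m n p (fun j => qv j : {poly F}) f - cube_integral f| <=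
      c1 / (rho * (b ^ m)%:R) `^ (alpha%:R - eps).
Proof.
move=> /andP[eps0 epsa].
pose beta := Num.max (alpha%:R - eps) 1 : R.
have alpha_gt0 : (0 < alpha)%N by exact: ltnW.
have beta1 : 1 <= beta by rewrite le_max lexx orbT.
have beta_lt : beta < alpha%:R by rewrite gt_max ltr1n alpha_ge2 andbT gtrBl.
have beta_ge : alpha%:R - eps <= beta by rewrite le_max lexx.
have [C C0' HC] := scaled_series_bounded b_prime alpha_gt0 beta1 beta_lt.
pose D := 8 * C ^+ s.
have D0 : 0 < D by rewrite mulr_gt0 ?exprn_gt0.
pose K1 := s%:R * @eval_bound R s alpha Gam + @rule_const R s alpha Gam b * D `^ beta.
have K10 : 0 <= K1.
  by apply: addr_ge0; [exact: mulr_ge0|apply: mulr_ge0 => //; exact: powR_ge0].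
exists (K1 + 2 * @eval_bound R s alpha Gam + 1).
  by rewrite ltr_wpDl//; apply: addr_ge0 => //; exact: mulr_ge0.
move=> rho m n p /andP[rho0 rho1] amn p_irr size_p.
have le_mn : (m <= n)%N by apply: leq_trans amn; rewrite leq_pmull.
set N : R := (b ^ m)%:R.
have N0 : 0 < N by rewrite ltr0n expn_gt0 prime_gt0.
have N1 : 1 <= N by rewrite ler1n expn_gt0 prime_gt0.
have rN0 : 0 < rho * N by rewrite mulr_gt0.
pose c := D / (rho * N).
exists (bad_vectors s alpha beta m n p c).
  apply/andP; split.
    by apply/fintype.subsetP => q; rewrite [q \in bad_vectors _ _ _ _ _ _ _]inE => /andP[].
  exact: (card_bad_vectors b_prime s p_irr size_p le_mn C0' rho0 (HC n)).
move=> q f qv q1 fs fn qG qB.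
have P0 : 0 < (rho * N) `^ (alpha%:R - eps) by rewrite powR_gt0.
rewrite ler_pdivlMr//.
have [rN1|rN1] := leP 1 (rho * N); last first.
  have P1 : (rho * N) `^ (alpha%:R - eps) <= 1.
    rewrite -[leRHS](powRr0 (rho * N)); apply: ger_powR; first by rewrite rN0 ltW.
    by rewrite subr_ge0 ltW.
  have := lattice_rule_error_trivial alpha_ge2 gamma_gt0 gamma_le q1 fs fn b_prime n m p
    (fun j => qv j : {poly F}).
  set e := `|_|; move=> he; apply: (@le_trans _ _ e); first by rewrite ler_piMr ?normr_ge0.
  by apply: le_trans he _; lra.
have err := lattice_rule_error alpha_ge2 gamma_gt0 gamma_le q1 fs fn b_prime n m p
    (fun j => qv j : {poly F}).
have dual_le := dual_sum_good b_prime beta1 qG qB.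
have Pb : (rho * N) `^ (alpha%:R - eps) <= (rho * N) `^ beta by exact: ler_powR.
have Pb0 : 0 < (rho * N) `^ beta by rewrite powR_gt0.
have Bn : B ^- n <= ((rho * N) `^ beta)^-1.
  rewrite lef_pV2 ?posrE ?exprn_gt0//.
  apply: (@le_trans _ _ (N `^ beta)).
    apply: ge0_ler_powR; rewrite ?nnegrE ?(ltW rN0) ?(ltW N0)//.
      by apply: le_trans beta1.
    by rewrite ger_pMl// ltW.
  apply: (@le_trans _ _ (N `^ alpha%:R)); first by apply: ler_powR => //; exact: ltW.
  rewrite powR_mulrn ?(ltW N0)// /N natrX -exprM ler_eXn2l//.
  by rewrite mulnC.
have cE : c `^ beta = D `^ beta * ((rho * N) `^ beta)^-1.
  by rewrite /c powRM ?(ltW D0) ?invr_ge0 ?(ltW rN0)// -powR_inv1 ?(ltW rN0)// powRAC powR_inv1// ltW.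
have err2 : `|lattice_rule m n p (fun j => qv j : {poly F}) f - cube_integral f| <=
   K1 * ((rho * N) `^ beta)^-1.
  apply: le_trans err _; rewrite /K1 mulrDl lerD//.
    by rewrite mulrA ler_wpM2l//; exact: mulr_ge0.
  rewrite -mulrA -cE ler_wpM2l//.
apply: (@le_trans _ _ (K1 * ((rho * N) `^ beta)^-1 * (rho * N) `^ beta)).
  by apply: ler_pM => //; exact: ltW.
by rewrite -mulrA mulVf ?gt_eqF// mulr1; have c0 := eval_bound_ge0; lra.
Qed.

End final.

(** * V *)

Lemma card_generating_vectors b n s r :
  #|generating_vectors b n s r| = (#|nonzero_vectors b s n| ^ r)%N.
Proof.
rewrite -[X in (_ ^ X)%N]card_ord -card_ffun_on; apply: eq_card => Q.
rewrite inE; apply/forallP/ffun_onP => H l; have := H l; rewrite inE//.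
Qed.

Lemma worst_case_median {R : realType} (b s alpha : nat) (gamma : {set 'I_s} -> R)
    (m n r : nat) (p : {poly 'F_b}) (q : \bar R)
    (Q : {ffun 'I_r -> {ffun 'I_s -> {poly_n 'F_b}}}) (Bad : {set {ffun 'I_s -> {poly_n 'F_b}}})
    (t : R) : odd r ->
  (forall l, Q l \in nonzero_vectors b s n) ->
  (forall f qv, sob_space alpha gamma q f -> (sob_norm alpha gamma q f <= 1)%E ->
     qv \in nonzero_vectors b s n -> qv \notin Bad ->
     `|lattice_rule m n p (fun j => qv j : {poly 'F_b}) f - cube_integral f| <= t) ->
  (#|[set l | Q l \in Bad]%SET| < (r.+1)./2)%N ->
  (worst_case_error alpha gamma q
     (median_rule m n p (fun l j => Q l j : {poly 'F_b})) <= t%:E)%E.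
Proof.
move=> odd_r QG good few_bad; apply: ge_ereal_sup => _ [f [fs fn] <-].
rewrite lee_fin; apply: median_close; rewrite size_map size_enum_ord//.
rewrite count_map; set P := preim _ _.
have : (#|[set l | Q l \notin Bad]%SET| <= count P (enum 'I_r))%N.
  rewrite cardE -size_filter; apply: uniq_leq_size; first exact: enum_uniq.
  move=> l; rewrite mem_enum inE mem_filter mem_enum andbT => Ql.
  exact: good.
apply: leq_trans.
have -> : [set l | Q l \notin Bad]%SET = (~: [set l | Q l \in Bad])%SET.
  by apply/setP => l; rewrite !inE.
have := cardsC [set l | Q l \in Bad]%SET; rewrite card_ord; move: few_bad.
move: #|[set l | Q l \in Bad]%SET| #|(~: _)%SET| => x y.
by have := odd_double_half r; rewrite odd_r; have := odd_double_half r.+1; rewrite /= odd_r/=; lia.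
Qed.

Theorem corollary3p8 (R : realType) (b s alpha : nat)
    (gamma : {set 'I_s} -> R) (eps : R)
    (b_prime : prime b) (s_ge1 : (1 <= s)%N) (alpha_ge2 : (2 <= alpha)%N)
    (gamma_gt0 : forall u, 0 < gamma u) (gamma_set0 : gamma finset.set0 = 1)
    (eps_gt0 : 0 < eps) (eps_lt : eps < alpha%:R) :
  exists c1 : R, 0 < c1 /\
    forall (r : nat) (rho : R), odd r -> (3 <= r)%N -> 0 < rho < 1 ->
    forall (m n : nat) (p : {poly 'F_b}) (q : \bar R),
      (1 <= m)%N -> (1 <= n)%N -> (alpha * m <= n)%N ->
      irreducible_poly p -> size p = n.+1 ->
      (1 <= q)%E ->
      finite_uniform_prob (generating_vectors b n s r) (fun Q =>
        (worst_case_error alpha gamma q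
           (median_rule m n p (fun l j => Q l j : {poly 'F_b})) <=
         (c1 / (rho * (b ^ m)%:R) `^ (alpha%:R - eps))%:E)%E) >=
      1 - rho ^+ (r.+1)./2 / 4.
Proof.
have eps_itv : 0 < eps < alpha%:R by rewrite eps_gt0.
have [c1 c1_gt0 Hc1] := good_vector_error b_prime alpha_ge2 gamma_gt0 eps_itv.
exists c1; split=> // r rho odd_r _ rho01 m n p q _ n_ge1 amn p_irr size_p q_ge1.
have [Bad /andP[Bad_sub card_Bad] good] := Hc1 rho m n p rho01 amn p_irr size_p.
set t := c1 / _ in good *; set E := (X in finite_uniform_prob _ X).
have rho_ge0 : 0 <= rho by case/andP: rho01 => /ltW.
have G_gt0 : (0 < #|nonzero_vectors b s n|)%N.
  have size1 : (size (1%R : {poly 'F_b}) <= n)%N by rewrite size_poly1.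
  apply/card_gt0P; exists [ffun=> NPoly size1]; rewrite inE; apply/forallP => j.
  by rewrite ffunE -val_eqE/= oner_neq0.
have := amplification_bound odd_r Bad_sub G_gt0 rho_ge0 card_Bad.
set M := (X in #|X|%:R) => card_M.
have A_gt0 : 0 < #|generating_vectors b n s r|%:R :> R.
  by rewrite card_generating_vectors ltr0n expn_gt0 G_gt0.
rewrite /finite_uniform_prob ler_pdivlMr// mulrBl mul1r.
rewrite lerBlDr.
apply: (@le_trans _ _ (#|[pred Q in generating_vectors b n s r | `[< E Q >]]|%:R + #|M|%:R)).
  rewrite -natrD ler_nat -[X in (_ <= X + _)%N]cardsE.
  apply: leq_trans (leq_card_setU _ _).
  apply: fintype.subset_leq_card; apply/fintype.subsetP => Q QA; rewrite finset.inE.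
  have QG l : Q l \in nonzero_vectors b s n.
    by rewrite inE; move: QA; rewrite inE => /forallP.
  have [many|few] := leqP (r.+1)./2 #|[set l | Q l \in Bad]%SET|.
    by apply/orP; right; rewrite inE many andbT; apply/forallP.
  apply/orP; left; rewrite inE; apply/andP; split=> //; apply/asboolP.
  apply: (worst_case_median odd_r QG _ few) => f qv; exact: good.
by rewrite lerD2l card_generating_vectors natrX.
Qed.
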